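(* Let $p\in(0,1)$ be fixed, $q=1-p$, and let $\widehat{\Upsilon}_n$ be the random Patricia trie built from $n$ independent random strings with i.i.d. $\mathrm{Be}(p)$ bits. Let $t$ be a full binary tree with $|t|_{\mathsf e}>1$. Then, as $n\to\infty$, $$q(\widehat{\Upsilon}_n;t\mid\widehat{\Upsilon}_n)=|t|_{\mathsf e}H^{-1}\psi_{\mathsf E}(\log n)+o_{\mathrm p}(1),\qquad q(\widehat{\Upsilon}_n;t)=|t|_{\mathsf e}H^{-1}\psi_{\mathsf E}(\log n)+o(1).$$ In particular, in the aperiodic case ($\log p/\log q\notin\mathbb{Q}$), $$q(\widehat{\Upsilon}_n;t\mid\widehat{\Upsilon}_n)\overset{\mathrm p}{\longrightarrow}\frac{\pi_t}{(|t|_{\mathsf e}-1)H},\qquad q(\widehat{\Upsilon}_n;t)\longrightarrow\frac{\pi_t}{(|t|_{\mathsf e}-1)H}.$$ For $|t|_{\mathsf e}=1$, $q(\widehat{\Upsilon}_n;t)=1$.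
   Context: Trees. A binary tree is a (finite, non-empty) rooted tree in which each child is labelled left or right and each node has at most one left and at most one right child. It is full if each node has outdegree 0 or 2. $|T|_{\mathsf e}$ is the number of leaves of $T$. For $v\in T$, the fringe tree $T^v$ consists of $v$ and all its descendants. For a (random) tree $T$ and a fixed tree $t$, $q(T;t)$ is the probability that a uniformly random leaf of $T$ lies in some fringe tree $T^w$ isomorphic to $t$, and $q(T;t\mid T)$ is the corresponding conditional probability given $T$. The compression $\widehat T$ of a binary tree $T$ is the full binary tree obtained by deleting all nodes of outdegree 1 and connecting the remaining nodes in the obvious way. For a full binary tree $t$, $\check{\mathfrak T}_t$ is the set of binary trees $T$ with $\widehat T=t$ whose root does not have outdegree 1. Tries. Given $n$ distinct infinite strings in $\{0,1\}^\infty$, the trie is built recursively: for $n=0$ it is empty; otherwise put all strings in a root; if $n=1$ stop; if $n\ge2$ pass all strings beginning with 0 (if any) to a left child and all strings beginning with 1 (if any) to a right child, and continue recursively at each child using the next letter. $\Upsilon_n$ is the random trie defined by $n$ independent strings whose letters are independent with $\mathbb{P}(1)=p$, $\mathbb{P}(0)=q=1-p$. The Patricia trie $\widehat{\Upsilon}_n$ is the compression of $\Upsilon_n$. Constants and functions. With $m=|t|_{\mathsf e}$: $\pi_t:=\mathbb{P}(\Upsilon_m\in\check{\mathfrak T}_t)$; $H:=-p\log p-q\log q$; $f^*_{\mathsf E}(s):=\pi_t\Gamma(m+s)/m!$ for $\operatorname{Re}s>-m$. If $\log p/\log q\notin\mathbb{Q}$ (aperiodic case), $\psi_{\mathsf E}(x):=f^*_{\mathsf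 E}(-1)=\pi_t/(m(m-1))$ for all $x$. If $\log p/\log q=a/b$ in lowest terms with $a,b\in\mathbb{N}$, let $d:=(-\log p)/a=(-\log q)/b$ and $\psi_{\mathsf E}(x):=\sum_{k=-\infty}^\infty f^*_{\mathsf E}\bigl(-1-\frac{2\pi k}{d}\mathrm i\bigr)e^{2\pi\mathrm i kx/d}$. (The number $q=1-p$ should not be confused with the functional $q(\cdot\,;\cdot)$.) $o_{\mathrm p}(1)$ denotes random variables converging to 0 in probability. *)

(* Defs.v *)
From HB Require Import structures.
From mathcomp Require Import all_boot all_order all_algebra.
From mathcomp Require Import complex.
From mathcomp Require Import all_classical all_reals all_analysis.
Import Order.TTheory GRing.Theory Num.Theory.
Import numFieldNormedType.Exports.

Set Implicit Arguments.
Unset Strict Implicit.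
Unset Printing Implicit Defensive.

Local Open Scope classical_set_scope.
Local Open Scope ring_scope.
Local Open Scope complex_scope.

(* [BNode l r] is a node with left child [l] and right child [r], where [BEmpty]
   means that the child is absent; the non-empty binary trees
   are the terms other than [BEmpty], and [BEmpty] is the trie of no strings. *)
Inductive bintree := BEmpty | BNode of bintree & bintree.

Definition BLeaf := BNode BEmpty BEmpty.

Fixpoint bintree_encode (T : bintree) : GenTree.tree unit :=
  if T is BNode l r then GenTree.Node 0 [:: bintree_encode l; bintree_encode r]
  else GenTree.Leaf tt.

Fixpoint bintree_decode (g : GenTree.tree unit) : option bintree :=
  match g with
  | GenTree.Leaf _ => Some BEmpty
  | GenTree.Node 0 [:: gl; gr] =>
      if (bintree_decode gl, bintree_decode gr) is (Some l, Some r)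
      then Some (BNode l r) else None
  | _ => None
  end.

Lemma bintree_encodeK : pcancel bintree_encode bintree_decode.
Proof. by elim=> [|l IHl r IHr] //=; rewrite IHl IHr. Qed.

HB.instance Definition _ :=
  Countable.copy bintree (pcan_type bintree_encodeK).

(* [full_tree] fails on [BEmpty], hence on every node of outdegree 1. *)
Fixpoint full_tree (T : bintree) : bool :=
  match T with
  | BEmpty => false
  | BNode BEmpty BEmpty => true
  | BNode l r => full_tree l && full_tree r
  end.

Definition root_outdegree (T : bintree) : nat :=
  if T is BNode l r then (l != BEmpty) + (r != BEmpty) else 0.

Fixpoint compression (T : bintree) : bintree :=
  match T with
  | BEmpty => BEmpty
  | BNode BEmpty BEmpty => BLeaf
  | BNode l BEmpty => compression l
  | BNode BEmpty r => compression r
  | BNode l r => BNode (compression l) (compression r)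
  end.

(* A node is named by its path from the root: [false] is left, [true] right. *)
Fixpoint nodes (T : bintree) : seq (seq bool) :=
  if T is BNode l r then
    [::] :: [seq false :: v | v <- nodes l] ++ [seq true :: v | v <- nodes r]
  else [::].

Fixpoint fringe (T : bintree) (v : seq bool) : bintree :=
  match v, T with
  | [::], _ => T
  | b :: v', BNode l r => fringe (if b then r else l) v'
  | _ :: _, BEmpty => BEmpty
  end.

Definition leaves (T : bintree) : seq (seq bool) :=
  [seq v <- nodes T | fringe T v == BLeaf].

Definition nleaves (T : bintree) : nat := size (leaves T).

(* The node [v] belongs to the fringe tree at [w] iff [w] is a prefix of [v];
   isomorphism of binary trees respects left and right, so it is equality. *)
Definition in_fringe_copy (t T : bintree) (v : seq bool) : bool :=
  has (fun w => prefix w v && (fringe T w == t)) (nodes T).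

(* q(T; t) for a deterministic T; for a random T it is q(T; t | T). *)
Definition q_cond (R : realType) (T t : bintree) : R :=
  (count (in_fringe_copy t T) (leaves T))%:R / (nleaves T)%:R.

Definition preimage_compression (t : bintree) : set bintree :=
  [set T | T <> BEmpty /\ compression T = t /\ root_outdegree T <> 1%N].

Definition bitstring := nat -> bool.

Definition bs_tail (s : bitstring) : bitstring := fun j => s j.+1.

Definition strings_with (b : bool) (ss : seq bitstring) : seq bitstring :=
  [seq bs_tail s | s <- ss & s 0%N == b].

Inductive is_trie : seq bitstring -> bintree -> Prop :=
| is_trie0 : is_trie [::] BEmpty
| is_trie1 s : is_trie [:: s] BLeaf
| is_trie2 ss l r : (1 < size ss)%N ->
    is_trie (strings_with false ss) l -> is_trie (strings_with true ss) r ->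
    is_trie ss (BNode l r).

(* The recursion terminates exactly when the strings are distinct; [BEmpty] is
   the value otherwise. *)
Definition trie (ss : seq bitstring) : bintree := xget BEmpty (is_trie ss).

Section Complex.
Context {R : realType}.
Implicit Types (x : R) (z : R[i]).

Definition cexp z : R[i] :=
  expR (complex.Re z) *
    cos (complex.Im z) +i* (expR (complex.Re z) * sin (complex.Im z)).

Definition cpow x z : R[i] := cexp (z * (ln x)%:C).

(* Euler's integral, for a positive real part. *)
Definition cGamma z : R[i] :=
  let g x := cpow x (z - 1) * (expR (- x))%:C in
  Rintegral lebesgue_measure `]0, +oo[ (fun x => complex.Re (g x)) +i*
  Rintegral lebesgue_measure `]0, +oo[ (fun x => complex.Im (g x)).

(* The topology of R[i] is found on R[i]^o; [Negz k] is - (k + 1). *)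
Definition bi_series (f : int -> R[i]^o) : R[i] :=
  limn (series (fun k => f (Posz k))) + limn (series (fun k => f (Negz k))).

Definition entropy (p : R) : R := - p * ln p - (1 - p) * ln (1 - p).

Definition log_ratio (p : R) : R := ln p / ln (1 - p).

Definition aperiodic (p : R) : Prop := forall r : rat, log_ratio p <> ratr r.

(* In the periodic case, [numq] is the numerator a in lowest terms of
   log p / log q > 0. *)
Definition log_span (p : R) : R :=
  - ln p / (numq (xget 0 [set r : rat | log_ratio p = ratr r]))%:~R.

End Complex.

Section RandomTrie.
Context {R : realType} {d : measure_display} {Omega : measurableType d}.
Variable P : probability Omega R.

(* [X i j] is the [j]-th letter of the [i]-th string. *)
Variable X : nat -> nat -> {RV P >-> bool}.

Definition iid_Be_bits (p : R) : Prop :=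
  (forall i j, P [set w | X i j w = true] = p%:E) /\
  (forall (J : seq (nat * nat)) (B : nat * nat -> set bool), uniq J ->
     P [set w | forall ij, ij \in J -> B ij (X ij.1 ij.2 w)] =
     (\prod_(ij <- J) P [set w | B ij (X ij.1 ij.2 w)])%E).

Definition random_trie (n : nat) (w : Omega) : bintree :=
  trie [seq (fun j => X i j w) | i <- iota 0 n].

Definition patricia (n : nat) (w : Omega) : bintree :=
  compression (random_trie n w).

(* For a random tree [T] and a leaf [V] that is uniform given [T], the
   probability that [V] lies in a copy of [t] integrates [q_cond]. *)
Definition q_mean (T : Omega -> bintree) (t : bintree) : R :=
  fine 'E_P[fun w => q_cond R (T w) t].

Definition pi_tree (t : bintree) : R :=
  fine (P [set w | preimage_compression t (random_trie (nleaves t) w)]).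

Definition fE (t : bintree) (s : R[i]) : R[i] :=
  (pi_tree t)%:C * cGamma ((nleaves t)%:R + s) / ((nleaves t)`!)%:R.

Definition psiE (p : R) (t : bintree) (x : R) : R[i] :=
  if `[< aperiodic p >] then fE t (- 1)
  else bi_series (fun k =>
    fE t (- 1 - (2 * pi * k%:~R / log_span p)%:C * 'i) *
    cexp ((2 * pi * k%:~R * x / log_span p)%:C * 'i)).

End RandomTrie.

(* Y n = o_p(1); for K = R[i], 0 < eps forces eps to be real. *)
Definition is_op1 (R : realType) (d : measure_display)
    (Omega : measurableType d) (P : probability Omega R) (K : numFieldType)
    (Y : nat -> Omega -> K) : Prop :=
  forall eps : K, 0 < eps ->
    P [set w | eps < `|Y n w|] @[n --> \oo] --> 0%E.

(* Main.v *)
Require Import Defs.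
From mathcomp Require Import all_boot all_order all_algebra.
From mathcomp Require Import complex.
From mathcomp Require Import all_classical all_reals all_analysis.
From mathcomp Require Import measurable_realfun.
From mathcomp Require Import ring lra zify.
Import Order.TTheory GRing.Theory Num.Theory.
Import numFieldNormedType.Exports.

Set Implicit Arguments.
Unset Strict Implicit.
Unset Printing Implicit Defensive.

Local Open Scope classical_set_scope.
Local Open Scope ring_scope.

(**
Every leaf below a copy of [t] lies in exactly one copy, so with [m] leaves in
[t] the conditional quantity is [m N / n], where [N] counts the copies of [t] in
the Patricia trie.  Splitting at the root, the mean [e n] of [N] satisfies
[e n = pi_t 1(n = m) + E (e K + e (n - K))] with [K] binomial.  Its increments
are bounded, so an Efron-Stein recursion gives a variance of order [n log n],
and by Chebyshev only [e n / n] matters.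

Replacing the binomial law by the Poisson law costs [O(1)]:
[e n = (pi_t / m!) E(n) + O(1)] with [E z = f z + E (p z) + E (q z)] and
[f z = z^m exp (- z)].  Then [E z / z] is asymptotically the [p], [q]-average of
its values at [p z] and [q z], so that near its limit superior it is also close
to it at all [p^i q^j z] with bounded [i], [j].  If [log p / log q] is
irrational these points are dense on the logarithmic scale, and a conserved
quantity, an antiderivative of [E z / z] in [log z], forces the limit
[(m - 2)! / H].  Otherwise [p], [q] are powers of [exp (- d)], and the same
argument on each class modulo [d] shows that [E z / z] approaches [d / H] times
the sum of [f / id] over the points [exp (k d) z], for [k] in [Z].  This
sum is Lipschitz and periodic in [log z]; unfolding the Gamma integral
identifies its Fourier coefficients with [Gamma (m - 1 - 2 pi i k / d) / d], and
Dirichlet's theorem sums the series [psi_E].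
*)

(** * Copies of a tree in a compressed trie *)

(** Expectations are limits of finite sums over trees of bounded height; integrals enter only when
    these sums are matched with [P], and a total mass tending to 1 disposes of coinciding strings. A
    split can leave all strings on one side, so every recursion has its unknown on both sides; a
    maximum principle replaces direct induction. The Poisson error is compared word by word: the
    mean is a sum over all finite words of binomial probabilities, and each term differs from its
    Poisson counterpart by 1/n times a weight whose sum over all words is O(n). Linear bounds of
    this kind are the obstacle. The candidate V z = z satisfies V z = V (p z) + V (q z) with
    equality and leaves no room for a source term; the correction z^2 / (1 + z) does, and it is
    still quadratic at 0 and linear at infinity. No renewal theorem and no Mellin inversion is used.
    Propagation from near-maximal points shows that the quotient is almost constant along long
    progressions, and an exact identity, summed over windows of lengths - ln p and - ln q, fixes the
    constant; the entropy is the mean window length. *)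

Fixpoint ncopies (t T : bintree) : nat :=
  if T is BNode l r then (T == t) + ncopies t l + ncopies t r else 0.

Lemma full_neq_BEmpty t : full_tree t -> t != BEmpty.
Proof. by case: t. Qed.

Lemma leaves_BNode l r : BNode l r != BLeaf ->
  leaves (BNode l r) = [seq false :: v | v <- leaves l] ++ [seq true :: v | v <- leaves r].
Proof.
move=> /negbTE nL; rewrite /leaves /= nL filter_cat !filter_map.
by congr (_ ++ _); congr map; apply: eq_filter.
Qed.

Lemma nleaves_BNode l r : BNode l r != BLeaf ->
  nleaves (BNode l r) = (nleaves l + nleaves r)%N.
Proof. by move=> h; rewrite /nleaves leaves_BNode // size_cat !size_map. Qed.

Lemma nleaves_BLeaf : nleaves BLeaf = 1%N. Proof. by []. Qed.

Lemma ncopies_small t T : (nleaves T < nleaves t)%N -> ncopies t T = 0%N.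
Proof.
elim: T => // l IHl r IHr h /=.
have -> : (BNode l r == t) = false.
  by apply/negbTE; apply: contraTneq h => ->; rewrite ltnn.
have [E|nE] := eqVneq (BNode l r) BLeaf; first by case: E => -> ->.
rewrite nleaves_BNode // in h.
by rewrite IHl ?IHr //; lia.
Qed.

Lemma nleaves_full_gt0 t : full_tree t -> (0 < nleaves t)%N.
Proof.
elim: t => // l IHl r IHr.
have [-> //|nE] := eqVneq (BNode l r) BLeaf.
rewrite nleaves_BNode //.
by case: l r IHl IHr nE => [|ll lr] [|rl rr] //= IHl IHr nE /andP[hl hr]; rewrite addn_gt0 IHl.
Qed.

Lemma full_BNodeP l r : full_tree (BNode l r) ->
  BNode l r = BLeaf \/ [/\ full_tree l, full_tree r & BNode l r != BLeaf].
Proof.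
case: l r => [|ll lr] [|rl rr] //=; first by left.
- by rewrite andbF.
- by move=> /andP[? ?]; right; split.
Qed.

Lemma in_fringe_copy_cons t l r b v : t != BEmpty ->
  in_fringe_copy t (BNode l r) (b :: v) =
  (BNode l r == t) || in_fringe_copy t (if b then r else l) v.
Proof.
move=> tE; rewrite /in_fringe_copy /= has_cat !has_map /=.
have aux b1 T1 : has (preim (cons b1) (fun w => prefix w (b :: v) &&
    (fringe (BNode l r) w == t))) (nodes T1) =
    (b1 == b) && has (fun w => prefix w v && (fringe (if b then r else l) w == t)) (nodes T1).
  elim: (nodes T1) => [|x s IH] /=; first by rewrite andbF.
  by rewrite IH; case: eqP => [->|].
by congr (_ || _); rewrite !aux; case: b {aux} => /=; rewrite ?orbF.
Qed.

(** Fullness gives both children of a copy at least one leaf each, so each has fewer leaves than [t]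
    and contains no further copy. *)
Lemma count_in_fringe_copy t T : full_tree t ->
  count (in_fringe_copy t T) (leaves T) = (nleaves t * ncopies t T)%N.
Proof.
move=> ft; have tE := full_neq_BEmpty ft.
elim: T => [|l IHl r IHr]; first by rewrite muln0.
have [E|nE] := eqVneq (BNode l r) BLeaf.
  case: E => -> ->; rewrite /leaves /= /in_fringe_copy /= !addn0.
  by rewrite orbF -/BLeaf; case: eqP => [<-|]; rewrite ?muln0.
rewrite leaves_BNode // count_cat !count_map /=.
have [Et|nEt] := eqVneq (BNode l r) t.
  have tn : t != BLeaf by rewrite -Et.
  have /full_BNodeP [Ebad|[fl fr _]] : full_tree (BNode l r) by rewrite Et.
    by rewrite Ebad eqxx in nE.
  have hs : nleaves t = (nleaves l + nleaves r)%N by rewrite -Et nleaves_BNode.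
  have nl := nleaves_full_gt0 fl; have nr := nleaves_full_gt0 fr.
  rewrite (@ncopies_small t l) ?hs; last by lia.
  rewrite (@ncopies_small t r) ?hs; last by lia.
  rewrite !addn0 muln1; congr addn.
  - by rewrite /nleaves -count_predT; apply: eq_count => v /=; rewrite in_fringe_copy_cons // Et eqxx.
  - by rewrite /nleaves -count_predT; apply: eq_count => v /=; rewrite in_fringe_copy_cons // Et eqxx.
rewrite add0n mulnDr -IHl -IHr.
by congr addn; apply: eq_count => v /=; rewrite in_fringe_copy_cons // (negbTE nEt).
Qed.

Lemma compression_BNode l r :
  compression (BNode l r) =
  if l == BEmpty then if r == BEmpty then BLeaf else compression r
  else if r == BEmpty then compression l else BNode (compression l) (compression r).
Proof. by case: l r => [|? ?] [|? ?]. Qed.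

Lemma compression_BEmpty T : (compression T == BEmpty) = (T == BEmpty).
Proof.
elim: T => // l IHl r IHr; rewrite compression_BNode.
case: (eqVneq l BEmpty) => [lE|lE]; case: (eqVneq r BEmpty) => [rE|rE] //.
- by rewrite IHr (negbTE rE).
- by rewrite IHl (negbTE lE).
Qed.

(** The root contributes a copy only if it survives compression; a root of outdegree 1 leaves the
    whole count to its child. *)
Definition toll (t l r : bintree) : bool :=
  [&& l != BEmpty, r != BEmpty & compression (BNode l r) == t].

Definition ncomp (t T : bintree) : nat := ncopies t (compression T).

Lemma ncomp_BNode t l r : (1 < nleaves t)%N ->
  ncomp t (BNode l r) = (toll t l r + ncomp t l + ncomp t r)%N.
Proof.
move=> ht; rewrite /ncomp /toll compression_BNode.
have [->|lE] := eqVneq l BEmpty; have [->|rE] := eqVneq r BEmpty => //=.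
  by rewrite !addn0; case: eqP ht => [<-|].
by rewrite addn0 add0n.
Qed.

Lemma toll_preimage t l r : (1 < nleaves t)%N ->
  preimage_compression t (BNode l r) <-> toll t l r.
Proof.
move=> ht; rewrite /preimage_compression /toll; split=> /=.
  move=> [_ []]; have [->|lE] := eqVneq l BEmpty; have [->|rE] := eqVneq r BEmpty => //.
  - by move=> E; rewrite -E nleaves_BLeaf in ht.
  - by rewrite -/(compression (BNode l r)) => -> _; rewrite eqxx.
move=> /and3P[lE rE /eqP E]; split => //; split => //.
by rewrite lE rE.
Qed.

Lemma ncomp_le t T : full_tree t -> (nleaves t * ncomp t T <= nleaves (compression T))%N.
Proof.
by move=> ft; rewrite /ncomp -count_in_fringe_copy // count_size.
Qed.

(** The recursion is on the tree, since a recursion on the strings need not terminate. The event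
    that the trie is [T] thereby becomes a condition on finitely many letters. *)
Fixpoint trieb (T : bintree) (ss : seq bitstring) : bool :=
  match T with
  | BEmpty => nilp ss
  | BNode l r =>
      if (size ss <= 1)%N then (size ss == 1)%N && (T == BLeaf)
      else trieb l (strings_with false ss) && trieb r (strings_with true ss)
  end.

Lemma is_trieP ss T : reflect (is_trie ss T) (trieb T ss).
Proof.
apply: (iffP idP).
  elim: T ss => [|l IHl r IHr] ss /=; first by case: ss => // _; constructor.
  case: leqP => hs.
    by case/andP => /eqP s1 /eqP [-> ->]; case: ss s1 {hs} => [|s [|]] //; constructor.
  by case/andP => hl hr; constructor => //; [exact: IHl|exact: IHr].
elim=> {ss T} //= ss l r hs _ hl _ hr.
by rewrite leqNgt hs hl hr.
Qed.

Lemma trieb_uniq ss T T' : trieb T ss -> trieb T' ss -> T = T'.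
Proof.
elim: T T' ss => [|l IHl r IHr] [|l' r'] ss //=.
- by case: ss.
- by case: ss.
- case: leqP => hs; first by case/andP => _ /eqP -> /andP[_ /eqP ->].
  by case/andP => hl hr /andP[hl' hr']; rewrite (IHl _ _ hl hl') (IHr _ _ hr hr').
Qed.

Lemma trieb_trie ss T : trieb T ss -> trie ss = T.
Proof.
move=> h; rewrite /trie; case: xgetP => [T' _ /is_trieP h'|/(_ T)].
  exact: trieb_uniq h' h.
by case; apply/is_trieP.
Qed.

Lemma trie_trieb ss T : T != BEmpty -> trie ss = T -> trieb T ss.
Proof.
rewrite /trie; case: xgetP => [T' _ /is_trieP h' _ <- //|_ /eqP TE E].
by rewrite E in TE.
Qed.

(** * The law of a trie *)

(* The law of (n - K, K) for K binomial, revealing one trial at a time. *)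
Fixpoint binE {R : pzRingType} (p : R) (n : nat) (g : nat -> nat -> R) : R :=
  if n is n'.+1 then
    (1 - p) * binE p n' (fun j k => g j.+1 k) + p * binE p n' (fun j k => g j k.+1)
  else g 0%N 0%N.

Section BinE.
Context {R : realType}.
Variable p : R.
Implicit Types (n : nat) (g : nat -> nat -> R).

Lemma eq_binE n g g' : (forall j k, (j + k)%N = n -> g j k = g' j k) ->
  binE p n g = binE p n g'.
Proof.
elim: n g g' => [|n IH] g g' h /=; first exact: h.
by congr (_ * _ + _ * _); apply: IH => j k jk; apply: h; lia.
Qed.

Lemma binED n g g' : binE p n (fun j k => g j k + g' j k) = binE p n g + binE p n g'.
Proof. by elim: n g g' => //= n IH g g'; rewrite !IH; ring. Qed.

Lemma binEZ n c g : binE p n (fun j k => c * g j k) = c * binE p n g.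
Proof. by elim: n g => //= n IH g; rewrite !IH; ring. Qed.

Lemma binEB n g g' : binE p n (fun j k => g j k - g' j k) = binE p n g - binE p n g'.
Proof. by elim: n g g' => //= n IH g g'; rewrite !IH; ring. Qed.

Lemma binE_cst n c : binE p n (fun _ _ => c) = c.
Proof. by elim: n => //= n ->; ring. Qed.

Lemma binE_sum (I : Type) (s : seq I) n (g : I -> nat -> nat -> R) :
  binE p n (fun j k => \sum_(i <- s) g i j k) = \sum_(i <- s) binE p n (g i).
Proof.
elim: s => [|i s IH].
  by rewrite big_nil (@eq_binE _ _ (fun _ _ => 0)) ?binE_cst // => j k _; rewrite big_nil.
rewrite big_cons -IH -binED; apply: eq_binE => j k _.
by rewrite big_cons.
Qed.

Lemma cvg_binE n (g : nat -> nat -> nat -> R) (g0 : nat -> nat -> R) :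
  (forall j k, (j + k)%N = n -> g L j k @[L --> \oo] --> g0 j k) ->
  binE p n (g L) @[L --> \oo] --> binE p n g0.
Proof.
elim: n g g0 => [|n IH] g g0 h /=; first exact: h.
apply: cvgD; (apply: cvgM; [exact: cvg_cst|]).
  by apply: (IH (fun L j k => g L j.+1 k) (fun j k => g0 j.+1 k)) => j k jk; apply: h; lia.
by apply: (IH (fun L j k => g L j k.+1) (fun j k => g0 j k.+1)) => j k jk; apply: h; lia.
Qed.

Hypotheses (p0 : 0 < p) (p1 : p < 1).

Let p0w : 0 <= p. Proof. exact: ltW. Qed.
Let q0w : 0 <= 1 - p. Proof. by rewrite subr_ge0 ltW. Qed.

Lemma le_binE n g g' : (forall j k, (j + k)%N = n -> g j k <= g' j k) ->
  binE p n g <= binE p n g'.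
Proof.
elim: n g g' => [|n IH] g g' h /=; first exact: h.
by apply: lerD; (apply: ler_wpM2l; [by []|]); apply: IH => j k jk; apply: h; lia.
Qed.

Lemma binE_ge0 n g : (forall j k, (j + k)%N = n -> 0 <= g j k) -> 0 <= binE p n g.
Proof. by move=> h; rewrite -(binE_cst n 0); apply: le_binE. Qed.

Lemma binE_left n : binE p n (fun j k => (j == n)%:R) = (1 - p) ^+ n.
Proof.
(* The offset [c] makes the claim stable under the recursion, which shifts [j] by one. *)
have aux c i : binE p i (fun j k => (j + c == i + c)%N%:R : R) = (1 - p) ^+ i.
  elim: i c => [|i IH] c /=; first by rewrite eqxx.
  rewrite [X in _ + p * X](@eq_binE _ _ (fun _ _ => 0)); last first.
    by move=> j k jk; case: eqP => //; lia.
  rewrite binE_cst mulr0 addr0 exprS -(IH c.+1); congr (_ * _).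
  by apply: eq_binE => j k _; congr ((nat_of_bool _)%:R); lia.
by rewrite -(aux 0%N n); apply: eq_binE => j k _; rewrite !addn0.
Qed.

Lemma binE_right n : binE p n (fun j k => (k == n)%:R) = p ^+ n.
Proof.
have aux c i : binE p i (fun j k => (k + c == i + c)%N%:R : R) = p ^+ i.
  elim: i c => [|i IH] c /=; first by rewrite eqxx.
  rewrite [X in _ * X + _](@eq_binE _ _ (fun _ _ => 0)); last first.
    by move=> j k jk; case: eqP => //; lia.
  rewrite binE_cst mulr0 add0r exprS -(IH c.+1); congr (_ * _).
  by apply: eq_binE => j k _; congr ((nat_of_bool _)%:R); lia.
by rewrite -(aux 0%N n); apply: eq_binE => j k _; rewrite !addn0.
Qed.

Lemma binE_mul n : binE p n (fun j k => j%:R * k%:R) = (1 - p) * p * (n%:R * (n%:R - 1)).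
Proof.
have hj i : binE p i (fun j k => j%:R : R) = (1 - p) * i%:R.
  elim: i => [|i IH] /=; first by rewrite mulr0.
  rewrite (@eq_binE _ _ (fun j k => j%:R + 1)); last by move=> j k _; rewrite -natr1.
  by rewrite binED binE_cst IH -(natr1 i); ring.
have hk i : binE p i (fun j k => k%:R : R) = p * i%:R.
  elim: i => [|i IH] /=; first by rewrite mulr0.
  rewrite [X in _ + _ * X](@eq_binE _ _ (fun j k => k%:R + 1)); last by move=> j k _; rewrite -natr1.
  by rewrite binED binE_cst IH -(natr1 i); ring.
elim: n => [|n IH] /=; first by rewrite !mul0r mulr0.
rewrite (@eq_binE _ (fun j k => j.+1%:R * k%:R) (fun j k => j%:R * k%:R + k%:R)); last first.
  by move=> j k _; rewrite -natr1; ring.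
rewrite (@eq_binE _ (fun j k => j%:R * k.+1%:R) (fun j k => j%:R * k%:R + j%:R)); last first.
  by move=> j k _; rewrite -natr1; ring.
by rewrite !binED hj hk IH -(natr1 n); ring.
Qed.

(* Efron-Stein, by induction on the number of trials. *)
Lemma binE_var n g c : (forall j k, (j + k).+1 = n -> `|g j.+1 k - g j k.+1| <= c) ->
  binE p n (fun j k => g j k ^+ 2) - binE p n g ^+ 2 <= n%:R * c ^+ 2.
Proof.
elim: n g => [|n IH] g h /=; first by rewrite mul0r subrr.
set a := binE p n (fun j k => g j.+1 k); set b := binE p n (fun j k => g j k.+1).
set A := binE _ _ (fun j k => _ j.+1 _ ^+ 2); set B := binE _ _ (fun j k => _ ^+ 2).
have hA : A - a ^+ 2 <= n%:R * c ^+ 2 by apply: IH => j k jk; apply: h; rewrite -jk; lia.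
have hB : B - b ^+ 2 <= n%:R * c ^+ 2 by apply: IH => j k jk; apply: h; rewrite -jk; lia.
have hab : `|a - b| <= c.
  have H j k : (j + k)%N = n -> - c <= g j.+1 k - g j k.+1 <= c.
    by move=> jk; rewrite -ler_norml; apply: h; rewrite jk.
  rewrite ler_norml -binEB; apply/andP; split.
    by rewrite -[leLHS](binE_cst n); apply: le_binE => j k /H /andP[].
  by rewrite -[leRHS](binE_cst n); apply: le_binE => j k /H /andP[].
have hab2 : (a - b) ^+ 2 <= c ^+ 2 by rewrite -real_normK ?num_real // ler_sqr // ?nnegrE // (le_trans _ hab).
(* Total variance over one trial: the mean of the two conditional variances plus the variance of the
   conditional mean. *)
have -> : (1 - p) * A + p * B - ((1 - p) * a + p * b) ^+ 2 =
   (1 - p) * (A - a ^+ 2) + p * (B - b ^+ 2) + (1 - p) * p * (a - b) ^+ 2 by ring.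
have -> : n.+1%:R * c ^+ 2 = (1 - p) * (n%:R * c ^+ 2) + p * (n%:R * c ^+ 2) + c ^+ 2.
  by rewrite -(natr1 n); ring.
apply: lerD; first by apply: lerD; apply: ler_wpM2l.
apply: le_trans hab2; rewrite -[leRHS]mul1r ler_wpM2r ?sqr_ge0 //.
by apply: mulr_ile1 => //; [move: p0; lra|exact: ltW].
Qed.

(* The terms with [j = n] or [k = n] occur on both sides; their total weight is
   less than 1. *)
Lemma binE_comparison (al be : R) (n0 : nat) (D : nat -> R) :
  0 <= al -> 0 <= be ->
  (forall n, (n0 <= n)%N -> (0 < n)%N /\ al * (1 - p) ^+ n + be * p ^+ n < 1) ->
  (forall n, (n < n0)%N -> D n <= 0) ->
  (forall n, (n0 <= n)%N -> D n <= binE p n (fun j k => al * D j + be * D k)) ->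
  forall n, D n <= 0.
Proof.
move=> al0 be0 hn hb hr n; have [N] := ubnP n; elim: N n => // N IH n nN.
have [nn0|n0n] := ltnP n n0; first exact: hb.
have [n_gt0 hlt] := hn _ n0n.
rewrite leNgt; apply/negP => Dn0.
have : D n <= (al * (1 - p) ^+ n + be * p ^+ n) * D n.
  apply: (le_trans (hr n n0n)).
  apply: (le_trans (y := binE p n (fun j k => (al * D n) * (j == n)%:R + (be * D n) * (k == n)%:R))).
    apply: le_binE => j k jk; apply: lerD.
      rewrite -mulrA ler_wpM2l //; case: eqP => [->|jn]; first by rewrite mulr1.
      by rewrite mulr0; apply: IH; lia.
    rewrite -mulrA ler_wpM2l //; case: eqP => [->|jn]; first by rewrite mulr1.
    by rewrite mulr0; apply: IH; lia.
  rewrite binED !binEZ binE_left binE_right.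
  by rewrite le_eqVlt; apply/orP; left; apply/eqP; ring.
by rewrite leNgt gtr_pMl // hlt.
Qed.

End BinE.

Lemma cvg_succP (R : realType) (u : nat -> R) (l : R) :
  (u L.+1 @[L --> \oo] --> l) <-> (u L @[L --> \oo] --> l).
Proof. by rewrite -(cvg_shiftS u). Qed.

(* The probability that the trie of [n] random strings is [T]. *)
Fixpoint trie_mass {R : pzRingType} (p : R) (T : bintree) (n : nat) : R :=
  match T with
  | BEmpty => (n == 0)%:R
  | BNode l r =>
      if (n <= 1)%N then ((n == 1) && (T == BLeaf))%:R
      else binE p n (fun j k => trie_mass p l j * trie_mass p r k)
  end.

(** The trees with at most [L] levels: finite truncations that exhaust all trees. *)
Fixpoint trees (L : nat) : seq bintree :=
  if L is L'.+1 then
    BEmpty :: [seq BNode l r | l <- trees L', r <- trees L']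
  else [:: BEmpty].

Lemma trees_uniq L : uniq (trees L).
Proof.
elim: L => //= L IH; apply/andP; split; first by apply/allpairsP => -[[l r] [_ _]].
by apply: allpairs_uniq => // -[l r] [l' r'] _ _ /= [-> ->].
Qed.

(** * Truncated expectations over the law of the trie *)

Section TrieLaw.
Context {R : realType}.
Variable p : R.
Hypotheses (p0 : 0 < p) (p1 : p < 1).
Implicit Types (phi psi : bintree -> R).

Let p0w : 0 <= p. Proof. exact: ltW. Qed.
Let q0w : 0 <= 1 - p. Proof. by rewrite subr_ge0 ltW. Qed.

Definition treeE (L n : nat) phi : R := \sum_(T <- trees L) trie_mass p T n * phi T.

Lemma trie_mass_ge0 T n : 0 <= trie_mass p T n.
Proof.
elim: T n => [|l IHl r IHr] n //=; case: ifP => // _.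
by apply: binE_ge0 => // j k _; rewrite mulr_ge0.
Qed.

(** Every string ends in a leaf of its own, and compression keeps the leaves. *)
Lemma trie_mass_neq0 T n : trie_mass p T n != 0 ->
  nleaves (compression T) = n /\ (T == BEmpty) = (n == 0%N).
Proof.
elim: T n => [|l IHl r IHr] n.
  case: n => [|n] /=; first by split.
  by move=> /eqP; case.
have -> : trie_mass p (BNode l r) n = if (n <= 1)%N then ((n == 1) && (BNode l r == BLeaf))%:R
  else binE p n (fun j k => trie_mass p l j * trie_mass p r k) by [].
case: leqP => hn.
  rewrite pnatr_eq0 eqb0 negbK => /andP[/eqP -> /eqP ->].
  by rewrite nleaves_BLeaf.
move=> h; split; last by case: n hn {h}.
apply/eqP; apply: contra_neqT h => h.
rewrite (@eq_binE _ _ _ _ (fun _ _ => 0)) ?binE_cst // => j k jk.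
apply/eqP; apply: contraNT h; rewrite mulf_eq0 negb_or => /andP[/IHl [hl lE] /IHr [hr rE]].
rewrite compression_BNode lE rE.
case: (eqVneq j 0%N) => j0; case: (eqVneq k 0%N) => k0; rewrite ?hl ?hr; [lia..|].
rewrite nleaves_BNode ?hl ?hr; first by rewrite jk.
by apply/eqP => -[E _]; move: lE; rewrite -compression_BEmpty E eqxx (negbTE j0).
Qed.

Lemma treeE_eq L n phi psi : (forall T, trie_mass p T n != 0 -> phi T = psi T) ->
  treeE L n phi = treeE L n psi.
Proof.
move=> h; apply: eq_bigr => T _.
by have [->|/h ->] := eqVneq (trie_mass p T n) 0; rewrite ?mul0r.
Qed.

Lemma treeE_le L n phi psi : (forall T, trie_mass p T n != 0 -> phi T <= psi T) ->
  treeE L n phi <= treeE L n psi.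
Proof.
move=> h; apply: ler_sum => T _.
have [->|/h le] := eqVneq (trie_mass p T n) 0; first by rewrite !mul0r.
by rewrite ler_wpM2l ?trie_mass_ge0.
Qed.

Lemma treeED L n phi psi :
  treeE L n (fun T => phi T + psi T) = treeE L n phi + treeE L n psi.
Proof. by rewrite -big_split; apply: eq_bigr => T _; rewrite mulrDr. Qed.

Lemma treeEZ L n c phi : treeE L n (fun T => c * phi T) = c * treeE L n phi.
Proof. by rewrite /treeE mulr_sumr; apply: eq_bigr => T _; rewrite mulrCA. Qed.

Lemma treeE_ge0 L n phi : (forall T, trie_mass p T n != 0 -> 0 <= phi T) -> 0 <= treeE L n phi.
Proof.
move=> h; apply: sumr_ge0 => T _.
have [->|/h le] := eqVneq (trie_mass p T n) 0; first by rewrite mul0r.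
by rewrite mulr_ge0 ?trie_mass_ge0.
Qed.

Lemma treeE0 L phi : treeE L 0 phi = phi BEmpty.
Proof.
have h T : T != BEmpty -> trie_mass p T 0 = 0 by case: T.
case: L => [|L]; rewrite /treeE /= big_cons /= mul1r ?big_nil ?addr0 //.
by rewrite big_seq big1 ?addr0 // => T /allpairsP[[l r] [_ _ ->]]; rewrite h ?mul0r.
Qed.

Lemma treeES L n phi : (1 < n)%N -> treeE L.+1 n phi =
  binE p n (fun j k => treeE L j (fun l => treeE L k (fun r => phi (BNode l r)))).
Proof.
move=> n1; rewrite /treeE /= big_cons /= [(n == 0)%N]gtn_eqF ?(ltnW n1) // mul0r add0r.
rewrite big_allpairs_dep /=.
rewrite (eq_binE _ (g' := fun j k => \sum_(l <- trees L) \sum_(r <- trees L)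
    trie_mass p l j * trie_mass p r k * phi (BNode l r))); last first.
  by move=> j k _; apply: eq_bigr => l _; rewrite mulr_sumr; apply: eq_bigr => r _; rewrite mulrA.
rewrite binE_sum; apply: eq_bigr => l _; rewrite binE_sum; apply: eq_bigr => r _.
rewrite leqNgt n1 /= mulrC -binEZ.
by apply: eq_binE => j k _; rewrite mulrC.
Qed.

Lemma treeE1 L phi : treeE L.+1 1 phi = phi BLeaf.
Proof.
rewrite /treeE /= big_cons mul0r add0r.
have /= /andP[_ hun] := trees_uniq L.+1.
have hin : BLeaf \in [seq BNode l r | l <- trees L, r <- trees L].
  by apply/allpairsP; exists (BEmpty, BEmpty); split => //=; case: L {hun} => //= L; exact: mem_head.
rewrite (bigD1_seq BLeaf hin hun) /=.
rewrite mul1r big_seq_cond big1 ?addr0 // => T /andP[/allpairsP[[l r] [_ _ ->]]].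
by rewrite /= => /negbTE ->; rewrite mul0r.
Qed.

Lemma treeE_mono L n phi : (forall T, 0 <= phi T) -> treeE L n phi <= treeE L.+1 n phi.
Proof.
elim: L n phi => [|L IH] n phi h.
  by rewrite /treeE /= !big_cons !big_nil !addr0 lerDl mulr_ge0 ?trie_mass_ge0.
case: n => [|[|n]]; [by rewrite !treeE0|by rewrite !treeE1|].
rewrite !treeES //; apply: le_binE => // j k _.
apply: (le_trans (IH _ _ _)); last by apply: treeE_le => T _; apply: IH.
by move=> T; apply: treeE_ge0.
Qed.

Lemma treeE_const L n c : treeE L n (fun=> c) = c * treeE L n (fun=> 1).
Proof. by rewrite -treeEZ; apply: treeE_eq => T _; rewrite mulr1. Qed.

Lemma treeE_mass_le1 L n : treeE L n (fun=> 1) <= 1.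
Proof.
elim: L n => [|L IH] n.
  by rewrite /treeE big_cons big_nil /= addr0 mulr1 lern1; case: (n == 0%N).
case: n => [|[|n]]; [by rewrite treeE0|by rewrite treeE1|].
rewrite treeES // -[leRHS](binE_cst p n.+2); apply: le_binE => // j k _.
by rewrite treeE_const mulr_ile1 // treeE_ge0.
Qed.

(** The bound is the expected number of ordered pairs of strings that agree on their first [L]
    letters; without such a pair the trie has at most [L.+1] levels. *)
Lemma treeE1_mass L n : 1 - treeE L.+1 n (fun=> 1) <=
  n%:R * (n%:R - 1) * (p ^+ 2 + (1 - p) ^+ 2) ^+ L.
Proof.
set c := p ^+ 2 + _; have c0 : 0 <= c by rewrite addr_ge0 ?exprn_ge0.
elim: L n => [|L IH] n.
  rewrite expr0 mulr1; case: n => [|[|n]]; rewrite ?treeE0 ?treeE1 ?subrr ?mulr0 ?mul0r //.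
  apply: (@le_trans _ _ 1); first by rewrite lerBlDr lerDl treeE_ge0.
  have : (2 : R) <= n.+2%:R by rewrite ler_nat.
  by move: (n.+2%:R) => x; nra.
case: n => [|[|n]]; rewrite ?treeE0 ?treeE1 ?subrr ?mulr0 ?mul0r //.
rewrite treeES //; set N := n.+2.
have tE := treeE_mass_le1 L.+1.
have sE j k : treeE L.+1 j (fun=> treeE L.+1 k (fun=> 1)) =
  treeE L.+1 j (fun=> 1) * treeE L.+1 k (fun=> 1).
  by rewrite treeE_const mulrC.
rewrite -[X in X - _](binE_cst p N) -binEB.
(* The mass factorizes over the two subtrees, and 1 - x y <= (1 - x) + (1 - y) on the unit
   interval. *)
apply: (le_trans (y := binE p N (fun j k => (j%:R * (j%:R - 1) + k%:R * (k%:R - 1)) * c ^+ L))).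
  apply: le_binE => // j k _; rewrite sE mulrDl; apply: le_trans (lerD (IH j) (IH k)).
  have := tE j; have := tE k; set x := treeE _ j _; set y := treeE _ k _ => hx hy.
  have := mulr_ge0 (_ : 0 <= 1 - x) (_ : 0 <= 1 - y); rewrite !subr_ge0 => /(_ hy hx); lra.
(* With j + k = n, j (j - 1) + k (k - 1) = n (n - 1) - 2 j k. The mean p q n (n - 1) of j k then
   produces the factor 1 - 2 p q = p^2 + q^2. *)
rewrite (eq_binE _ (g' := fun j k => c ^+ L * (N%:R * (N%:R - 1) - 2 * (j%:R * k%:R)))); last first.
  by move=> j k <-; rewrite natrD; ring.
rewrite binEZ binEB binE_cst binEZ binE_mul exprS /c le_eqVlt; apply/orP; left; apply/eqP; ring.
Qed.

End TrieLaw.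

(** * First and second moment of the number of copies *)

Section TrieMoments.
Context {R : realType}.
Variable p : R.
Hypotheses (p0 : 0 < p) (p1 : p < 1).
Implicit Types (phi psi : bintree -> R).

Let p0w : 0 <= p. Proof. exact: ltW. Qed.
Let q0w : 0 <= 1 - p. Proof. by rewrite subr_ge0 ltW. Qed.

Definition treeLim n phi : R := limn (fun L => treeE p L n phi).

Lemma treeE_cvg n phi (C : R) : (forall T, 0 <= phi T) ->
  (forall T, trie_mass p T n != 0 -> phi T <= C) ->
  treeE p L n phi @[L --> \oo] --> treeLim n phi.
Proof.
move=> h0 hC; apply: nondecreasing_is_cvgn.
  by apply/nondecreasing_seqP => L; apply: treeE_mono.
exists `|C| => _ [L _ <-].
apply: (@le_trans _ _ (treeE p L n (fun=> `|C|))).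
  by apply: treeE_le => // T h; apply: le_trans (hC T h) (ler_norm _).
by rewrite treeE_const ler_piMr // treeE_mass_le1.
Qed.

Lemma treeE_mass_cvg n : treeE p L n (fun=> 1) @[L --> \oo] --> (1 : R).
Proof.
apply/(cvg_succP (fun L => treeE p L n (fun=> 1))).
have h : n%:R * (n%:R - 1) * (p ^+ 2 + (1 - p) ^+ 2) ^+ L @[L --> \oo] --> (0 : R).
  rewrite -(mulr0 (n%:R * (n%:R - 1))); apply: cvgM; first exact: cvg_cst.
  apply: cvg_expr; rewrite ger0_norm ?addr_ge0 ?exprn_ge0 //.
  by move: p0 p1 => ? ?; nra.
apply: (@squeeze_cvgr _ _ _ _ (fun L => 1 - n%:R * (n%:R - 1) * (p ^+ 2 + (1 - p) ^+ 2) ^+ L) (fun=> 1)).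
- near=> L; rewrite treeE_mass_le1 // andbT.
  by have := treeE1_mass p0 p1 L n; lra.
- by rewrite -[X in _ --> X]subr0; apply: cvgB => //; exact: cvg_cst.
- exact: cvg_cst.
Unshelve. all: by end_near. Qed.

Variable t : bintree.
Hypotheses (ft : full_tree t) (m2 : (1 < nleaves t)%N).
Let m := nleaves t.

Let cp T : R := (ncomp t T)%:R.
Let tollT T : R := if T is BNode l r then (toll t l r)%:R else 0.

Definition mean_copies n : R := treeLim n cp.
Definition sqmean_copies n : R := treeLim n (fun T => cp T ^+ 2).
Definition mean_toll n : R := treeLim n tollT.

Let cp_le n T : trie_mass p T n != 0 -> cp T <= n%:R.
Proof.
move=> /(trie_mass_neq0 p0 p1) [h _]; rewrite ler_nat -h; apply: leq_trans (ncomp_le T ft).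
by rewrite leq_pmull // ltnW.
Qed.

Let cp_sqr_le n T : trie_mass p T n != 0 -> cp T ^+ 2 <= n%:R ^+ 2.
Proof. by move=> /cp_le h; rewrite ler_sqr // nnegrE ler0n. Qed.

Let tollT_ge0 T : 0 <= tollT T. Proof. by case: T => //= l r; rewrite ler0n. Qed.
Let tollT_le1 T : tollT T <= 1. Proof. by case: T => //= l r; rewrite lern1; case: (toll _ _ _). Qed.

Lemma mean_copies_cvg n : treeE p L n cp @[L --> \oo] --> mean_copies n.
Proof. by apply: (treeE_cvg (C := n%:R)) => // T; exact: cp_le. Qed.

Lemma sqmean_copies_cvg n :
  treeE p L n (fun T => cp T ^+ 2) @[L --> \oo] --> sqmean_copies n.
Proof. by apply: (treeE_cvg (C := n%:R ^+ 2)) => T; [exact: sqr_ge0|exact: cp_sqr_le]. Qed.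

Lemma mean_toll_cvg n : treeE p L n tollT @[L --> \oo] --> mean_toll n.
Proof. by apply: (treeE_cvg (C := 1)). Qed.

Lemma mean_copies_ge0 n : 0 <= mean_copies n.
Proof.
apply: limr_ge; first by apply/cvg_ex; eexists; exact: mean_copies_cvg.
by near=> L; apply: treeE_ge0 => // T _; rewrite ler0n.
Unshelve. all: by end_near. Qed.

Lemma mean_copies_le n : mean_copies n <= n%:R.
Proof.
apply: limr_le; first by apply/cvg_ex; eexists; exact: mean_copies_cvg.
near=> L; apply: (@le_trans _ _ (treeE p L n (fun=> n%:R))).
  by apply: treeE_le => // T; exact: cp_le.
by rewrite treeE_const ler_piMr // treeE_mass_le1.
Unshelve. all: by end_near. Qed.

Lemma sqmean_copies_le n : sqmean_copies n <= n%:R ^+ 2.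
Proof.
apply: limr_le; first by apply/cvg_ex; eexists; exact: sqmean_copies_cvg.
near=> L; apply: (@le_trans _ _ (treeE p L n (fun=> n%:R ^+ 2))).
  by apply: treeE_le => // T; exact: cp_sqr_le.
by rewrite treeE_const ler_piMr ?exprn_ge0 // treeE_mass_le1.
Unshelve. all: by end_near. Qed.

Lemma mean_toll_ge0 n : 0 <= mean_toll n.
Proof.
apply: limr_ge; first by apply/cvg_ex; eexists; exact: mean_toll_cvg.
by near=> L; apply: treeE_ge0.
Unshelve. all: by end_near. Qed.

Lemma mean_toll_le1 n : mean_toll n <= 1.
Proof.
apply: limr_le; first by apply/cvg_ex; eexists; exact: mean_toll_cvg.
near=> L; apply: (@le_trans _ _ (treeE p L n (fun=> 1))); last exact: treeE_mass_le1.
by apply: treeE_le.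
Unshelve. all: by end_near. Qed.

Let tollT0 n T : n != m -> trie_mass p T n != 0 -> tollT T = 0.
Proof.
move=> nm /(trie_mass_neq0 p0 p1) [h _]; case: T h => //= l r h.
case: (boolP (toll t l r)) => // /and3P[_ _ /eqP E].
by rewrite -/(compression (BNode l r)) E in h; rewrite -h eqxx in nm.
Qed.

Lemma mean_toll_neq n : n != m -> mean_toll n = 0.
Proof.
move=> nm; apply: cvg_lim => //.
have -> : (fun L => treeE p L n tollT) = (fun=> 0).
  apply/funext => L; rewrite (@treeE_eq _ _ L n _ (fun=> 0)) => [|T]; last exact: tollT0.
  by rewrite treeE_const mul0r.
exact: cvg_cst.
Qed.

Lemma mean_copies0 : mean_copies 0 = 0.
Proof. by apply/eqP; rewrite eq_le mean_copies_ge0 mean_copies_le. Qed.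

Lemma mean_copies1 : mean_copies 1 = 0.
Proof.
apply: cvg_lim => //; apply/(cvg_succP (fun L => treeE p L 1 cp)).
have -> : (fun L => treeE p L.+1 1 cp) = (fun=> 0).
  apply/funext => L; rewrite treeE1 // /cp /ncomp /= !addn0.
  by rewrite -/BLeaf; case: eqP m2 => // <-.
exact: cvg_cst.
Qed.

Lemma mean_copies_rec n :
  mean_copies n = binE p n (fun j k => mean_copies j + mean_copies k) + mean_toll n.
Proof.
case: n => [|[|n]].
- by rewrite /= mean_copies0 mean_toll_neq ?addr0 // /m; case: (nleaves t) m2.
- by rewrite /= mean_copies0 mean_copies1 mean_toll_neq ?addr0 ?mulr0 ?addr0 // /m; case: (nleaves t) m2 => [|[]].
apply: cvg_lim => //; apply/(cvg_succP (fun L => treeE p L n.+2 cp)).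
(* Given the sizes, the two subtrees are independent. Each count is multiplied by the truncated mass
   of the other side, which becomes 1 only in the limit. *)
pose g L j k := treeE p L j cp * treeE p L k (fun=> 1) + treeE p L j (fun=> 1) * treeE p L k cp.
have -> : (fun L => treeE p L.+1 n.+2 cp) =
    (fun L => binE p n.+2 (g L) + treeE p L.+1 n.+2 tollT).
  apply/funext => L; rewrite !treeES // -binED; apply: eq_binE => j k _.
  rewrite /g.
  have -> : treeE p L j cp * treeE p L k (fun=> 1) = treeE p L j (fun l => cp l * treeE p L k (fun=> 1)).
    by rewrite mulrC -treeEZ; apply: treeE_eq => l _; rewrite mulrC.
  have -> : treeE p L j (fun=> 1) * treeE p L k cp = treeE p L j (fun=> treeE p L k cp).
    by rewrite mulrC -treeE_const.
  rewrite -!treeED; apply: treeE_eq => l _; rewrite -treeE_const -!treeED.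
  by apply: treeE_eq => r _; rewrite /cp ncomp_BNode // !natrD /= /tollT; ring.
apply: cvgD; last first.
  by apply/(cvg_succP (fun L => treeE p L n.+2 tollT)); exact: mean_toll_cvg.
apply: cvg_binE => j k _.
rewrite -[X in _ --> X + _]mulr1 -[X in _ --> _ + X]mul1r.
by apply: cvgD; apply: cvgM; try exact: mean_copies_cvg; exact: treeE_mass_cvg.
Qed.

(** Above size [m] the root is never a copy, so the count is exactly the sum of two counts that are
    independent given the split. *)
Lemma sqmean_copies_rec n : (m < n)%N ->
  sqmean_copies n = binE p n (fun j k =>
    sqmean_copies j + sqmean_copies k + 2 * (mean_copies j * mean_copies k)).
Proof.
move=> mn; have n1 : (1 < n)%N by exact: ltn_trans mn.
apply: cvg_lim => //; apply/(cvg_succP (fun L => treeE p L n (fun T => cp T ^+ 2))).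
pose g L j k := treeE p L j (fun T => cp T ^+ 2) * treeE p L k (fun=> 1) +
  treeE p L j (fun=> 1) * treeE p L k (fun T => cp T ^+ 2) +
  2 * (treeE p L j cp * treeE p L k cp).
have -> : (fun L => treeE p L.+1 n (fun T => cp T ^+ 2)) = (fun L => binE p n (g L)).
  apply/funext => L.
  rewrite (@treeE_eq _ _ L.+1 n _ (fun T => if T is BNode l r then (cp l + cp r) ^+ 2 else 0)); last first.
    move=> [|l r] h; first by rewrite /cp /ncomp /= expr0n.
    have := tollT0 (negbT (gtn_eqF mn)) h; rewrite /tollT /cp ncomp_BNode // => /eqP.
    by rewrite pnatr_eq0 => /eqP ->; rewrite add0n natrD.
  rewrite treeES //; apply: eq_binE => j k _; rewrite /g.
  have -> : treeE p L j (fun T => cp T ^+ 2) * treeE p L k (fun=> 1) =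
      treeE p L j (fun l => cp l ^+ 2 * treeE p L k (fun=> 1)).
    by rewrite mulrC -treeEZ; apply: treeE_eq => l _; rewrite mulrC.
  have -> : treeE p L j (fun=> 1) * treeE p L k (fun T => cp T ^+ 2) =
      treeE p L j (fun=> treeE p L k (fun T => cp T ^+ 2)).
    by rewrite mulrC -treeE_const.
  have -> : 2 * (treeE p L j cp * treeE p L k cp) = treeE p L j (fun l => (2 * cp l) * treeE p L k cp).
    rewrite [treeE p L j cp * _]mulrC -treeEZ -treeEZ; apply: treeE_eq => l _; ring.
  rewrite -!treeED; apply: treeE_eq => l _; rewrite -treeE_const -treeEZ -!treeED.
  by apply: treeE_eq => r _; ring.
apply: cvg_binE => j k _.
rewrite -[X in _ --> X + _ + _]mulr1 -[X in _ --> _ + X + _]mul1r.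
apply: cvgD; last first.
  by apply: cvgM; [exact: cvg_cst|apply: cvgM; exact: mean_copies_cvg].
by apply: cvgD; apply: cvgM; try exact: sqmean_copies_cvg; exact: treeE_mass_cvg.
Qed.

Let pq_lt1 n : (0 < n)%N -> (1 - p) * (1 - p) ^+ n + p * p ^+ n <= 1 - 2 * (p * (1 - p)).
Proof.
case: n => // n _; rewrite !exprS.
have : (1 - p) ^+ n <= 1 by rewrite exprn_ile1 //; move: p0; lra.
have : p ^+ n <= 1 by rewrite exprn_ile1 // ltW.
move=> /(ler_wpM2l (sqr_ge0 p)) h1 /(ler_wpM2l (sqr_ge0 (1 - p))) h2.
rewrite !mulrA -!expr2; apply: (le_trans (lerD h2 h1)); rewrite !mulr1.
by rewrite le_eqVlt; apply/orP; left; apply/eqP; ring.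
Qed.

(* The increments inherit the recursion through the path of one extra string;
   sizes along that path drop out of {m - 1, m} at a geometric rate. *)
Lemma mean_copies_lip n :
  `|mean_copies n.+1 - mean_copies n| <= 1 / (p * (1 - p)).
Proof.
(* The subtree entered by the extra string is strictly smaller with probability at least 2 p q, so a
   drop of height [A] pays for a toll increment of at most 1. *)
pose A : R := 1 / (2 * (p * (1 - p))).
pose de i := mean_copies i.+1 - mean_copies i.
(* A barrier with one jump at each of the two sizes where the toll increment can be nonzero; its
   height [2 * A] is the final bound. *)
pose y (i : nat) : R := A * ((m.-1 <= i)%N%:R + (m <= i)%N%:R).
have pq0 : 0 < p * (1 - p) by rewrite mulr_gt0 // subr_gt0.
have A0 : 0 <= A by rewrite divr_ge0 // mulr_ge0 // ltW.
have AE : A * (2 * (p * (1 - p))) = 1 by rewrite /A divfK // gt_eqF // mulr_gt0.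
have m1 : (0 < m.-1)%N by rewrite /m; case: (nleaves t) m2 => [|[]].
have mS : m.-1.+1 = m by rewrite prednK // ltnW.
have yle i : y i <= 2 * A.
  rewrite /y mulrC ler_wpM2r //; case: (leqP m i) => _; case: (leqP m.-1 i) => _ /=; lra.
have dE i : de i = binE p i (fun j k => (1 - p) * de j + p * de k) + (mean_toll i.+1 - mean_toll i).
  have -> : de i = binE p i.+1 (fun j k => mean_copies j + mean_copies k) + mean_toll i.+1 -
    (binE p i (fun j k => mean_copies j + mean_copies k) + mean_toll i).
    by rewrite /de -!mean_copies_rec.
  rewrite [in RHS]binED !binEZ /de !binEB /= !binED; ring.
have ymon i j : (j <= i)%N -> y j <= y i.
  move=> ji; rewrite /y ler_wpM2l // lerD // ler_nat;
  [case: (leqP m.-1 j) => // h1; have -> // : (m.-1 <= i)%N by lia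
  |case: (leqP m j) => // h1; have -> // : (m <= i)%N by lia].
have yE i : (0 < i)%N ->
    `|mean_toll i.+1 - mean_toll i| + binE p i (fun j k => (1 - p) * y j + p * y k) <= y i.
  move=> i0; have tm : mean_toll m <= 1 := mean_toll_le1 m; have tm0 := mean_toll_ge0 m.
  have key c : (forall j, (j < i)%N -> y j <= y i - A) -> c <= 1 ->
      c + binE p i (fun j k => (1 - p) * y j + p * y k) <= y i.
    move=> hj c1.
    have : binE p i (fun j k => (1 - p) * y j + p * y k) <= binE p i (fun j k =>
       (y i - A) + (A * (1 - p) * (j == i)%:R + A * p * (k == i)%:R)).
      have yj j : (j <= i)%N -> y j <= y i - A + A * (j == i)%:R.
        rewrite leq_eqVlt; case: (eqVneq j i) => [-> _|_ /= /hj h]; first by rewrite mulr1 subrK.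
        by rewrite mulr0 addr0.
      apply: le_binE => // j k jk.
      have h1 := ler_wpM2l q0w (yj j (ltac:(lia))); have h2 := ler_wpM2l p0w (yj k (ltac:(lia))).
      apply: (le_trans (lerD h1 h2)); rewrite le_eqVlt; apply/orP; left; apply/eqP; ring.
    move: (binE p i (fun j k => (1 - p) * y j + p * y k)) => z.
    rewrite binED binE_cst binED !binEZ binE_left // binE_right //.
    have := ler_wpM2l A0 (pq_lt1 i0); rewrite mulrBr mulr1 AE; lra.
  case: (ltngtP i.+1 m) => him.
  - rewrite !mean_toll_neq; [|lia..].
    rewrite subr0 normr0 add0r -[leRHS](binE_cst p i); apply: le_binE => // j k jk.
    have h1 := ler_wpM2l q0w (@ymon i j (ltac:(lia))); have h2 := ler_wpM2l p0w (@ymon i k (ltac:(lia))).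
    by apply: (le_trans (lerD h1 h2)); rewrite le_eqVlt; apply/orP; left; apply/eqP; ring.
  - case: (eqVneq i m) => [E|nE].
      rewrite (@mean_toll_neq i.+1); last by rewrite E; lia.
      rewrite sub0r normrN E ger0_norm // -E; apply: key; last by rewrite E.
      move=> j ji; rewrite /y -E leqnn (leqNgt i j) ji (_ : (i.-1 <= i)%N) /= ?leq_pred //.
      rewrite addr0; have : A * ((i.-1 <= j)%N)%:R <= A * 1 by rewrite ler_wpM2l // lern1 leq_b1.
      by rewrite mulrDr mulr1; lra.
    rewrite !mean_toll_neq; [|lia..].
    rewrite subr0 normr0 add0r -[leRHS](binE_cst p i); apply: le_binE => // j k jk.
    have h1 := ler_wpM2l q0w (@ymon i j (ltac:(lia))); have h2 := ler_wpM2l p0w (@ymon i k (ltac:(lia))).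
    by apply: (le_trans (lerD h1 h2)); rewrite le_eqVlt; apply/orP; left; apply/eqP; ring.
  - rewrite him (@mean_toll_neq i); last by lia.
    rewrite subr0 ger0_norm //; apply: key => // j ji.
    rewrite /y -him /= leqnn (leqNgt i j) ji (leqNgt i.+1 j) (ltnW _) // (leqNgt i.+1 i) ltnSn /=.
    by rewrite !addr0 mulr0 mulr1 subrr.
have AA : 2 * A = 1 / (p * (1 - p)).
  by rewrite /A; field; rewrite ?gt_eqF // ?subr_gt0.
rewrite -AA.
have up (s : R) : `|s| = 1 -> s * de n - y n <= 0.
  move=> s1; apply: (binE_comparison p0 p1 (al := 1 - p) (be := p) (n0 := 1) (D := fun i => s * de i - y i)) => //.
  - by move=> i i0; split => //; apply: (le_lt_trans (pq_lt1 i0)); lra.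
  - case => // _; rewrite /de mean_copies0 mean_copies1 subrr mulr0 sub0r oppr_le0 mulr_ge0 // addr_ge0 // ler0n.
  - move=> i i0; rewrite {1}dE; have := yE i i0.
    have : s * (mean_toll i.+1 - mean_toll i) <= `|mean_toll i.+1 - mean_toll i|.
      by apply: (le_trans (ler_norm _)); rewrite normrM s1 mul1r.
    rewrite [X in _ -> _ -> _ <= X](_ : _ = s * binE p i (fun j k => (1 - p) * de j + p * de k)
      - binE p i (fun j k => (1 - p) * y j + p * y k)); last first.
      by rewrite -binEZ -binEB; apply: eq_binE => j k _; ring.
    by rewrite mulrDr; lra.
have := up 1 (normr1 _); have := up (-1); rewrite normrN1 => /(_ erefl).
rewrite mulN1r mul1r /de => h1 h2; have hy := yle n.
by rewrite ler_norml; apply/andP; split; lra.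
Qed.

End TrieMoments.

(** * Variance of the number of copies *)

Section TrieVariance.
Context {R : realType}.
Variables (p : R) (t : bintree).
Hypotheses (p0 : 0 < p) (p1 : p < 1) (ft : full_tree t) (m2 : (1 < nleaves t)%N).
Let m := nleaves t.

(** From ln x <= x - 1 at x = j / n. Added over both parts, it shows that n ln n loses at least 2 j
    k / n in a split, on average 2 p q (n - 1). *)
Let nlnn_sub (j k n : nat) : (0 < n)%N -> (j + k)%N = n ->
  j%:R * ln (j%:R : R) <= j%:R * ln n%:R - n%:R^-1 * (j%:R * k%:R).
Proof.
move=> n0 jk; have nR : (0 : R) < n%:R by rewrite ltr0n.
case: (posnP j) => [->|j0]; first by rewrite !mul0r mulr0 subrr.
have jR : (0 : R) < j%:R by rewrite ltr0n.
have : ln (j%:R / n%:R : R) <= j%:R / n%:R - 1.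
  have := @le_ln1Dx R (j%:R / n%:R - 1); rewrite addrCA subrr addr0; apply.
  by rewrite ltrBDr addrC subrr divr_gt0.
rewrite ln_div ?posrE // => h.
have -> : n%:R^-1 * (j%:R * k%:R) = j%:R * (1 - j%:R / n%:R) :> R.
  by rewrite -jk natrD; field; rewrite -natrD jk gt_eqF.
by rewrite -mulrBr ler_pM2l //; lra.
Qed.

Lemma var_copies_le : exists C : R, forall n,
  sqmean_copies p t n - mean_copies p t n ^+ 2 <= C * (n%:R * ln n%:R) + m%:R * n%:R.
Proof.
have q0 : 0 < 1 - p by rewrite subr_gt0.
have pq0 : 0 < p * (1 - p) by rewrite mulr_gt0.
(* Moving one string across the split changes the sum of the two means by at most two increments. *)
pose c : R := 2 * (1 / (p * (1 - p))).
(* The average loss of C n ln n in a split is at least 2 c^2 (n - 1), which covers the Efron-Stein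
   term n c^2 as soon as n >= 2. *)
pose C : R := c ^+ 2 / (p * (1 - p)).
have C0 : 0 <= C by rewrite divr_ge0 ?sqr_ge0 // ltW.
pose v n := sqmean_copies p t n - mean_copies p t n ^+ 2.
(* The linear term is unaffected by splits and covers sizes up to [m], where the variance is bounded
   by n^2 <= m n. *)
pose u n : R := C * (n%:R * ln n%:R) + m%:R * n%:R.
exists C => n; rewrite -subr_le0.
apply: (binE_comparison p0 p1 (al := 1) (be := 1) (n0 := m.+1) (D := fun i => v i - u i)) => //.
- move=> i mi; split; first by exact: leq_trans mi.
  rewrite !mul1r; case: i mi => [|[|i]] // mi; first by move: mi m2; rewrite /m; lia.
  have : (1 - p) ^+ i <= 1 by rewrite exprn_ile1 ?(ltW q0) //; move: p0; lra.
  have : p ^+ i <= 1 by rewrite exprn_ile1 // ltW.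
  move=> /(ler_wpM2l (sqr_ge0 p)) h1 /(ler_wpM2l (sqr_ge0 (1 - p))) h2.
  rewrite !exprS !mulrA -!expr2; apply: (le_lt_trans (lerD h2 h1)); rewrite !mulr1.
  by move: p0 p1; nra.
- move=> i; rewrite ltnS => im; rewrite subr_le0.
  apply: (@le_trans _ _ (i%:R ^+ 2)).
    by rewrite /v lerBlDr (le_trans (sqmean_copies_le p0 p1 ft m2 i)) // lerDl sqr_ge0.
  apply: (@le_trans _ _ (m%:R * i%:R)); first by rewrite expr2 ler_wpM2r ?ler_nat.
  rewrite lerDr; case: i {im} => [|i]; first by rewrite mul0r mulr0.
  by apply: mulr_ge0 => //; apply: mulr_ge0 => //; apply: ln_ge0; rewrite ler1n.
move=> i mi; have i2 : (1 < i)%N by exact: ltn_trans mi.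
have i0 : (0 < i)%N by exact: ltnW.
have iR : (0 : R) < i%:R by rewrite ltr0n.
(* Law of total variance over the split; Efron-Stein bounds the variance of the conditional mean. *)
have hv : v i <= binE p i (fun j k => v j + v k) + i%:R * c ^+ 2.
  pose g j k := mean_copies p t j + mean_copies p t k.
  have := @binE_var _ p p0 p1 i g c.
  have -> : binE p i g = mean_copies p t i.
    by rewrite [RHS]mean_copies_rec // (mean_toll_neq p0 p1 (n := i)) ?addr0 // gtn_eqF.
  rewrite /v (sqmean_copies_rec p0 p1 ft m2 mi) -lerBlDl => h; apply: le_trans (h _).
    rewrite le_eqVlt; apply/orP; left; apply/eqP.
    rewrite addrAC -binEB; congr (_ - _); apply: eq_binE => j k _; rewrite /g; ring.
  move=> j k _; rewrite /g.
  have := mean_copies_lip p0 p1 ft m2 j; have := mean_copies_lip p0 p1 ft m2 k.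
  rewrite /c !ler_norml => /andP[? ?] /andP[? ?]; apply/andP; split; lra.
have hu : binE p i (fun j k => u j + u k) + i%:R * c ^+ 2 <= u i.
  have : binE p i (fun j k => u j + u k) <= binE p i (fun j k => u i - 2 * C * i%:R^-1 * (j%:R * k%:R)).
    apply: le_binE => // j k jk; rewrite /u.
    have h1 := ler_wpM2l C0 (nlnn_sub i0 jk).
    have h2 := ler_wpM2l C0 (@nlnn_sub k j i i0 (etrans (addnC _ _) jk)).
    have -> : i%:R = j%:R + k%:R :> R by rewrite -natrD jk.
    by rewrite -jk natrD in h1 h2; lra.
  rewrite binEB binE_cst binEZ binE_mul => h; apply: (le_trans (lerD h (lexx _))).
  have i2R : (2 : R) <= i%:R by rewrite ler_nat.
  have -> : 2 * C / i%:R * ((1 - p) * p * (i%:R * (i%:R - 1))) = 2 * c ^+ 2 * (i%:R - 1).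
    by rewrite /C; field; rewrite !gt_eqF.
  have c2 : 0 <= c ^+ 2 by exact: sqr_ge0.
  by move: (i%:R) i2R (c ^+ 2) c2 => x x2 y y0; nra.
rewrite (eq_binE _ (g' := fun j k => (v j + v k) - (u j + u k))); last by move=> *; ring.
by rewrite binEB; lra.
Qed.

End TrieVariance.

(** * Random strings *)

Section TrieProbability.
Context {R : realType} {d : measure_display} {Omega : measurableType d}.
Variable P : probability Omega R.
Variable X : nat -> nat -> {RV P >-> bool}.
Variable p : R.
Hypothesis hX : iid_Be_bits X p.

Definition suffixes (I : seq nat) (c : nat) (w : Omega) : seq bitstring :=
  [seq (fun j => X i (c + j) w) | i <- I].

Lemma strings_with_suffixes b I c w :
  strings_with b (suffixes I c w) = suffixes [seq i <- I | X i c w == b] c.+1 w.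
Proof.
rewrite /strings_with /suffixes filter_map -map_comp; congr map; last first.
  by apply: eq_filter => i /=; rewrite addn0.
by apply/funext => i; apply/funext => j; rewrite /= /bs_tail addnS addSn.
Qed.

Lemma measurable_bit i j b : measurable [set w | X i j w == b].
Proof.
have -> : [set w | X i j w == b] = X i j @^-1` [set b].
  by apply/seteqP; split => w /= /eqP.
by rewrite -[X in measurable X]setTI; apply: measurable_funP.
Qed.

Lemma measurable_andb (a b : Omega -> bool) :
  measurable [set w | a w] -> measurable [set w | b w] -> measurable [set w | a w && b w].
Proof.
move=> ha hb; have -> : [set w | a w && b w] = [set w | a w] `&` [set w | b w].
  by apply/seteqP; split => w /= => [/andP[]|[-> ->]].
exact: measurableI.
Qed.

Lemma measurable_bool (b : bool) : measurable [set w : Omega | b].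
Proof.
case: b; first by rewrite (_ : [set w | true] = setT) //; apply/seteqP; split.
by rewrite (_ : [set w | false] = set0) //; apply/seteqP; split.
Qed.

Lemma bit_split (A : set Omega) i j :
  A = (A `&` [set w | X i j w == false]) `|` (A `&` [set w | X i j w == true]).
Proof.
by rewrite -setIUr -[LHS]setIT; congr (_ `&` _); apply/seteqP; split => w //= _; case: (X i j w); [right|left].
Qed.

(** The accumulators [I0] and [I1] hold the strings already sent left and right. Reading one letter
    at a time turns the random partition of [I] into binary case distinctions. *)
Lemma measurable_split T1 T2 I I0 I1 c :
  (forall I c, measurable [set w | trieb T1 (suffixes I c w)]) ->
  (forall I c, measurable [set w | trieb T2 (suffixes I c w)]) ->
  measurable [set w | trieb T1 (suffixes (I0 ++ [seq i <- I | X i c w == false]) c.+1 w) &&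
    trieb T2 (suffixes (I1 ++ [seq i <- I | X i c w == true]) c.+1 w)].
Proof.
move=> h1 h2.
elim: I I0 I1  => [|i I IH] I0 I1.
  rewrite (_ : [set w | _] = [set w | trieb T1 (suffixes I0 c.+1 w) && trieb T2 (suffixes I1 c.+1 w)]).
    exact: measurable_andb.
  by apply/seteqP; split => w /=; rewrite !cats0.
rewrite (bit_split [set w | _] i c); apply: measurableU.
- rewrite (_ : _ `&` _ = [set w | trieb T1 (suffixes (rcons I0 i ++ [seq i <- I | X i c w == false]) c.+1 w) &&
    trieb T2 (suffixes (I1 ++ [seq i <- I | X i c w == true]) c.+1 w)] `&` [set w | X i c w == false]).
    by apply: measurableI; [exact: IH|exact: measurable_bit].
  by apply/seteqP; split => w /= [+ /eqP E]; rewrite E cat_rcons eqxx.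
- rewrite (_ : _ `&` _ = [set w | trieb T1 (suffixes (I0 ++ [seq i <- I | X i c w == false]) c.+1 w) &&
    trieb T2 (suffixes (rcons I1 i ++ [seq i <- I | X i c w == true]) c.+1 w)] `&` [set w | X i c w == true]).
    by apply: measurableI; [exact: IH|exact: measurable_bit].
  by apply/seteqP; split => w /= [+ /eqP E]; rewrite E cat_rcons eqxx.
Qed.

Lemma measurable_trieb T I c : measurable [set w | trieb T (suffixes I c w)].
Proof.
elim: T I c => [|l IHl r IHr] I c /=.
  by rewrite (_ : [set w | _] = [set w | nilp I]); [exact: measurable_bool|apply/seteqP; split => w /=; rewrite /nilp size_map].
case: (leqP (size I) 1) => hI.
  rewrite (_ : [set w | _] = [set w : Omega | (size I == 1)%N && (BNode l r == BLeaf)]).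
    exact: measurable_bool.
  by apply/seteqP; split => w /=; rewrite size_map hI.
rewrite (_ : [set w | _] = [set w |
    trieb l (suffixes ([::] ++ [seq i <- I | X i c w == false]) c.+1 w) &&
    trieb r (suffixes ([::] ++ [seq i <- I | X i c w == true]) c.+1 w)]); last first.
  by apply/seteqP; split => w /=; rewrite size_map leqNgt hI /= !strings_with_suffixes.
exact: measurable_split.
Qed.

Definition cylinder (J : seq (nat * nat * bool)) (w : Omega) : bool :=
  all (fun x => X x.1.1 x.1.2 w == x.2) J.

Definition forest (fs : seq (bintree * seq nat * nat)) (w : Omega) : bool :=
  all (fun f => trieb f.1.1 (suffixes f.1.2 f.2 w)) fs.

Lemma measurable_cylinder J : measurable [set w | cylinder J w].
Proof.
elim: J => [|x J IH] /=; first exact: (measurable_bool true).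
by apply: measurable_andb => //; exact: measurable_bit.
Qed.

Lemma measurable_forest fs : measurable [set w | forest fs w].
Proof.
elim: fs => [|x J IH] /=; first exact: (measurable_bool true).
by apply: measurable_andb => //; exact: measurable_trieb.
Qed.

Definition bit_mass (b : bool) : R := if b then p else 1 - p.

Lemma prob_bit i j b : P [set w | X i j w == b] = (bit_mass b)%:E.
Proof.
have ht : P [set w | X i j w == true] = p%:E.
  by rewrite -(hX.1 i j); congr (P _); apply/seteqP; split => w /= /eqP.
case: b => //=; rewrite -[(1 - p)%:E]/(1%:E - p%:E)%E -ht -probability_setC; last exact: measurable_bit.
by congr (P _); apply/seteqP; split => w /=; case: (X i j w).
Qed.

Lemma prob_cylinder J : uniq [seq x.1 | x <- J] ->
  P [set w | cylinder J w] = (\prod_(x <- J) bit_mass x.2)%:E.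
Proof.
move=> uJ.
have key x y : x \in J -> y \in J -> x.1 = y.1 -> x = y.
  elim: J uJ => //= z J IH /andP[zJ uJ]; rewrite !inE => /orP[/eqP ->|xJ] /orP[/eqP ->|yJ] // E.
  - by move: zJ; rewrite E map_f.
  - by move: zJ; rewrite -E map_f.
  - exact: IH.
have := hX.2 [seq x.1 | x <- J] (fun ij => [set b | (ij, b) \in J]) uJ.
rewrite big_map (_ : [set w | _] = [set w | cylinder J w]) => [->|]; last first.
  apply/seteqP; split => w /=.
    move=> h; apply/allP => -[ij b] xJ /=; have /= h' := h ij (map_f _ xJ).
    by have [->] := key _ _ h' xJ erefl.
  by move=> /allP h ij /mapP[[ij' b] xJ ->] /=; have /= /eqP -> := h _ xJ.
elim: J {uJ} key => [|x J IH] key; first by rewrite !big_nil.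
rewrite big_seq [in RHS]big_seq.
elim/big_ind2: _ => // [a a' b b' -> ->|[ij b] yJ]; first by rewrite EFinM.
rewrite -(prob_bit ij.1 ij.2); congr (P _); apply/seteqP; split => w /=.
  by move=> h; have [->] := key _ _ h yJ erefl.
by move/eqP => ->.
Qed.

(** Empty trees count as 1, so the total size of a forest drops both when a tree is discharged and
    when a node is replaced by its two children. *)
Fixpoint tree_size T := if T is BNode l r then (tree_size l + tree_size r).+1 else 1%N.

Definition forest_mass (fs : seq (bintree * seq nat * nat)) : R :=
  \prod_(f <- fs) trie_mass p f.1.1 (size f.1.2).

Definition bits_fresh (J : seq (nat * nat * bool)) (I : seq nat) (c : nat) :=
  forall i j, i \in I -> (c <= j)%N -> (i, j) \notin [seq x.1 | x <- J].

Definition forest_fresh J (fs : seq (bintree * seq nat * nat)) :=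
  forall f, f \in fs -> bits_fresh J f.1.2 f.2.

(** A trie splits into two tries on a random partition of its strings, so the induction needs a
    statement stable under splitting: several tries on disjoint sets of strings, jointly with
    finitely many letters already read that none of these tries reads again. Letters move into the
    cylinder as they are read, and only the independence of finitely many letters is used. *)
Lemma prob_forest (fs : seq (bintree * seq nat * nat)) J :
  uniq [seq x.1 | x <- J] -> uniq (flatten [seq f.1.2 | f <- fs]) -> forest_fresh J fs ->
  P [set w | cylinder J w && forest fs w] =
  ((\prod_(x <- J) bit_mass x.2) * forest_mass fs)%:E.
Proof.
have [N] := ubnP (\sum_(f <- fs) tree_size f.1.1)%N.
elim: N fs J => // N IHN [|[[T I] c] fs] J.
  move=> _ uJ _ _; rewrite /forest_mass big_nil mulr1 -prob_cylinder //.
  by congr (P _); apply/seteqP; split => w /=; rewrite andbT.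
rewrite big_cons ltnS /= => hN uJ; rewrite cat_uniq => /and3P[uI hI ufs] fr.
have IHfs : P [set w | cylinder J w && forest fs w] = ((\prod_(x <- J) bit_mass x.2) * forest_mass fs)%:E.
  apply: IHN => //; last by move=> f ffs; apply: fr; rewrite inE ffs orbT.
  by apply: leq_trans hN; rewrite -add1n leq_add2r; case: (T).
(* If the first tree is empty or at most one string is left, its event does not depend on the
   letters. *)
have triv (b : bool) : (forall w, trieb T (suffixes I c w) = b) -> trie_mass p T (size I) = b%:R ->
    P [set w | [&& cylinder J w, trieb T (suffixes I c w) & forest fs w]] =
    ((\prod_(x <- J) bit_mass x.2) * forest_mass ((T, I, c) :: fs))%:E.
  move=> hb mb; rewrite /forest_mass big_cons /= mb.
  case: b hb mb => hb mb.
    by rewrite mul1r -IHfs; congr (P _); apply/seteqP; split => w /=; rewrite hb.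
  rewrite mul0r mulr0 (_ : [set w | _] = set0) ?measure0 //.
  by apply/seteqP; split => w //=; rewrite hb andbF.
case: T hN fr triv => [|l r] hN fr triv.
  by apply: (triv (nilp I)) => // w; rewrite /= /nilp size_map.
case: (leqP (size I) 1) => sI.
  apply: (triv ((size I == 1%N) && (BNode l r == BLeaf))) => [w|]; last by rewrite /= sI.
  by rewrite /= size_map sI.
rewrite /forest_mass big_cons /= [(size I <= 1)%N]leqNgt sI /=.
rewrite (_ : [set w | _] = [set w | cylinder J w && (
    trieb l (suffixes ([::] ++ [seq i <- I | X i c w == false]) c.+1 w) &&
    trieb r (suffixes ([::] ++ [seq i <- I | X i c w == true]) c.+1 w) && forest fs w)]); last first.
  by apply/seteqP; split => w /=; rewrite size_map leqNgt sI /= !strings_with_suffixes.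
have ff : forest_fresh J fs by move=> f ffs; apply: fr; rewrite inE ffs orbT.
(* The letters at depth [c] are read string by string; each joins the cylinder and sends its string
   to [I0] or [I1], which is one step of the recursion of [binE]. *)
suff inner Ir I0 I1 J' : uniq [seq x.1 | x <- J'] ->
    uniq (I0 ++ I1 ++ Ir ++ flatten [seq f.1.2 | f <- fs]) ->
    bits_fresh J' I0 c.+1 -> bits_fresh J' I1 c.+1 -> bits_fresh J' Ir c -> forest_fresh J' fs ->
    P [set w | cylinder J' w && (
      trieb l (suffixes (I0 ++ [seq i <- Ir | X i c w == false]) c.+1 w) &&
      trieb r (suffixes (I1 ++ [seq i <- Ir | X i c w == true]) c.+1 w) && forest fs w)] =
    ((\prod_(x <- J') bit_mass x.2) * (binE p (size Ir) (fun j k =>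
      trie_mass p l (size I0 + j) * trie_mass p r (size I1 + k)) * forest_mass fs))%:E.
  apply: (inner I [::] [::] J) => //; first by rewrite /= cat_uniq uI hI.
  by apply: (fr (BNode l r, I, c)); rewrite mem_head.
elim: Ir I0 I1 J' {IHfs triv uJ fr ff sI uI hI} => [|i Ir IH] I0 I1 J' uJ' hu f0 f1 fI ff.
  rewrite (_ : [set w | _] = [set w | cylinder J' w && forest ((l, I0, c.+1) :: (r, I1, c.+1) :: fs) w]); last first.
    by apply/seteqP; split => w /=; rewrite !cats0 -!andbA.
  rewrite IHN //; last first.
  - by move=> f; rewrite !inE => /or3P[/eqP ->|/eqP ->|/ff].
  - by rewrite !big_cons /= addnA; apply: leq_trans hN; rewrite addSn.
  by rewrite /forest_mass !big_cons /= !addn0 !mulrA.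
have key b : P ([set w | cylinder J' w && (
      trieb l (suffixes (I0 ++ [seq i <- i :: Ir | X i c w == false]) c.+1 w) &&
      trieb r (suffixes (I1 ++ [seq i <- i :: Ir | X i c w == true]) c.+1 w) && forest fs w)] `&`
      [set w | X i c w == b]) =
    (\prod_(x <- J') bit_mass x.2 * (bit_mass b * (binE p (size Ir) (fun j k =>
      trie_mass p l (size I0 + (if b then j else j.+1)) * trie_mass p r (size I1 + (if b then k.+1 else k))) * forest_mass fs)))%:E.
  have fi i0 j : (i0, j) \in [seq x.1 | x <- (i, c, b) :: J'] = ((i0, j) == (i, c)) || ((i0, j) \in [seq x.1 | x <- J']) by rewrite inE.
  have hi : (i, c) \notin [seq x.1 | x <- J'] by apply: fI; rewrite ?mem_head.
  pose F := flatten [seq f.1.2 | f <- fs].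
  have hperm : perm_eq (I0 ++ I1 ++ (i :: Ir) ++ F) (i :: (I0 ++ I1 ++ Ir ++ F)).
    have -> : I0 ++ I1 ++ (i :: Ir) ++ F = (I0 ++ I1) ++ [:: i] ++ (Ir ++ F) by rewrite -catA.
    have -> : i :: I0 ++ I1 ++ Ir ++ F = [:: i] ++ (I0 ++ I1) ++ (Ir ++ F) by rewrite -catA.
    by apply/permPl; exact: perm_catCA.
  move: (hu); rewrite (perm_uniq hperm) => /= /andP[iNa huF].
  have iN : [/\ i \notin I0, i \notin I1, i \notin Ir & i \notin flatten [seq f.1.2 | f <- fs]].
    by move: iNa; rewrite !mem_cat !negb_or => /and4P[].
  have [i0 i1 ir ifs] := iN.
  transitivity (P [set w | cylinder ((i, c, b) :: J') w && (
      trieb l (suffixes ((if b then I0 else rcons I0 i) ++ [seq i <- Ir | X i c w == false]) c.+1 w) &&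
      trieb r (suffixes ((if b then rcons I1 i else I1) ++ [seq i <- Ir | X i c w == true]) c.+1 w) && forest fs w)]).
    congr (P _); apply/seteqP; split => w /=.
      by case=> /[swap] /eqP ->; rewrite eqxx /=; case: b {fi} => /=; rewrite ?cat_rcons.
    by case/andP => /andP[/eqP -> ->] /= h; rewrite eqxx; split => //; move: h; case: b {fi} => /=; rewrite ?cat_rcons.
  rewrite IH /=; last first.
  - move=> f ffs i2 j i2f cj; rewrite fi negb_or (ff f) // andbT.
    apply: contraNneq ifs => -[<- _]; apply/flattenP; exists f.1.2 => //.
    by apply: map_f.
  - move=> i2 j i2f cj; rewrite fi negb_or fI ?inE ?i2f ?orbT // andbT.
    by apply: contraNneq ir => -[<- _].
  - move=> i2 j i2f cj; rewrite fi negb_or.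
    have -> /= : (i2, j) != (i, c) by apply: contraTneq cj => -[_ ->]; rewrite ltnn.
    move: i2f; case: b {fi} => i2f; last exact: f1.
    by move: i2f; rewrite mem_rcons inE => /orP[/eqP ->|/f1]; [apply: fI; rewrite ?mem_head // ltnW|apply].
  - move=> i2 j i2f cj; rewrite fi negb_or.
    have -> /= : (i2, j) != (i, c) by apply: contraTneq cj => -[_ ->]; rewrite ltnn.
    move: i2f; case: b {fi} => i2f; first exact: f0.
    by move: i2f; rewrite mem_rcons inE => /orP[/eqP ->|/f0]; [apply: fI; rewrite ?mem_head // ltnW|apply].
  - have hu' : uniq (i :: (I0 ++ I1 ++ Ir ++ F)) by rewrite /= iNa.
    case: b {fi}; rewrite cat_rcons; last first.
      rewrite -(perm_uniq (_ : perm_eq (i :: (I0 ++ I1 ++ Ir ++ F)) _)) //.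
      by rewrite -cat1s -[i :: _ in X in perm_eq _ X]cat1s; apply/permPl; exact: perm_catCA.
    rewrite -(perm_uniq (_ : perm_eq (i :: (I0 ++ I1 ++ Ir ++ F)) _)) //.
    by rewrite perm_sym -cat_cons.
  - by rewrite hi.
  rewrite big_cons /=; congr (_%:E); rewrite -[LHS]mulrA mulrCA; congr (_ * (_ * (_ * _))).
  by apply: eq_binE => j k _; case: b {fi}; rewrite size_rcons ?addSnnS.
rewrite (bit_split [set w | _] i c) measureU.
- apply: (etrans (congr2 (fun x y => x + y)%E (key false) (key true))).
  by rewrite -EFinD /=; congr (_%:E); rewrite /bit_mass /=; ring.
- apply: measurableI; last exact: measurable_bit.
  apply: measurable_andb; first exact: measurable_cylinder.
  apply: measurable_andb; last exact: measurable_forest.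
  by apply: measurable_split => *; exact: measurable_trieb.
- apply: measurableI; last exact: measurable_bit.
  apply: measurable_andb; first exact: measurable_cylinder.
  apply: measurable_andb; last exact: measurable_forest.
  by apply: measurable_split => *; exact: measurable_trieb.
- by apply/seteqP; split => w //= [[_ /eqP ->]] [_ /eqP].
Qed.

End TrieProbability.

(** * From the law of the trie to probabilities and expectations *)

Section TrieEvents.
Context {R : realType} {d : measure_display} {Omega : measurableType d}.
Variable P : probability Omega R.
Variable X : nat -> nat -> {RV P >-> bool}.
Variable p : R.
Hypotheses (p0 : 0 < p) (p1 : p < 1) (hX : iid_Be_bits X p).

Let B n T := [set w | trieb T (suffixes X (iota 0 n) 0 w)].

Let mB n T : measurable (B n T). Proof. exact: measurable_trieb. Qed.

Lemma prob_trieb n T : P (B n T) = (trie_mass p T n)%:E.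
Proof.
have := @prob_forest R d Omega P X p hX [:: (T, iota 0 n, 0%N)] [::].
rewrite /= cats0 iota_uniq => /(_ erefl erefl) h.
rewrite -[RHS](_ : (\prod_(x <- [::]) bit_mass p (x : nat * nat * bool).2 * forest_mass p [:: (T, iota 0 n, 0%N)])%:E = _); last first.
  by rewrite big_nil mul1r /forest_mass big_seq1 /= size_iota.
rewrite -h; last by [].
by congr (P _); apply/seteqP; split => w /=; rewrite andbT.
Qed.

Lemma random_trieE n w T : B n T w -> random_trie X n w = T.
Proof. exact: trieb_trie. Qed.

(** There are countably many trees, but [BEmpty] is also the default value for coinciding strings;
    its event is obtained as the complement of all the others. *)
Lemma measurable_random_trie n (Q : bintree -> bool) :
  measurable [set w | Q (random_trie X n w)].
Proof.
pose D (Q' : bintree -> bool) := \bigcup_k (if @unpickle bintree k is Some T then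
  if (T != BEmpty) && Q' T then B n T else set0 else set0).
have mD Q' : measurable (D Q').
  by apply: bigcupT_measurable => k; case: unpickle => [T|] //; case: ifP.
have DE Q' w : D Q' w <-> random_trie X n w != BEmpty /\ Q' (random_trie X n w).
  split.
    move=> [k _]; case: unpickle => [T|] //; case: ifP => // /andP[TE QT] /random_trieE ->.
    by split.
  move=> [TE QT]; exists (pickle (random_trie X n w)) => //; rewrite pickleK TE QT /=.
  exact: trie_trieb.
case QE : (Q BEmpty).
  rewrite (_ : [set w | _] = D Q `|` ~` D predT).
    by apply: measurableU => //; exact: measurableC.
  apply/seteqP; split => w /=.
    case: (eqVneq (random_trie X n w) BEmpty) => E h; last by left; apply/DE.
    by right => /DE [/eqP].
  case=> [/DE []//|h]; case: (eqVneq (random_trie X n w) BEmpty) => E; first by rewrite E QE.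
  by exfalso; apply: h; apply/DE.
rewrite (_ : [set w | _] = D Q) //; apply/seteqP; split => w /=.
  move=> h; apply/DE; split => //; apply: contraTneq h => ->.
  by rewrite QE.
by move/DE => [].
Qed.

Lemma measurable_fun_random_trie n (phi : bintree -> R) :
  measurable_fun setT (fun w => phi (random_trie X n w)).
Proof.
move=> _ Y mY; rewrite setTI.
rewrite (_ : _ @^-1` _ = [set w | (fun T => phi T \in Y) (random_trie X n w)]).
  exact: (measurable_random_trie n (fun T => phi T \in Y)).
by apply/seteqP; split => w /=; rewrite inE.
Qed.

Lemma treeE_le_integral n L (phi : bintree -> R) : (forall T, 0 <= phi T) ->
  ((treeE p L n phi)%:E <= \int[P]_w (phi (random_trie X n w))%:E)%E.
Proof.
move=> h0; pose g T w : R := phi T * \1_(B n T) w.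
have mg T : measurable_fun [set: Omega] (EFin \o g T).
  by apply/measurable_EFinP; apply: measurable_funM => //; exact: measurable_indic.
have g0 (T : bintree) (w : Omega) : [set: Omega] w -> (0%E <= (g T w)%:E)%E by rewrite lee_fin mulr_ge0.
have -> : (treeE p L n phi)%:E = (\int[P]_w (\sum_(T <- trees L) (g T w)%:E))%E.
  rewrite (ge0_integral_sum P measurableT mg g0).
  rewrite /treeE -sumEFin; apply: eq_bigr => T _.
  rewrite (eq_integral (fun w => (phi T)%:E * (\1_(B n T) w)%:E)%E); last first.
    by move=> w _; rewrite /g /= EFinM.
  rewrite ge0_integralZl_EFin //; last first.
    by apply/measurable_EFinP; exact: measurable_indic.
  by rewrite integral_indic // setIT EFinM muleC; congr (_ * _)%E; symmetry; exact: prob_trieb.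
apply: ge0_le_integral => //.
- by move=> w _; apply: sume_ge0 => T _; exact: g0.
- exact: emeasurable_sum.
- by apply/measurable_EFinP; exact: measurable_fun_random_trie.
move=> w _; rewrite sumEFin lee_fin.
elim: (trees L) (trees_uniq L) => [|T s IH] /=; first by rewrite big_nil.
rewrite big_cons => /andP[Ts us]; rewrite /g indicE.
case: (boolP (w \in _)) => [|_]; last by rewrite mulr0 add0r; exact: IH.
rewrite inE => h; rewrite (random_trieE h) mulr1 big_seq big1 ?addr0 // => T' T's.
rewrite indicE memNset ?mulr0 // => h'.
by move: Ts; rewrite (trieb_uniq h h') T's.
Qed.

(** Truncation only bounds an integral from below. Applied to [phi] and to [1 - phi], the bounds
    meet because the truncated mass tends to 1; this also shows that coinciding strings do not
    contribute. *)
Lemma expectation_treeLim n (phi : bintree -> R) :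
  (forall T, 0 <= phi T) -> (forall T, phi T <= 1) ->
  fine 'E_P[fun w => phi (random_trie X n w)] = treeLim p n phi.
Proof.
move=> h0 h1; rewrite unlock; set e := (\int[P]_w _)%E.
have mphi := measurable_fun_random_trie n phi.
have one : (\int[P]_w (phi (random_trie X n w))%:E + \int[P]_w (1 - phi (random_trie X n w))%:E)%E = 1%E.
  rewrite -ge0_integralD //=.
  - under eq_integral do rewrite -EFinD addrC subrK.
    by rewrite integral_cst // mul1e; exact: probability_setT.
  - by move=> w _; rewrite lee_fin.
  - exact/measurable_EFinP.
  - by move=> w _; rewrite lee_fin subr_ge0.
  - by apply/measurable_EFinP; apply: measurable_funB.
have e_ge0 : (0 <= e)%E by apply: integral_ge0 => w _; rewrite lee_fin.
have e'_ge0 : (0 <= \int[P]_w (1 - phi (random_trie X n w))%:E)%E.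
  by apply: integral_ge0 => w _; rewrite lee_fin subr_ge0.
have efin : e \is a fin_num.
  rewrite ge0_fin_numE // (@le_lt_trans _ _ 1%E) ?ltry //.
  by rewrite -one leeDl.
have lo L : treeE p L n phi <= fine e by rewrite -lee_fin fineK //; exact: treeE_le_integral.
have hi L : fine e <= treeE p L n phi + (1 - treeE p L n (fun=> 1)).
  have := treeE_le_integral n L (fun T => _ : 0 <= 1 - phi T).
  move=> /(_ (fun T => ltac:(by rewrite subr_ge0))) h.
  have : ((treeE p L n (fun T => 1 - phi T))%:E + e <= 1)%E by rewrite -one addeC; exact: leeD.
  rewrite -[e]fineK // -EFinD lee_fin.
  have -> : treeE p L n (fun T => 1 - phi T) = treeE p L n (fun=> 1) + (-1) * treeE p L n phi.
    by rewrite -treeEZ -treeED; apply: treeE_eq => T _ /=; ring.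
  by rewrite mulN1r /=; lra.
have h : treeE p L n phi @[L --> \oo] --> treeLim p n phi.
  exact: (treeE_cvg p0 p1 (C := 1)).
have h2 : treeE p L n phi + (1 - treeE p L n (fun=> 1)) @[L --> \oo] -->
    treeLim p n phi + (1 - 1).
  by apply: cvgD => //; apply: cvgB; [exact: cvg_cst|exact: treeE_mass_cvg].
apply/eqP; rewrite eq_le; apply/andP; split.
  rewrite -[leRHS](addr0) -(subrr 1) -(cvg_lim (@Rhausdorff R) h2).
  apply: limr_ge; first by apply/cvg_ex; eexists; exact: h2.
  by near=> L; exact: hi.
rewrite /treeLim; apply: limr_le; first by apply/cvg_ex; eexists; exact: h.
by near=> L; exact: lo.
Unshelve. all: by end_near. Qed.

Lemma prob_treeLim n (Q : bintree -> bool) :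
  fine (P [set w | Q (random_trie X n w)]) = treeLim p n (fun T => (Q T)%:R).
Proof.
rewrite -expectation_treeLim => [|T|T]; [|exact: ler0n|by rewrite lern1 leq_b1].
rewrite unlock -[X in P X]setIT -integral_indic //; last exact: measurable_random_trie.
by congr fine; apply: eq_integral => w _; rewrite indicE mem_setE.
Qed.

End TrieEvents.

(** * The conditional probability and its concentration *)

Section QCond.
Context {R : realType} {d : measure_display} {Omega : measurableType d}.
Variable P : probability Omega R.
Variable X : nat -> nat -> {RV P >-> bool}.
Variables (p : R) (t : bintree).
Hypotheses (p0 : 0 < p) (p1 : p < 1) (hX : iid_Be_bits X p) (ft : full_tree t).
Let m := nleaves t.

Lemma treeLim_eq n (phi psi : bintree -> R) :
  (forall T, trie_mass p T n != 0 -> phi T = psi T) -> treeLim p n phi = treeLim p n psi.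
Proof.
move=> h; rewrite /treeLim; have -> : (fun L => treeE p L n phi) = (fun L => treeE p L n psi) => //.
by apply/funext => L; exact: treeE_eq.
Qed.

Lemma q_cond_compression n T : trie_mass p T n != 0 ->
  q_cond R (compression T) t = m%:R * (ncomp t T)%:R / n%:R.
Proof.
move=> /(trie_mass_neq0 p0 p1) [h _].
by rewrite /q_cond count_in_fringe_copy // h natrM.
Qed.

Lemma q_cond_ge0 T : 0 <= q_cond R T t.
Proof. by rewrite /q_cond divr_ge0. Qed.

Lemma q_cond_le1 T : q_cond R T t <= 1.
Proof.
rewrite /q_cond; have [->|h] := posnP (nleaves T); first by rewrite invr0 mulr0.
by rewrite ler_pdivrMr ?ltr0n // mul1r ler_nat count_size.
Qed.

Lemma q_mean_treeLim n :
  q_mean P (patricia X n) t = treeLim p n (fun T => q_cond R (compression T) t).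
Proof.
apply: (expectation_treeLim p0 p1 hX n (phi := fun T => q_cond R (compression T) t)) => T.
  exact: q_cond_ge0.
exact: q_cond_le1.
Qed.

Lemma q_mean_leaf n : m = 1%N -> (0 < n)%N -> q_mean P (patricia X n) t = 1.
Proof.
move=> m1 n0; rewrite q_mean_treeLim.
have tL : t = BLeaf.
  have := ft; move: m1; rewrite /m; case: (t) => // l r h /full_BNodeP [//|[fl fr nE]].
  by move: h; rewrite nleaves_BNode //; have := nleaves_full_gt0 fl; have := nleaves_full_gt0 fr; lia.
rewrite (@treeLim_eq n _ (fun=> 1)).
  by apply: cvg_lim => //; exact: treeE_mass_cvg.
move=> T h; have [hT _] := trie_mass_neq0 p0 p1 h.
rewrite /q_cond tL (_ : count _ _ = nleaves (compression T)) ?divff // ?hT ?pnatr_eq0 -?lt0n //.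
rewrite -hT; apply/eqP; rewrite -all_count; apply/allP => v.
rewrite mem_filter => /andP[hv vT]; apply/hasP; exists v => //.
by rewrite prefix_refl hv.
Qed.

Hypothesis (m2 : (1 < m)%N).

Lemma pi_tree_mean_toll : pi_tree X t = mean_toll p t m.
Proof.
rewrite /pi_tree.
pose Q T := if T is BNode l r then toll t l r else false.
rewrite (_ : [set w | _] = [set w | Q (random_trie X m w)]).
  rewrite (prob_treeLim p0 p1 hX); apply: treeLim_eq => T _.
  by case: T.
apply/seteqP; split => w /=; case: (random_trie X m w) => [|l r] //=.
- by case.
- by move=> h; apply/toll_preimage.
- by move=> h; apply/toll_preimage.
Qed.

Lemma q_mean_copies n : q_mean P (patricia X n) t = m%:R * mean_copies p t n / n%:R.
Proof.
rewrite q_mean_treeLim.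
rewrite (@treeLim_eq n _ (fun T => (m%:R / n%:R) * (ncomp t T)%:R)); last first.
  by move=> T /q_cond_compression ->; rewrite mulrAC.
rewrite mulrAC; apply: cvg_lim => //.
rewrite (_ : (fun L => _) = (fun L => m%:R / n%:R * treeE p L n (fun T => (ncomp t T)%:R))); last first.
  by apply/funext => L; rewrite treeEZ.
by apply: cvgM; [exact: cvg_cst|exact: (mean_copies_cvg p0 p1 ft m2)].
Qed.

(** Chebyshev's inequality is applied to the truncated sums, before [L] tends to infinity; there the
    square is expanded with the truncated mass in the place of 1. *)
Lemma q_cond_chebyshev n (eps : R) : (0 < n)%N -> 0 < eps ->
  fine (P [set w | eps < `|q_cond R (patricia X n w) t - m%:R * mean_copies p t n / n%:R|]) <=
  m%:R ^+ 2 * (sqmean_copies p t n - mean_copies p t n ^+ 2) / (n%:R ^+ 2 * eps ^+ 2).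
Proof.
move=> n0 e0; have nR : (0 : R) < n%:R by rewrite ltr0n.
set e := mean_copies p t n.
have D0 : 0 < n%:R ^+ 2 * eps ^+ 2 by rewrite mulr_gt0 ?exprn_gt0.
rewrite (prob_treeLim p0 p1 hX n (fun T => eps < `|q_cond R (compression T) t - m%:R * e / n%:R|)).
pose K := m%:R ^+ 2 / (n%:R ^+ 2 * eps ^+ 2).
have hc : K * (treeE p L n (fun T => (ncomp t T)%:R ^+ 2) - 2 * e * treeE p L n (fun T => (ncomp t T)%:R)
    + e ^+ 2 * treeE p L n (fun=> 1)) @[L --> \oo] -->
    K * (sqmean_copies p t n - 2 * e * e + e ^+ 2 * 1).
  apply: cvgM; first exact: cvg_cst.
  apply: cvgD; last by apply: cvgM; [exact: cvg_cst|exact: treeE_mass_cvg].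
  apply: cvgB; first exact: (sqmean_copies_cvg p0 p1 ft m2).
  by apply: cvgM; [exact: cvg_cst|exact: (mean_copies_cvg p0 p1 ft m2)].
have -> : m%:R ^+ 2 * (sqmean_copies p t n - e ^+ 2) / (n%:R ^+ 2 * eps ^+ 2) =
    K * (sqmean_copies p t n - 2 * e * e + e ^+ 2 * 1) by rewrite /K; ring.
rewrite -(cvg_lim (@Rhausdorff R) hc); apply: ler_lim.
- apply/cvg_ex; eexists; apply: (treeE_cvg p0 p1 (C := 1)) => T; rewrite ?ler0n //.
  by rewrite lern1 leq_b1.
- by apply/cvg_ex; eexists; exact: hc.
near=> L.
have -> : K * (treeE p L n (fun T => (ncomp t T)%:R ^+ 2) - 2 * e * treeE p L n (fun T => (ncomp t T)%:R)
    + e ^+ 2 * treeE p L n (fun=> 1)) = treeE p L n (fun T => K * ((ncomp t T)%:R - e) ^+ 2).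
  rewrite -mulNr -treeEZ -treeEZ -!treeED -treeEZ; apply: treeE_eq => T _; ring.
apply: treeE_le => // T /q_cond_compression ->.
case: ltP => h /=; last by rewrite mulr_ge0 ?sqr_ge0 // divr_ge0 ?exprn_ge0 // ltW.
rewrite /K mulrAC ler_pdivlMr // mul1r.
have -> : m%:R ^+ 2 * ((ncomp t T)%:R - e) ^+ 2 =
  n%:R ^+ 2 * (m%:R * (ncomp t T)%:R / n%:R - m%:R * e / n%:R) ^+ 2.
  by field; rewrite gt_eqF.
rewrite ler_pM2l ?exprn_gt0 // -[leRHS]real_normK ?num_real //.
by rewrite ler_sqr ?nnegrE // ltW.
Unshelve. all: by end_near. Qed.

End QCond.

(** * The Poissonized mean *)

Section Dilation.
Context {R : realType}.
Variable p : R.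
Hypotheses (p0 : 0 < p) (p1 : p < 1).
Implicit Types (f g V : R -> R) (z : R).

(** One letter: the k-th iterate sums [f] over the words of length k, at [z] times the probability
    of the word. *)
Definition dil f z : R := f (p * z) + f ((1 - p) * z).

(* The solution of [E z = f z + E (p z) + E ((1 - p) z)]. *)
Definition renew f z : R := limn (series (fun k => iter k dil f z)).

Let q0 : 0 < 1 - p. Proof. by rewrite subr_gt0. Qed.

Let pz z x : 0 <= x <= p * z -> 0 <= z -> 0 <= x <= z.
Proof.
move=> /andP[-> h] z0 /=; apply: (le_trans h); rewrite -[leRHS]mul1r ler_wpM2r //; exact: ltW.
Qed.

Let qz z x : 0 <= x <= (1 - p) * z -> 0 <= z -> 0 <= x <= z.
Proof.
move=> /andP[-> h] z0 /=; apply: (le_trans h); rewrite -[leRHS]mul1r ler_wpM2r //.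
by rewrite gerBl ltW.
Qed.

Let pz0 z : 0 <= z -> 0 <= p * z. Proof. by move=> z0; rewrite mulr_ge0 // ltW. Qed.
Let qz0 z : 0 <= z -> 0 <= (1 - p) * z. Proof. by move=> z0; rewrite mulr_ge0 // ltW. Qed.

(** A supersolution V >= |f| + dil V dominates all partial sums, by peeling off the first letter.
    The condition is confined to [0, z] because [dil] only moves towards 0. *)
Lemma dil_series_le f V z : 0 <= z ->
  (forall x, 0 <= x <= z -> 0 <= V x /\ `|f x| <= V x - dil V x) ->
  forall N, \sum_(k < N) `|iter k dil f z| <= V z.
Proof.
move=> z0 hV N; elim: N z z0 hV => [|N IH] z z0 hV.
  by rewrite big_ord0; apply: (hV z _).1; rewrite z0 lexx.
rewrite big_ord_recl /=.
have hp := IH _ (pz0 z0) (fun x hx => hV x (pz hx z0)).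
have hq := IH _ (qz0 z0) (fun x hx => hV x (qz hx z0)).
apply: (@le_trans _ _ (`|f z| + (V (p * z) + V ((1 - p) * z)))).
  rewrite lerD2l; apply: le_trans (lerD hp hq); rewrite -big_split.
  by apply: ler_sum => k _; exact: ler_normD.
by rewrite -lerBrDr; apply: (hV z _).2; rewrite z0 lexx.
Qed.

Lemma renew_cvg_norm f V z : 0 <= z ->
  (forall x, 0 <= x <= z -> 0 <= V x /\ `|f x| <= V x - dil V x) ->
  cvgn [normed series (fun k => iter k dil f z)].
Proof.
move=> z0 hV; apply: nondecreasing_is_cvgn.
  by apply: nondecreasing_series => k _ _; exact: normr_ge0.
by exists (V z) => _ [N _ <-]; apply: le_trans (dil_series_le z0 hV N); rewrite -(big_mkord xpredT (fun k => `|iter k dil f z|)).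
Qed.

Lemma renew_cvg f V z : 0 <= z ->
  (forall x, 0 <= x <= z -> 0 <= V x /\ `|f x| <= V x - dil V x) ->
  series (fun k => iter k dil f z) @ \oo --> renew f z.
Proof. by move=> z0 hV; apply: normed_cvg; exact: renew_cvg_norm hV. Qed.

Lemma renew_le f V z : 0 <= z ->
  (forall x, 0 <= x <= z -> 0 <= V x /\ `|f x| <= V x - dil V x) ->
  `|renew f z| <= V z.
Proof.
move=> z0 hV; apply: (@le_trans _ _ (limn [normed series (fun k => iter k dil f z)])).
  by apply: lim_series_norm; exact: renew_cvg_norm hV.
apply: limr_le; first exact: renew_cvg_norm hV.
by near=> N; apply: le_trans (dil_series_le z0 hV N); rewrite -(big_mkord xpredT (fun k => `|iter k dil f z|)).
Unshelve. all: by end_near. Qed.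

Lemma renew_eq f V z : 0 <= z ->
  (forall x, 0 <= x <= z -> 0 <= V x /\ `|f x| <= V x - dil V x) ->
  renew f z = f z + (renew f (p * z) + renew f ((1 - p) * z)).
Proof.
move=> z0 hV; apply: cvg_lim => //.
apply/(cvg_succP (series (fun k => iter k dil f z))).
rewrite (_ : (fun L => _) = (fun n => f z + (series (fun k => iter k dil f (p * z)) n +
    series (fun k => iter k dil f ((1 - p) * z)) n))); last first.
  apply/funext => n; rewrite /series /= big_nat_recl //=; congr (_ + _).
  by rewrite -big_split.
apply: cvgD; first exact: cvg_cst.
apply: cvgD; first exact: (renew_cvg (pz0 z0) (fun x hx => hV x (pz hx z0))).
exact: (renew_cvg (qz0 z0) (fun x hx => hV x (qz hx z0))).
Qed.

Lemma iter_dilD f g k z :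
  iter k dil (fun x => f x + g x) z = iter k dil f z + iter k dil g z.
Proof. by elim: k z => //= k IH z; rewrite /dil !IH addrACA. Qed.

Lemma iter_dilZ c f k z : iter k dil (fun x => c * f x) z = c * iter k dil f z.
Proof. by elim: k z => //= k IH z; rewrite /dil !IH mulrDr. Qed.

Lemma iter_dil_scale s f k z :
  iter k dil (fun x => f (s * x)) z = iter k dil f (s * z).
Proof. by elim: k z => //= k IH z; rewrite /dil !IH !(mulrCA s). Qed.

Lemma renew_scale s f z : renew (fun x => f (s * x)) z = renew f (s * z).
Proof.
rewrite /renew; have -> // : (fun k => iter k dil (fun x => f (s * x)) z) =
  (fun k => iter k dil f (s * z)).
by apply/funext => k; exact: iter_dil_scale.
Qed.

Definition summable f z := cvgn (series (fun k => iter k dil f z)).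

Lemma summableZ c f z : summable f z -> summable (fun x => c * f x) z.
Proof.
rewrite /summable => h.
have -> : (fun k => iter k dil (fun x => c * f x) z) = (fun k => c *: iter k dil f z).
  by apply/funext => k; exact: iter_dilZ.
exact: is_cvg_seriesZ.
Qed.

Lemma renewZ c f z : summable f z -> renew (fun x => c * f x) z = c * renew f z.
Proof.
rewrite /summable /renew => h.
have -> : (fun k => iter k dil (fun x => c * f x) z) = (fun k => c *: iter k dil f z).
  by apply/funext => k; exact: iter_dilZ.
exact: lim_seriesZ.
Qed.

Lemma renewD f g z : summable f z -> summable g z ->
  renew (fun x => f x + g x) z = renew f z + renew g z.
Proof.
rewrite /summable /renew => hf hg.
have -> : (fun k => iter k dil (fun x => f x + g x) z) = (fun k => iter k dil f z) + (fun k => iter k dil g z).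
  by apply/funext => k; exact: iter_dilD.
exact: lim_seriesD.
Qed.

(* [pot] is a supersolution: [pot - dil pot] dominates a multiple of [wt]. *)
Definition pot z : R := z ^+ 2 / (1 + z).
Definition wt z : R := z ^+ 2 / (1 + z) ^+ 2.

Lemma wt_ge0 z : 0 <= wt z. Proof. by rewrite divr_ge0 ?sqr_ge0. Qed.

Lemma pot_ge0 z : 0 <= z -> 0 <= pot z.
Proof. by move=> z0; rewrite divr_ge0 ?sqr_ge0 // addr_ge0. Qed.

Lemma pot_le z : 0 <= z -> pot z <= z.
Proof. by move=> z0; rewrite /pot ler_pdivrMr; [nra|rewrite ltr_pwDl]. Qed.

(** Since pot z = z - z / (1 + z), the linear part cancels in [pot z - dil pot z], and what remains
    is the strict subadditivity of z / (1 + z). *)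
Lemma pot_dil z : 0 <= z -> p * (1 - p) * wt z <= pot z - dil pot z.
Proof.
move=> z0; have z1 : 0 < 1 + z by rewrite ltr_pwDl.
have hp : 0 < 1 + p * z by rewrite ltr_pwDl // pz0.
have hq : 0 < 1 + (1 - p) * z by rewrite ltr_pwDl // qz0.
have pq0 : 0 < p * (1 - p) by rewrite mulr_gt0.
have hpq : 0 < 1 + z + p * (1 - p) * z ^+ 2 by rewrite ltr_pwDl // mulr_ge0 ?sqr_ge0 // ltW.
have -> : pot z - dil pot z =
    (p * (1 - p) * z ^+ 2) * ((2 + z) / ((1 + z) * (1 + z + p * (1 - p) * z ^+ 2))).
  by rewrite /pot /dil; field; rewrite !gt_eqF //.
rewrite /wt mulrA; apply: ler_wpM2l; first by rewrite mulr_ge0 ?sqr_ge0 // ltW.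
rewrite -[leLHS]mul1r ler_pdivrMr ?exprn_gt0 // mulrAC ler_pdivlMr ?mulr_gt0 //.
have pq1 : p * (1 - p) <= 1 by move: p0 p1; nra.
move: (p * (1 - p)) pq0 pq1 => c c0 c1.
have h : 1 + z + c * z ^+ 2 <= (1 + z) ^+ 2 by nra.
have : (1 + z) * (1 + z + c * z ^+ 2) <= (1 + z) * (1 + z) ^+ 2 by rewrite ler_pM2l.
have : 0 <= (1 + z) ^+ 2 by rewrite sqr_ge0.
nra.
Qed.

Lemma pot_bound f c z : 0 <= c -> 0 <= z ->
  (forall x, 0 <= x <= z -> `|f x| <= c * wt x) ->
  forall x, 0 <= x <= z ->
    0 <= c / (p * (1 - p)) * pot x /\
    `|f x| <= c / (p * (1 - p)) * pot x - dil (fun y => c / (p * (1 - p)) * pot y) x.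
Proof.
move=> c0 z0 h x hx; have [x0 xz] := andP hx.
have pq0 : 0 < p * (1 - p) by rewrite mulr_gt0.
have k0 : 0 <= c / (p * (1 - p)) by rewrite divr_ge0 // ltW.
split; first by rewrite mulr_ge0 // pot_ge0.
apply: (le_trans (h x hx)); rewrite /dil -mulrDr -mulrBr.
have := ler_wpM2l k0 (pot_dil x0); rewrite mulrA divfK // gt_eqF //.
Qed.

(** A second supersolution, x^2, with 1 - p^2 - q^2 = 2 p q. It serves sources that are only O(x^2),
    such as those that do not decay at infinity. *)
Lemma sqr_bound f c z : 0 <= c -> 0 <= z ->
  (forall x, 0 <= x <= z -> `|f x| <= c * x ^+ 2) ->
  forall x, 0 <= x <= z ->
    0 <= c / (2 * (p * (1 - p))) * x ^+ 2 /\
    `|f x| <= c / (2 * (p * (1 - p))) * x ^+ 2 - dil (fun y => c / (2 * (p * (1 - p))) * y ^+ 2) x.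
Proof.
move=> c0 z0 h x hx.
have pq0 : 0 < p * (1 - p) by rewrite mulr_gt0.
split; first by rewrite mulr_ge0 ?sqr_ge0 // divr_ge0 // mulr_ge0 // ltW.
apply: (le_trans (h x hx)); rewrite le_eqVlt; apply/orP; left; apply/eqP.
by rewrite /dil; field; rewrite !gt_eqF.
Qed.

End Dilation.

(** * The Poisson toll and its binomial counterpart *)

Section TollFunction.
Context {R : realType}.
Variable m : nat.
Hypothesis m2 : (1 < m)%N.

Definition toll_fun (z : R) : R := z ^+ m * expR (- z).

(** From 1 + x <= expR x at x = z / (M + 1), raised to the power M + 1. *)
Lemma poly_exp_le M (z : R) : 0 <= z -> (1 + z) ^+ M.+1 * expR (- z) <= M.+1%:R ^+ M.+1.
Proof.
move=> z0; rewrite expRN ler_pdivrMr ?expR_gt0 //.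
have E : expR z = expR (z / M.+1%:R) ^+ M.+1.
  by rewrite -expRM_natl mulrC divfK // pnatr_eq0.
rewrite E -exprMn lerXn2r ?nnegrE ?addr_ge0 ?mulr_ge0 ?expR_ge0 //.
apply: le_trans (ler_wpM2l (ler0n _ _) (expR_ge1Dx _)).
rewrite mulrDr mulr1 mulrC divfK ?pnatr_eq0 // lerD2r.
by rewrite ler1n.
Qed.

Lemma toll_fun_ge0 z : 0 <= z -> 0 <= toll_fun z.
Proof. by move=> z0; rewrite mulr_ge0 ?exprn_ge0 ?expR_ge0. Qed.

Lemma toll_fun_wt N : exists2 C : R, 0 <= C & forall z, 0 <= z ->
  toll_fun z * (1 + z) ^+ N <= C * wt z.
Proof.
exists ((m + N).-1.+1%:R ^+ (m + N).-1.+1) => [|z z0]; first by rewrite exprn_ge0.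
have z1 : 0 < 1 + z by rewrite ltr_pwDl.
rewrite /wt mulrA ler_pdivlMr ?exprn_gt0 // /toll_fun.
have h := poly_exp_le (m + N).-1 z0.
apply: le_trans (ler_wpM2r (sqr_ge0 z) h); rewrite prednK; last by rewrite addn_gt0 (ltnW m2).
have -> : (1 + z) ^+ (m + N) * expR (- z) * z ^+ 2 =
   z ^+ 2 * (1 + z) ^+ (m - 2) * (expR (- z) * (1 + z) ^+ N * (1 + z) ^+ 2).
  by rewrite -{1}(subnK m2) !exprD; ring.
have -> : z ^+ m * expR (- z) * (1 + z) ^+ N * (1 + z) ^+ 2 =
   z ^+ 2 * z ^+ (m - 2) * (expR (- z) * (1 + z) ^+ N * (1 + z) ^+ 2).
  by rewrite -{1}(subnK m2) !exprD; ring.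
apply: ler_wpM2r; first by rewrite !mulr_ge0 ?expR_ge0 ?exprn_ge0 // ltW.
apply: ler_wpM2l; first exact: sqr_ge0.
by rewrite lerXn2r ?nnegrE ?lerDr // ltW.
Qed.

(* [n choose m] a^m (1-a)^(n-m), the probability that exactly [m] of [n] strings
   fall in a set of measure [a]. *)
Definition binp n (a : R) : R := 'C(n, m)%:R * a ^+ m * (1 - a) ^+ (n - m).

Lemma ffact_lower n k : (0 < n)%N -> n%:R ^+ k * (1 - k%:R ^+ 2 / n%:R) <= (n ^_ k)%:R :> R.
Proof.
move=> n0; have nR : (0 : R) < n%:R by rewrite ltr0n.
elim: k => [|k IH]; first by rewrite expr0n /= mul0r subr0 mulr1 expr0.
rewrite ffactnSr natrM; case: (leqP n k) => nk.
  rewrite (_ : (n - k)%N = 0%N) ?mulr0; last by apply/eqP; rewrite subn_eq0.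
  rewrite mulr_ge0_le0 ?exprn_ge0 // subr_le0 ler_pdivlMr // mul1r.
  by rewrite -natrX ler_nat; apply: (leq_trans nk); rewrite expnS expn1; nia.
rewrite natrB 1?ltnW //.
have kn : (k%:R : R) <= n%:R by rewrite ler_nat ltnW.
have nk0 : (0 : R) <= n%:R - k%:R by rewrite subr_ge0.
apply: le_trans (ler_wpM2r nk0 IH).
rewrite exprSr -[leLHS]mulrA -[leRHS]mulrA ler_wpM2l ?exprn_ge0 // -natr1.
have -> : n%:R * (1 - (k%:R + 1) ^+ 2 / n%:R) = n%:R - (k%:R + 1) ^+ 2 :> R.
  by field; rewrite gt_eqF.
have -> : (1 - k%:R ^+ 2 / n%:R) * (n%:R - k%:R) = n%:R - k%:R - k%:R ^+ 2 + k%:R ^+ 3 / n%:R :> R.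
  by field; rewrite gt_eqF.
have k0 : (0 : R) <= k%:R by [].
have : 0 <= k%:R ^+ 3 / n%:R :> R by rewrite divr_ge0 ?exprn_ge0.
nra.
Qed.

Lemma pow_exp_lower n (a : R) : 0 <= a <= 1 -> expR (- (n%:R * a)) * (1 - n%:R * a ^+ 2) <= (1 - a) ^+ n.
Proof.
move=> /andP[a0 a1].
have b0 : 0 <= 1 - a by rewrite subr_ge0.
have h : 1 - a ^+ 2 <= (1 - a) * expR a.
  have -> : 1 - a ^+ 2 = (1 - a) * (1 + a) by ring.
  by rewrite ler_wpM2l // expR_ge1Dx.
have h0 : 0 <= 1 - a ^+ 2 by rewrite subr_ge0 expr_le1.
have hb : 1 - n%:R * a ^+ 2 <= (1 - a ^+ 2) ^+ n.
  elim: n => [|n IH]; first by rewrite mul0r subr0 expr0.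
  rewrite [leRHS]exprS; apply: (@le_trans _ _ ((1 - a ^+ 2) * (1 - n%:R * a ^+ 2))); last exact: ler_wpM2l.
  have : 0 <= n%:R * (a ^+ 2 * a ^+ 2) by rewrite mulr_ge0 // mulr_ge0 ?sqr_ge0.
  rewrite -natr1; nra.
rewrite expRN mulrC ler_pdivrMr ?expR_gt0 // expRM_natl -exprMn.
by apply: (le_trans hb); rewrite lerXn2r ?nnegrE // (le_trans h0).
Qed.

Lemma pow_exp_upper n (a : R) : 0 <= a <= 1 -> (1 - a) ^+ (n - m) <= expR (- (n%:R * a)) * (1 + a * (m%:R * expR m%:R)).
Proof.
move=> /andP[a0 a1]; have b0 : 0 <= 1 - a by rewrite subr_ge0.
have h1 : 1 - a <= expR (- a) by exact: expR_ge1Dx.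
apply: (@le_trans _ _ (expR (- a) ^+ (n - m))).
  by rewrite lerXn2r ?nnegrE ?expR_ge0.
rewrite -expRM_natl.
apply: (@le_trans _ _ (expR (- (n%:R * a) + m%:R * a))).
  rewrite ler_expR; have : (n%:R : R) <= (n - m)%:R + m%:R by rewrite -natrD ler_nat; lia.
  nra.
rewrite expRD ler_wpM2l ?expR_ge0 //.
have : expR (m%:R * a) - 1 <= (m%:R * a) * expR (m%:R * a).
  have := expR_ge1Dx (- (m%:R * a)); rewrite expRN.
  have e0 := expR_gt0 (m%:R * a).
  move=> /(ler_wpM2l (ltW e0)); rewrite mulfV ?gt_eqF //; lra.
have : (m%:R * a) * expR (m%:R * a) <= (m%:R * a) * expR m%:R.
  by rewrite ler_wpM2l ?mulr_ge0 // ler_expR ler_piMr.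
lra.
Qed.

(** With z = n a, the relative error is of order (1 + z)^2 / n, and the exponential decay of the
    toll absorbs the polynomial. The weight [wt] sums to O(n) over all words, so the factor 1 / n
    leaves a total error O(1). *)
Lemma binp_close : exists2 C : R, 0 <= C & forall n (a : R), (0 < n)%N -> 0 <= a <= 1 ->
  `|m`!%:R * binp n a - toll_fun (n%:R * a)| <= C / n%:R * wt (n%:R * a).
Proof.
have [C1 C10 hC1] := toll_fun_wt 2.
pose c : R := m%:R ^+ 2 + m%:R * expR m%:R + 1.
have mm0 : 0 <= m%:R * expR m%:R :> R by rewrite mulr_ge0 ?expR_ge0.
have c0 : 0 <= c by rewrite /c !addr_ge0 ?sqr_ge0.
exists (c * C1) => [|n a n0 ha]; first by rewrite mulr_ge0.
have [a0 a1] := andP ha.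
have nR : (0 : R) < n%:R by rewrite ltr0n.
have na0 : 0 <= n%:R * a by rewrite mulr_ge0.
pose z := n%:R * a; have zE : a = z / n%:R by rewrite /z mulrAC divff ?mul1r // gt_eqF.
suff : `|m`!%:R * binp n a - toll_fun z| <= c / n%:R * (toll_fun z * (1 + z) ^+ 2).
  move=> /le_trans; apply.
  have -> : c * C1 / n%:R * wt z = c / n%:R * (C1 * wt z) by field; rewrite gt_eqF.
  by rewrite ler_wpM2l ?divr_ge0 //; exact: hC1.
have -> : m`!%:R * binp n a = (n ^_ m)%:R * a ^+ m * (1 - a) ^+ (n - m).
  by rewrite /binp !mulrA -natrM mulnC bin_ffact.
have am0 : 0 <= a ^+ m by rewrite exprn_ge0.
have e0 := expR_gt0 (- z).
have b0 : 0 <= 1 - a by rewrite subr_ge0.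
have zm : z ^+ m = n%:R ^+ m * a ^+ m by rewrite -exprMn.
have ffle : (n ^_ m)%:R <= n%:R ^+ m :> R.
  rewrite -natrX ler_nat; elim: (m) => // k IH.
  by rewrite ffactnSr expnSr leq_mul // leq_subr.
have T0 : 0 <= toll_fun z by exact: toll_fun_ge0.
have cm : m%:R ^+ 2 + 1 <= c by rewrite /c lerD2r lerDl.
have cK : m%:R * expR m%:R <= c by rewrite /c -addrA addrCA lerDl addr_ge0 ?sqr_ge0.
have bn0 : 0 <= (1 - a) ^+ (n - m) by rewrite exprn_ge0.
rewrite ler_norml; apply/andP; split.
- pose x : R := m%:R ^+ 2 / n%:R; pose y : R := z ^+ 2 / n%:R.
  have x0 : 0 <= x by rewrite divr_ge0 ?sqr_ge0.
  have y0 : 0 <= y by rewrite divr_ge0 ?sqr_ge0.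
  have hA : z ^+ m * (1 - x) <= (n ^_ m)%:R * a ^+ m.
    by rewrite zm mulrAC ler_wpM2r //; exact: ffact_lower.
  have hB : expR (- z) * (1 - y) <= (1 - a) ^+ (n - m).
    apply: (@le_trans _ _ ((1 - a) ^+ n)); last first.
      by rewrite lerXn2l_wpX || (rewrite ler_wiXn2l // ?leq_subr // gerBl).
    have -> : y = n%:R * a ^+ 2 by rewrite /y /z; field; rewrite gt_eqF.
    exact: pow_exp_lower.
  have A0 : 0 <= (n ^_ m)%:R * a ^+ m by rewrite mulr_ge0.
  have zm0 : 0 <= z ^+ m by rewrite exprn_ge0.
  have AB : toll_fun z * (1 - x - y) <= (n ^_ m)%:R * a ^+ m * (1 - a) ^+ (n - m).
    case: (leP 1 (x + y)) => hxy.
      apply: (@le_trans _ _ 0); last by rewrite mulr_ge0.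
      by rewrite mulr_ge0_le0 //; lra.
    apply: (@le_trans _ _ ((z ^+ m * (1 - x)) * (expR (- z) * (1 - y)))).
      have -> : (z ^+ m * (1 - x)) * (expR (- z) * (1 - y)) = toll_fun z * (1 - x - y + x * y).
        by rewrite /toll_fun; ring.
      by rewrite ler_wpM2l // lerDl mulr_ge0.
    have [x1 y1] : x <= 1 /\ y <= 1 by move: (x) (y) x0 y0 hxy => u v u0 v0 h; split; lra.
    by apply: ler_pM => //; (apply: mulr_ge0; [exact: ltW|]) || apply: mulr_ge0 => //; rewrite subr_ge0.
  have : toll_fun z * (x + y) <= c / n%:R * (toll_fun z * (1 + z) ^+ 2).
    have -> : c / n%:R * (toll_fun z * (1 + z) ^+ 2) = toll_fun z * (c * (1 + z) ^+ 2 / n%:R).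
      by field; rewrite gt_eqF.
    rewrite ler_wpM2l // /x /y -mulrDl ler_wpM2r ?invr_ge0 ?(ltW nR) //.
    have c1 : 1 <= c by apply: le_trans cm; rewrite lerDr sqr_ge0.
    have : m%:R ^+ 2 <= c by apply: le_trans cm; rewrite lerDl.
    move: (m%:R ^+ 2) => M hM; have := ler_wpM2r (sqr_ge0 z) c1.
    have : 0 <= c * z by rewrite mulr_ge0.
    have -> : c * (1 + z) ^+ 2 = c + 2 * (c * z) + c * z ^+ 2 by ring.
    lra.
  lra.
- rewrite lerBlDr.
  apply: (@le_trans _ _ (z ^+ m * (expR (- z) * (1 + a * (m%:R * expR m%:R))))).
    rewrite zm; apply: ler_pM => //; first by rewrite mulr_ge0.
      by rewrite ler_wpM2r.
    exact: pow_exp_upper.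
  rewrite mulrA -/(toll_fun z) mulrDr mulr1 addrC lerD2r.
  have -> : c / n%:R * (toll_fun z * (1 + z) ^+ 2) = toll_fun z * (c * (1 + z) ^+ 2 / n%:R).
    by field; rewrite gt_eqF.
  rewrite ler_wpM2l // zE mulrAC ler_wpM2r ?invr_ge0 ?(ltW nR) //.
  have := ler_wpM2l na0 cK; have : 0 <= c * z ^+ 2 by rewrite mulr_ge0 ?sqr_ge0.
  have : 0 <= c * z by rewrite mulr_ge0.
  have -> : c * (1 + z) ^+ 2 = c + 2 * (c * z) + c * z ^+ 2 by ring.
  by rewrite -/z (mulrC z c); lra.
Qed.

End TollFunction.

(** * From the exact mean to its Poisson version *)

Section Depoissonization.
Context {R : realType}.
Variable p : R.
Hypotheses (p0 : 0 < p) (p1 : p < 1).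

Lemma binpS m n (a : R) : binp m.+1 n.+1 a = (1 - a) * binp m.+1 n a + a * binp m n a.
Proof.
rewrite /binp binS natrD subSS exprS; case: (leqP m.+1 n) => h.
  have -> : (n - m)%N = (n - m.+1).+1 by lia.
  by rewrite exprS; ring.
by rewrite (bin_small h); ring.
Qed.

Lemma binp0S n (a : R) : binp 0 n.+1 a = (1 - a) * binp 0 n a.
Proof. by rewrite /binp !bin0 !subn0 !expr0 exprS; ring. Qed.

Lemma binp_00 m (a b : R) : binp m 0 a = binp m 0 b.
Proof. by rewrite /binp; case: m => [|m]; rewrite ?bin0n ?mul0r ?expr0. Qed.

(** Thinning: a binomial number of trials with success probability [a] has a binomial number of
    successes, with parameter [p * a]. *)
Lemma binE_binp_right m n (a : R) : binE p n (fun j k => binp m k a) = binp m n (p * a).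
Proof.
elim: n m => [|n IH] m /=; first exact: binp_00.
case: m => [|m].
  rewrite IH (eq_binE _ (g' := fun j k => (1 - a) * binp 0 k a)).
    by rewrite binEZ IH binp0S; ring.
  by move=> j k _; rewrite binp0S.
rewrite IH (eq_binE _ (g' := fun j k => (1 - a) * binp m.+1 k a + a * binp m k a)).
  by rewrite binED !binEZ !IH binpS; ring.
by move=> j k _; rewrite binpS.
Qed.

Lemma binE_binp_left m n (a : R) : binE p n (fun j k => binp m j a) = binp m n ((1 - p) * a).
Proof.
elim: n m => [|n IH] m /=; first exact: binp_00.
case: m => [|m].
  rewrite IH (eq_binE _ (g' := fun j k => (1 - a) * binp 0 j a)).
    by rewrite binEZ IH binp0S; ring.
  by move=> j k _; rewrite binp0S.
rewrite IH (eq_binE _ (g' := fun j k => (1 - a) * binp m.+1 j a + a * binp m j a)).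
  by rewrite binED !binEZ !IH binpS; ring.
by move=> j k _; rewrite binpS.
Qed.

Lemma binp1 m n : binp m n (1 : R) = (n == m)%:R.
Proof.
rewrite /binp subrr expr1n mulr1; case: (ltngtP n m) => h.
- by rewrite bin_small // mul0r.
- by rewrite expr0n subn_eq0 leqNgt h /= mulr0.
- by rewrite h binn subnn expr0 mulr1.
Qed.

Lemma binE_iter_dil m n k (a : R) :
  binE p n (fun j i => iter k (dil p) (binp m j) a) = iter k (dil p) (binp m n) ((1 - p) * a) /\
  binE p n (fun j i => iter k (dil p) (binp m i) a) = iter k (dil p) (binp m n) (p * a).
Proof.
elim: k a => [|k IH] a /=; first by rewrite binE_binp_left binE_binp_right.
have [h1 h2] := IH (p * a); have [h3 h4] := IH ((1 - p) * a).
rewrite /dil !binED h1 h2 h3 h4.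
by rewrite (mulrCA (1 - p) p a).
Qed.

Variable m : nat.
Hypothesis m2 : (1 < m)%N.

Let p0w : 0 <= p. Proof. exact: ltW. Qed.
Let q0w : 0 <= 1 - p. Proof. by rewrite subr_ge0 ltW. Qed.

Lemma binp_bound n : forall x : R, 0 <= x <= 1 -> `|binp m n x| <= 'C(n, m)%:R * x ^+ 2.
Proof.
move=> x /andP[x0 x1]; rewrite /binp ger0_norm; last first.
  by rewrite !mulr_ge0 ?exprn_ge0 // subr_ge0.
rewrite -mulrA ler_wpM2l // -[leRHS]mulr1; apply: ler_pM; rewrite ?exprn_ge0 ?subr_ge0 //.
  by rewrite ler_wiXn2l.
by rewrite exprn_ile1 ?subr_ge0 // gerBl.
Qed.

Lemma binp_summable n (x : R) : 0 <= x <= 1 -> summable p (binp m n) x.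
Proof.
move=> /andP[x0 x1]; apply/cvg_ex; eexists.
apply: (renew_cvg p0 p1 x0 (sqr_bound p0 p1 (ler0n _ _) x0 _)).
by move=> y /andP[y0 yx]; apply: binp_bound; rewrite y0 (le_trans yx).
Qed.

(** [renew p (binp m n) 1] is the expected number of words that are a prefix of exactly [m] of the
    [n] strings; the empty word gives the indicator, the first letter gives the split. *)
Lemma renew_binp_rec n : renew p (binp m n) 1 =
  binE p n (fun j k => renew p (binp m j) 1 + renew p (binp m k) 1) + (n == m)%:R.
Proof.
have h := sqr_bound p0 p1 (ler0n _ _) ler01 (@binp_bound n).
rewrite (renew_eq p0 p1 ler01 h) binp1 addrC; congr (_ + _).
have h1 : series (fun k => iter k (dil p) (binp m n) (p * 1)) x +
     series (fun k => iter k (dil p) (binp m n) ((1 - p) * 1)) x @[x --> \oo] -->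
     binE p n (fun j k => renew p (binp m j) 1 + renew p (binp m k) 1).
  have -> : (fun x => series (fun k => iter k (dil p) (binp m n) (p * 1)) x +
     series (fun k => iter k (dil p) (binp m n) ((1 - p) * 1)) x) =
    (fun N => binE p n (fun j k => series (fun i => iter i (dil p) (binp m j) 1) N +
       series (fun i => iter i (dil p) (binp m k) 1) N)).
    apply/funext => N; rewrite binED addrC /series /=; congr (_ + _).
      rewrite binE_sum; apply: eq_bigr => k _; by rewrite (binE_iter_dil _ _ _ 1).1.
    rewrite binE_sum; apply: eq_bigr => k _; by rewrite (binE_iter_dil _ _ _ 1).2.
  by apply: cvg_binE => j k _; apply: cvgD; apply: binp_summable; rewrite ler01 lexx.
have h2 : series (fun k => iter k (dil p) (binp m n) (p * 1)) x +
     series (fun k => iter k (dil p) (binp m n) ((1 - p) * 1)) x @[x --> \oo] -->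
     renew p (binp m n) (p * 1) + renew p (binp m n) ((1 - p) * 1).
  by apply: cvgD; apply: binp_summable; rewrite mulr1 ?p0w ?q0w ?(ltW p1) // gerBl.
exact: (cvg_unique (@Rhausdorff R) h2 h1).
Qed.

Variable t : bintree.
Hypotheses (ft : full_tree t) (mE : nleaves t = m).

(** Below a prefix shared by exactly [m] strings hangs a trie of [m] strings, with [t] at its root
    with probability [mean_toll p t m]. The proof compares two solutions of one recursion. *)
Lemma mean_copies_renew n :
  mean_copies p t n = mean_toll p t m * renew p (binp m n) 1.
Proof.
have m2' : (1 < nleaves t)%N by rewrite mE.
pose r n := mean_toll p t m * renew p (binp m n) 1.
have rrec i : r i = binE p i (fun j k => r j + r k) + mean_toll p t i.
  rewrite /r renew_binp_rec mulrDr; congr (_ + _).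
    by rewrite -binEZ; apply: eq_binE => j k _; rewrite mulrDr.
  case: eqP => [->|/eqP h]; first by rewrite mulr1.
  by rewrite mulr0 (mean_toll_neq p0 p1) // mE.
have r_small i : (i < 2)%N -> r i = 0.
  move=> i2; rewrite /r; suff -> : renew p (binp m i) 1 = 0 by rewrite mulr0.
  have := renew_le p0 p1 ler01 (sqr_bound p0 p1 (ler0n _ _) ler01 (@binp_bound i)).
  by rewrite bin_small ?(leq_trans i2) // mul0r mul0r normr_le0 => /eqP.
have e_small i : (i < 2)%N -> mean_copies p t i = 0.
  by case: i => [|[|]] // _; [exact: mean_copies0|exact: mean_copies1].
have key (s : R) i : s * (mean_copies p t i - r i) <= 0.
  apply: (binE_comparison p0 p1 (al := 1) (be := 1) (n0 := 2)
    (D := fun i => s * (mean_copies p t i - r i))) => //.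
  - move=> j j2; split; first exact: ltnW.
    case: j j2 => [|[|j]] // _; rewrite !mul1r.
    have : (1 - p) ^+ j <= 1 by rewrite exprn_ile1 // gerBl.
    have : p ^+ j <= 1 by rewrite exprn_ile1 // ltW.
    move=> /(ler_wpM2l (sqr_ge0 p)) h1 /(ler_wpM2l (sqr_ge0 (1 - p))) h2.
    rewrite !exprS !mulrA -!expr2; apply: (le_lt_trans (lerD h2 h1)); rewrite !mulr1.
    by move: p0 p1; nra.
  - by move=> j j2; rewrite e_small // r_small // subrr mulr0.
  - move=> j _; rewrite {1}rrec {1}(mean_copies_rec p0 p1 ft m2').
    rewrite [X in s * X](_ : _ = binE p j (fun j k => (mean_copies p t j + mean_copies p t k) - (r j + r k))); last first.
      by rewrite binEB; ring.
    rewrite -binEZ le_eqVlt; apply/orP; left; apply/eqP; apply: eq_binE => ? ? _; ring.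
apply/eqP; rewrite -subr_eq0 eq_le; apply/andP; split.
  by have := key 1 n; rewrite mul1r.
by have := key (-1) n; rewrite mulN1r oppr_le0.
Qed.

Lemma toll_fun_bound : exists2 C : R, 0 <= C & forall x, 0 <= x -> `|toll_fun m x| <= C * wt x.
Proof.
have [C C0 hC] := toll_fun_wt (R := R) m2 0; exists C => // x x0.
by rewrite ger0_norm ?toll_fun_ge0 //; have := hC x x0; rewrite expr0 mulr1.
Qed.

Lemma toll_fun_summable (z : R) : 0 <= z -> summable p (toll_fun m) z.
Proof.
move=> z0; have [C C0 hC] := toll_fun_bound; apply/cvg_ex; eexists.
apply: (renew_cvg p0 p1 z0 (pot_bound p0 p1 C0 z0 _)).
by move=> y /andP[y0 yx]; exact: hC.
Qed.

Lemma mean_copies_approx : exists C : R, forall n, (0 < n)%N ->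
  `|mean_copies p t n - mean_toll p t m / m`!%:R * renew p (toll_fun m) n%:R| <= C.
Proof.
have m2' : (1 < nleaves t)%N by rewrite mE.
have [C C0 hC] := binp_close (R := R) m2.
exists (C / (p * (1 - p))) => n n0; have nR : (0 : R) < n%:R by rewrite ltr0n.
have mf : (0 : R) < m`!%:R by rewrite ltr0n fact_gt0.
rewrite mean_copies_renew.
have E : m`!%:R * renew p (binp m n) 1 - renew p (toll_fun m) n%:R =
    renew p (fun a => m`!%:R * binp m n a + (-1) * toll_fun m (n%:R * a)) 1.
  have s1 : summable p (binp m n) 1 by apply: binp_summable; rewrite ler01 lexx.
  have s2 : summable p (fun a => toll_fun m (n%:R * a)) 1.
    rewrite /summable (_ : (fun k => _) = (fun k => iter k (dil p) (toll_fun m) n%:R)).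
      exact: toll_fun_summable.
    by apply/funext => k; rewrite iter_dil_scale mulr1.
  rewrite renewD; [|exact: summableZ..].
  by rewrite !renewZ // renew_scale mulr1 mulN1r.
have B : `|m`!%:R * renew p (binp m n) 1 - renew p (toll_fun m) n%:R| <= C / (p * (1 - p)).
  rewrite E.
  (* The supersolution rescaled by n; at x = 1 the bound [pot n <= n] cancels the factor 1 / n of
     the error. *)
  pose V x : R := C / n%:R / (p * (1 - p)) * pot (n%:R * x).
  have hV x : 0 <= x <= 1 -> 0 <= V x /\ `|m`!%:R * binp m n x + (-1) * toll_fun m (n%:R * x)| <= V x - dil p V x.
    move=> /andP[x0 x1]; have nx0 : 0 <= n%:R * x by rewrite mulr_ge0.
    have Cn0 : 0 <= C / n%:R by rewrite divr_ge0.
    have pq0 : 0 < p * (1 - p) by rewrite mulr_gt0 // subr_gt0.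
    split; first by rewrite mulr_ge0 ?pot_ge0 // divr_ge0 // ltW.
    rewrite mulN1r; apply: (le_trans (hC n x n0 _)); first by rewrite x0.
    rewrite /V /dil -mulrDr -mulrBr (mulrCA n%:R p) (mulrCA n%:R (1 - p)).
    have K0 : 0 <= C / n%:R / (p * (1 - p)) by rewrite divr_ge0 // ltW.
    apply: le_trans (ler_wpM2l K0 (pot_dil p0 p1 nx0)).
    by rewrite [leRHS]mulrA divfK // gt_eqF.
  apply: (le_trans (renew_le p0 p1 ler01 hV)); rewrite /V mulr1.
  apply: (@le_trans _ _ (C / n%:R / (p * (1 - p)) * n%:R)).
    by rewrite ler_wpM2l ?pot_le // !mulr_ge0 // invr_ge0 // ?ltW // mulr_gt0 // subr_gt0.
  rewrite le_eqVlt; apply/orP; left; apply/eqP; field.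
  by rewrite !gt_eqF // subr_gt0.
have -> : mean_toll p t m * renew p (binp m n) 1 - mean_toll p t m / m`!%:R * renew p (toll_fun m) n%:R =
   (mean_toll p t m / m`!%:R) * (m`!%:R * renew p (binp m n) 1 - renew p (toll_fun m) n%:R).
  by field; rewrite gt_eqF.
rewrite normrM -[leRHS]mul1r; apply: ler_pM => //.
rewrite ger0_norm ?divr_ge0 ?(mean_toll_ge0 p0 p1) //.
rewrite ler_pdivrMr // mul1r; apply: (le_trans (mean_toll_le1 p0 p1 t m)).
by rewrite ler1n fact_gt0.
Qed.

End Depoissonization.

Lemma mvt_everywhere (R : realType) (f df : R -> R) (a b : R) : a <= b ->
  (forall x : R, is_derive x 1 f (df x)) -> exists2 c, a <= c <= b & f b - f a = df c * (b - a).
Proof.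
move=> ab h; have [|c cab ->] := @MVT_segment R f df a b ab (fun x _ => h x).
  by apply: derivable_within_continuous => x _; have [] := h x.
by exists c => //; rewrite in_itv /= in cab.
Qed.

Lemma is_derive_conv (R : realType) (f g : R -> R) (x d d' : R) :
  is_derive x 1 f d -> f =1 g -> d = d' -> is_derive x 1 g d'.
Proof. by move=> h /funext <- <-. Qed.

(** * The incomplete Gamma function *)

Section IncompleteGamma.
Context {R : realType}.

(** The integral of x^k exp (- x) over [0, z], with integration by parts as its recursion. *)
Fixpoint igamma (k : nat) (z : R) : R :=
  if k is k'.+1 then k%:R * igamma k' z - z ^+ k * expR (- z) else 1 - expR (- z).

Lemma is_derive_igamma k (z : R) : is_derive z 1 (igamma k) (z ^+ k * expR (- z)).
Proof.
have hE (x : R) : is_derive x 1 (fun y => expR (- y)) (- expR (- x) : R).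
  apply: is_derive_conv (is_derive1_comp (is_derive_expR _) (is_deriveN (is_derive_id x 1))) _ _ => //.
  by rewrite mulrN1.
elim: k => [|k IH] /=.
  apply: is_derive_conv (is_deriveB (is_derive_cst (1 : R) z 1) (hE z)) _ _ => //.
  by rewrite sub0r opprK expr0 mul1r.
have hX := is_deriveX k.+1 (is_derive_id z 1).
apply: is_derive_conv (is_deriveB (is_deriveZ k.+1%:R IH) (is_deriveM hX (hE z))) _ _.
  by move=> y; rewrite -[LHS]/(k.+1%:R * igamma k y - (id ^+ k.+1) y * expR (- y)) exprfctE.
rewrite exprfctE /GRing.scale /= mulr1 [z ^+ k.+1]exprS.
by ring.
Qed.

Lemma igamma0 k : igamma k 0 = 0.
Proof.
elim: k => [|k IH] /=; first by rewrite oppr0 expR0 subrr.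
by rewrite IH mulr0 expr0n /= mul0r subrr.
Qed.

Lemma igamma_homo k (x y : R) : 0 <= x -> x <= y -> igamma k x <= igamma k y.
Proof.
move=> x0 xy; have [c /andP[xc _] h] := mvt_everywhere xy (is_derive_igamma k).
rewrite -subr_ge0 h mulr_ge0 ?subr_ge0 // mulr_ge0 ?expR_ge0 ?exprn_ge0 //.
exact: le_trans xc.
Qed.

Lemma igamma_ge0 k (z : R) : 0 <= z -> 0 <= igamma k z.
Proof. by move=> z0; rewrite -(igamma0 k); exact: igamma_homo. Qed.

Lemma igamma_le k : exists2 C : R, 0 <= C & forall z, 0 <= z -> igamma k z <= C * z.
Proof.
exists (k.+1%:R ^+ k.+1) => [|z z0]; first by rewrite exprn_ge0.
have [c /andP[c0 _] h] := mvt_everywhere z0 (is_derive_igamma k).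
move: h; rewrite igamma0 !subr0 => ->; rewrite ler_wpM2r //.
apply: (le_trans _ (poly_exp_le k c0)); rewrite ler_wpM2r ?expR_ge0 //.
apply: (@le_trans _ _ ((1 + c) ^+ k)).
  by rewrite lerXn2r ?nnegrE ?addr_ge0 // lerDr.
by rewrite exprS ler_peMl ?exprn_ge0 ?addr_ge0 // lerDl.
Qed.

Lemma igamma_cvg k : igamma k z @[z --> +oo] --> (k`!%:R : R).
Proof.
have pe i : z ^+ i * expR (- z) @[z --> +oo] --> (0 : R).
  apply: (@squeeze_cvgr _ _ _ _ (fun=> 0) (fun z => i.+1.+1%:R ^+ i.+1.+1 * z^-1)).
  - near=> z; have z0 : 0 < z by near: z; exact: nbhs_pinfty_gt.
    apply/andP; split; first by apply: mulr_ge0; [rewrite exprn_ge0 // ltW|exact: expR_ge0].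
    rewrite ler_pdivlMr //; apply: (le_trans _ (poly_exp_le i.+1 (ltW z0))).
    rewrite mulrAC ler_wpM2r ?expR_ge0 // -exprSr [leRHS]exprS.
    apply: (@le_trans _ _ ((1 + z) ^+ i.+1)).
      by rewrite lerXn2r ?nnegrE ?addr_ge0 ?(ltW z0) // lerDr.
    by rewrite ler_peMl ?exprn_ge0 ?addr_ge0 ?(ltW z0) // lerDl (ltW z0).
  - exact: cvg_cst.
  - rewrite -[X in _ --> X](mulr0 (i.+2%:R ^+ i.+2)).
    by apply: cvgM; [exact: cvg_cst|apply/gtr0_cvgV0; [near=> z; near: z; exact: nbhs_pinfty_gt|exact: cvg_id]].
elim: k => [|k IH] /=.
  rewrite fact0 -[X in _ --> X]subr0; apply: cvgB; first exact: cvg_cst.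
  by have := pe 0%N; under eq_fun do rewrite expr0 mul1r.
rewrite factS natrM -[X in _ --> X]subr0; apply: cvgB; last exact: pe.
by apply: cvgM => //; exact: cvg_cst.
Unshelve. all: by end_near. Qed.

End IncompleteGamma.

(** * Increments on the logarithmic scale *)

Section TollIncrements.
Context {R : realType}.
Variable m : nat.
Hypothesis m2 : (1 < m)%N.

Lemma toll_fun_lip : exists2 C : R, 0 <= C & forall r z : R, 1 <= r <= 2 -> 0 <= z ->
  `|toll_fun m (r * z) - toll_fun m z| <= C * (r - 1) * wt z.
Proof.
have [C C0 hC] := toll_fun_wt (R := R) m2 1.
pose A : R := m%:R * 2 ^+ m + 1.
have A0 : 0 <= A by rewrite addr_ge0 // mulr_ge0 // exprn_ge0.
exists (A * C) => [|r z /andP[r1 r2] z0]; first by rewrite mulr_ge0.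
have s0 : 0 <= r - 1 by rewrite subr_ge0.
have r0 : 0 <= r by apply: le_trans r1.
have T0 := toll_fun_ge0 m z0.
suff : `|toll_fun m (r * z) - toll_fun m z| <= A * (r - 1) * (toll_fun m z * (1 + z) ^+ 1).
  move=> /le_trans; apply.
  have -> : A * C * (r - 1) * wt z = A * (r - 1) * (C * wt z) by ring.
  by rewrite ler_wpM2l ?mulr_ge0 //; exact: hC.
have hr : r ^+ m - 1 <= m%:R * 2 ^+ m * (r - 1).
  rewrite subrX1 mulrC ler_wpM2r //.
  apply: (@le_trans _ _ (\sum_(i < m) 2 ^+ m)).
    apply: ler_sum => i _; apply: (@le_trans _ _ (2 ^+ i)).
      by rewrite lerXn2r ?nnegrE.
    by rewrite ler_weXn2l ?ler1n // ltnW.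
  by rewrite sumr_const card_ord -[leLHS]mulr_natl.
have r1m : 1 <= r ^+ m by rewrite exprn_ege1.
have E : toll_fun m (r * z) = toll_fun m z * (r ^+ m * expR (- ((r - 1) * z))).
  rewrite /toll_fun exprMn (_ : - (r * z) = - z + - ((r - 1) * z)); last by ring.
  by rewrite expRD; ring.
have -> : toll_fun m (r * z) - toll_fun m z = toll_fun m z * (r ^+ m * expR (- ((r - 1) * z)) - 1).
  by rewrite E; ring.
rewrite normrM ger0_norm // mulrCA ler_wpM2l // expr1.
have e1 : expR (- ((r - 1) * z)) <= 1 by rewrite -[leRHS]expR0 ler_expR oppr_le0 mulr_ge0.
have e0 := expR_gt0 (- ((r - 1) * z)).
have elow : 1 - (r - 1) * z <= expR (- ((r - 1) * z)) by exact: expR_ge1Dx.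
have sz : 0 <= (r - 1) * z by rewrite mulr_ge0.
have Asz : (r - 1) * z <= A * ((r - 1) * z).
  by rewrite ler_peMl // /A lerDr mulr_ge0 // exprn_ge0.
have As : 0 <= A * (r - 1) by rewrite mulr_ge0.
have Asm : m%:R * 2 ^+ m * (r - 1) <= A * (r - 1) by rewrite ler_wpM2r // lerDl.
have -> : A * (r - 1) * (1 + z) = A * (r - 1) + A * ((r - 1) * z) by ring.
move: (expR _) e1 e0 elow => x x1 x0 xl; rewrite ler_norml; apply/andP; split.
  have : x <= r ^+ m * x by rewrite ler_peMl // ltW.
  lra.
have : r ^+ m * x <= r ^+ m by rewrite ler_piMr // exprn_ge0.
have : 0 <= A * ((r - 1) * z) by rewrite mulr_ge0.
lra.
Qed.

Lemma expR_sub1_le (x s : R) : 0 <= x <= s -> expR s <= 2 -> expR x - 1 <= 2 * s.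
Proof.
move=> /andP[x0 xs] hs.
have hx : expR x <= 2 by apply: le_trans hs; rewrite ler_expR.
have : 1 - x <= expR (- x) by exact: expR_ge1Dx.
rewrite expRN => /(ler_wpM2l (expR_ge0 x)); rewrite mulfV ?gt_eqF ?expR_gt0 //.
have := ler_wpM2r x0 hx; lra.
Qed.

(** At s = 0 the derivative in s of z times [igamma (m - 2) (expR s * z)] is z^m exp (- z), the
    toll. The second-order remainder carries the weight [wt], so that its sum over all words is
    linear in z. *)
Lemma igamma_increment : exists2 C : R, 0 <= C & forall s z : R, 0 <= s -> expR s <= 2 -> 0 <= z ->
  `|z * (igamma (m - 2) (expR s * z) - igamma (m - 2) z) - s * toll_fun m z| <= C * s ^+ 2 * wt z.
Proof.
have [C1 C10 h1] := toll_fun_lip.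
have [C2 C20 h2] := toll_fun_bound (R := R) m2.
exists (2 * (C1 + (C2 + C1))) => [|s z s0 s2 z0]; first by rewrite mulr_ge0 // addr_ge0 // addr_ge0.
pose J := @igamma R (m - 2).
have dk (x : R) : is_derive x 1 (fun y => J (expR y * z)) ((expR x * z) ^+ (m - 2) * expR (- (expR x * z)) * (expR x * z)).
  have hg : is_derive x 1 (fun y : R => expR y * z) (expR x * z).
    apply: is_derive_conv (is_deriveM (is_derive_expR x) (is_derive_cst z x 1)) _ _ => //.
    by rewrite scaler0 add0r /GRing.scale /= mulrC.
  exact: (@is_derive1_comp R J (fun y => expR y * z) x _ _ (is_derive_igamma (m - 2) (expR x * z)) hg).
have [c /andP[c0 cs] hc] := mvt_everywhere s0 dk.
rewrite -/J; move: hc; rewrite expR0 mul1r subr0 => ->.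
set r := expR c.
have r1 : 1 <= r by rewrite /r -expR0 ler_expR.
have r0 : 0 < r by apply: lt_le_trans r1.
have r2 : r <= 2 by apply: le_trans s2; rewrite ler_expR.
have rs : r - 1 <= 2 * s by apply: expR_sub1_le => //; rewrite c0.
have -> : z * ((r * z) ^+ (m - 2) * expR (- (r * z)) * (r * z) * s) - s * toll_fun m z =
   s * ((toll_fun m (r * z) - toll_fun m z) - (1 - r^-1) * toll_fun m (r * z)).
  have tE x : toll_fun m x = x ^+ (m - 2) * x ^+ 2 * expR (- x).
    by rewrite /toll_fun -[in LHS](subnK m2) exprD.
  by rewrite !tE; field; rewrite gt_eqF.
have hl := h1 r z; rewrite r1 r2 in hl; have {}hl := hl erefl z0.
have hT : `|toll_fun m (r * z)| <= (C2 + C1) * wt z.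
  rewrite -[toll_fun m _](subrK (toll_fun m z)) (le_trans (ler_normD _ _)) // mulrDl addrC.
  apply: lerD; first exact: h2.
  apply: (le_trans hl); rewrite ler_wpM2r ?wt_ge0 // ler_piMr // lerBlDr.
  by apply: (le_trans r2); lra.
have hi : `|1 - r^-1| <= 2 * s.
  rewrite ger0_norm ?subr_ge0 ?invf_le1 //.
  apply: le_trans rs; rewrite -[1 - r^-1]mul1r -{1}(mulVf (lt0r_neq0 r0)) -mulrA mulrBr mulr1 mulfV ?gt_eqF //.
  by rewrite ler_piMl ?subr_ge0 // invf_le1.
rewrite normrM (ger0_norm s0).
have -> : 2 * (C1 + (C2 + C1)) * s ^+ 2 * wt z = s * (C1 * (2 * s) * wt z + (2 * s) * ((C2 + C1) * wt z)) by ring.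
rewrite ler_wpM2l // (le_trans (ler_normB _ _)) //; apply: lerD.
  by apply: (le_trans hl); rewrite ler_wpM2r ?wt_ge0 // ler_wpM2l.
by rewrite normrM; apply: ler_pM.
Qed.

End TollIncrements.

(** * The quotient E z / z and its logarithmic antiderivative *)

Section RenewalFunction.
Context {R : realType}.
Variables (p : R) (m : nat).
Hypotheses (p0 : 0 < p) (p1 : p < 1) (m2 : (1 < m)%N).

Let q0 : 0 < 1 - p. Proof. by rewrite subr_gt0. Qed.
Let pq0 : 0 < p * (1 - p). Proof. by rewrite mulr_gt0. Qed.

Lemma renew_lin f (C z : R) : 0 <= C -> 0 <= z ->
  (forall x, 0 <= x <= z -> `|f x| <= C * wt x) -> `|renew p f z| <= C / (p * (1 - p)) * z.
Proof.
move=> C0 z0 h; apply: (le_trans (renew_le p0 p1 z0 (pot_bound p0 p1 C0 z0 h))).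
by rewrite ler_wpM2l ?pot_le // divr_ge0 // ltW.
Qed.

Lemma summable_sqr f (C z : R) : 0 <= C -> 0 <= z ->
  (forall x, 0 <= x <= z -> `|f x| <= C * x ^+ 2) -> summable p f z.
Proof.
by move=> C0 z0 h; apply/cvg_ex; eexists; apply: (renew_cvg p0 p1 z0 (sqr_bound p0 p1 C0 z0 h)).
Qed.

Lemma renew_ge0 f (z : R) : 0 <= z -> (forall x, 0 <= x -> 0 <= f x) -> summable p f z ->
  0 <= renew p f z.
Proof.
move=> z0 f0 s; apply: limr_ge => //; near=> N; apply: sumr_ge0 => k _.
elim: (k) z z0 {s} => [|i IH] z z0 /=; first exact: f0.
by rewrite /dil addr_ge0 // IH // mulr_ge0 // ltW.
Unshelve. all: by end_near. Qed.

Definition ratio (z : R) : R := renew p (toll_fun m) z / z.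

Lemma ratio_ge0 z : 0 < z -> 0 <= ratio z.
Proof.
move=> z0; have z0w := ltW z0; apply: divr_ge0 => //; apply: renew_ge0 => //.
  by move=> x; exact: toll_fun_ge0.
exact: toll_fun_summable.
Qed.

Lemma ratio_bound : exists C : R, forall z : R, 0 < z -> ratio z <= C * pot z / z.
Proof.
have [C C0 hC] := toll_fun_bound (R := R) m2.
exists (C / (p * (1 - p))) => z z0; rewrite ler_wpM2r ?invr_ge0 ?(ltW z0) //.
apply: (le_trans (ler_norm _)).
apply: (renew_le p0 p1 (ltW z0) (pot_bound p0 p1 C0 (ltW z0) _)).
by move=> x /andP[x0 _]; exact: hC.
Qed.

Lemma ratio_eq z : 0 < z ->
  ratio z = toll_fun m z / z + (p * ratio (p * z) + (1 - p) * ratio ((1 - p) * z)).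
Proof.
move=> z0; have [C C0 hC] := toll_fun_bound (R := R) m2.
have hb : forall x, 0 <= x <= z -> `|toll_fun m x| <= C * wt x by move=> x /andP[x0 _]; exact: hC.
rewrite /ratio (renew_eq p0 p1 (ltW z0) (pot_bound p0 p1 C0 (ltW z0) hb)).
by field; rewrite !gt_eqF.
Qed.

Lemma ratio_lip : exists2 C : R, 0 <= C & forall r z : R, 1 <= r <= 2 -> 0 < z ->
  `|ratio (r * z) - ratio z| <= C * (r - 1).
Proof.
have [C C0 hC] := toll_fun_lip (R := R) m2.
have [C1 C10 hC1] := toll_fun_bound (R := R) m2.
pose K := C / (p * (1 - p)); pose K1 := C1 / (p * (1 - p)).
have K0 : 0 <= K by rewrite divr_ge0 // ltW.
have K10 : 0 <= K1 by rewrite divr_ge0 // ltW.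
exists (K + K1) => [|r z hr z0]; first by rewrite addr_ge0.
have z0w := ltW z0; have [r1 r2] := andP hr.
have r0 : 0 < r by apply: lt_le_trans r1.
have s0 : 0 <= r - 1 by rewrite subr_ge0.
have hE : `|renew p (toll_fun m) z| <= K1 * z.
  by apply: renew_lin => // x /andP[x0 _]; exact: hC1.
have hD : `|renew p (toll_fun m) (r * z) - renew p (toll_fun m) z| <= K * (r - 1) * z.
  have -> : renew p (toll_fun m) (r * z) - renew p (toll_fun m) z =
      renew p (fun x => toll_fun m (r * x) + (-1) * toll_fun m x) z.
    have s1 : summable p (toll_fun m) z by exact: toll_fun_summable.
    have s2 : summable p (fun x => toll_fun m (r * x)) z.
      rewrite /summable (_ : (fun k => _) = (fun k => iter k (dil p) (toll_fun m) (r * z))).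
        by apply: toll_fun_summable => //; rewrite mulr_ge0 // ltW.
      by apply/funext => k; rewrite iter_dil_scale.
    by rewrite renewD ?renewZ ?renew_scale ?mulN1r //; exact: summableZ.
  have -> : K * (r - 1) = C * (r - 1) / (p * (1 - p)) by rewrite /K mulrAC.
  apply: renew_lin => //; first by rewrite mulr_ge0.
  by move=> x /andP[x0 _]; rewrite mulN1r; exact: hC.
have -> : ratio (r * z) - ratio z =
   (renew p (toll_fun m) (r * z) - renew p (toll_fun m) z) / (r * z) - (1 - r^-1) * (renew p (toll_fun m) z / z).
  by rewrite /ratio; field; rewrite !gt_eqF.
have ri : r^-1 <= 1 by rewrite invf_le1.
have ri0 : 0 <= r^-1 by rewrite invr_ge0 ltW.
have ri2 : 0 <= 1 - r^-1 <= r - 1.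
  rewrite subr_ge0 ri /= lerBlDr.
  have : 0 <= (r - 1) ^+ 2 / r by rewrite divr_ge0 ?sqr_ge0 ?ltW.
  have -> : (r - 1) ^+ 2 / r = r - 2 + r^-1 by field; rewrite gt_eqF.
  lra.
have [ri3 ri4] := andP ri2.
rewrite (le_trans (ler_normB _ _)) // [leRHS]mulrDl; apply: lerD.
  rewrite normrM (ger0_norm (x := (r * z)^-1)) ?invr_ge0 ?mulr_ge0 ?(ltW r0) //.
  rewrite ler_pdivrMr ?mulr_gt0 //; apply: (le_trans hD).
  apply: ler_wpM2l; first exact: mulr_ge0.
  by rewrite ler_peMl.
rewrite normrM (ger0_norm ri3) mulrC; apply: ler_pM => //.
by rewrite normrM (ger0_norm (x := z^-1)) ?invr_ge0 // ler_pdivrMr.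
Qed.

(* [cumul] plays the role of an antiderivative: d/ds cumul (e^s z) = ratio (e^s z). *)
Definition cumul (z : R) : R := renew p (fun x => x * igamma (m - 2) x) z / z.

Let sqr_igamma : exists2 C : R, 0 <= C & forall x : R, 0 <= x -> `|x * igamma (m - 2) x| <= C * x ^+ 2.
Proof.
have [C C0 hC] := igamma_le (R := R) (m - 2); exists C => // x x0.
by rewrite ger0_norm ?mulr_ge0 ?igamma_ge0 // expr2 mulrCA ler_wpM2l // hC.
Qed.

Let summable_igamma z : 0 <= z -> summable p (fun x => x * igamma (m - 2) x) z.
Proof.
move=> z0; have [C C0 hC] := sqr_igamma; apply: (summable_sqr C0 z0).
by move=> x /andP[x0 _]; exact: hC.
Qed.

(** An exact identity for the weighted drop of [cumul] over logarithmic windows of lengths - ln p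
    and - ln q. If [ratio] is close to c on both windows, the left side is close to c times the
    entropy, while the right side tends to (m - 2)!. *)
Lemma cumul_eq z : 0 < z ->
  p * (cumul z - cumul (p * z)) + (1 - p) * (cumul z - cumul ((1 - p) * z)) = igamma (m - 2) z.
Proof.
move=> z0; have [C C0 hC] := sqr_igamma.
have hb : forall x, 0 <= x <= z -> `|x * igamma (m - 2) x| <= C * x ^+ 2 by move=> x /andP[x0 _]; exact: hC.
rewrite /cumul (renew_eq p0 p1 (ltW z0) (sqr_bound p0 p1 C0 (ltW z0) hb)).
by field; rewrite !gt_eqF.
Qed.

Let summable_scale f r z : 0 <= z -> 0 <= r -> (forall x, 0 <= x -> summable p f x) ->
  summable p (fun x => f (r * x)) z.
Proof.
move=> z0 r0 h; rewrite /summable (_ : (fun k => _) = (fun k => iter k (dil p) f (r * z))).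
  by apply: h; rewrite mulr_ge0.
by apply/funext => k; rewrite iter_dil_scale.
Qed.

Let cumul_diff r z : 0 < z -> 0 < r -> cumul (r * z) - cumul z =
  renew p (fun x => r^-1 * ((r * x) * igamma (m - 2) (r * x)) + (-1) * (x * igamma (m - 2) x)) z / z.
Proof.
move=> z0 r0; have z0w := ltW z0; have r0w := ltW r0.
have s1 := summable_igamma z0w.
have s2 : summable p (fun x => (r * x) * igamma (m - 2) (r * x)) z.
  exact: (summable_scale (f := fun x => x * igamma (m - 2) x)).
rewrite renewD ?renewZ ?mulN1r //; [|exact: summableZ..].
rewrite (renew_scale p r (fun x => x * igamma (m - 2) x)) /cumul.
by field; rewrite !gt_eqF.
Qed.

(** Monotonicity allows a window to be compared with a whole number of small steps. *)
Lemma cumul_homo r z : 0 < z -> 1 <= r -> cumul z <= cumul (r * z).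
Proof.
move=> z0 r1; have r0 : 0 < r by apply: lt_le_trans r1.
rewrite -subr_ge0 cumul_diff // divr_ge0 ?(ltW z0) //; apply: renew_ge0; first exact: ltW.
  move=> x x0; rewrite mulN1r mulrA mulrA mulVf ?gt_eqF // mul1r -mulrBr mulr_ge0 // subr_ge0.
  by apply: igamma_homo => //; rewrite ler_peMl.
have [C C0 hC] := sqr_igamma.
have s2 : summable p (fun x => (r * x) * igamma (m - 2) (r * x)) z.
  by apply: (summable_scale (f := fun x => x * igamma (m - 2) x)); rewrite ?ltW.
have h1 := summableZ (c := r^-1) s2; have h2 := summableZ (c := -1) (summable_igamma (ltW z0)).
move: h1 h2; rewrite /summable => h1 h2.
rewrite (_ : (fun k => _) = (fun k => iter k (dil p) (fun x => r^-1 * (r * x * igamma (m - 2) (r * x))) z) +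
   (fun k => iter k (dil p) (fun x => (-1) * (x * igamma (m - 2) x)) z)).
  by rewrite seriesD; exact: is_cvgD.
by apply/funext => k; exact: iter_dilD.
Qed.

Lemma cumul_increment : exists2 C : R, 0 <= C & forall s z : R, 0 <= s -> expR s <= 2 -> 0 < z ->
  `|cumul (expR s * z) - cumul z - s * ratio z| <= C * s ^+ 2.
Proof.
have [C C0 hC] := igamma_increment (R := R) m2.
exists (C / (p * (1 - p))) => [|s z s0 s2 z0]; first by rewrite divr_ge0 // ltW.
have z0w := ltW z0; have r0 := expR_gt0 s.
rewrite cumul_diff // /ratio.
set f := fun x : R => _.
have sf : summable p f z.
  have s2' : summable p (fun x => (expR s * x) * igamma (m - 2) (expR s * x)) z.
    by apply: (summable_scale (f := fun x => x * igamma (m - 2) x)); rewrite ?ltW.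
  have h1 := summableZ (c := (expR s)^-1) s2'; have h2 := summableZ (c := -1) (summable_igamma z0w).
  move: h1 h2; rewrite /summable => h1 h2.
  rewrite (_ : (fun k => _) = (fun k => iter k (dil p) (fun x => (expR s)^-1 * (expR s * x * igamma (m - 2) (expR s * x))) z) +
     (fun k => iter k (dil p) (fun x => (-1) * (x * igamma (m - 2) x)) z)).
    by rewrite seriesD; exact: is_cvgD.
  by apply/funext => k; exact: iter_dilD.
have -> : renew p f z / z - s * (renew p (toll_fun m) z / z) =
   renew p (fun x => f x + (- s) * toll_fun m x) z / z.
  have st : summable p (toll_fun m) z by exact: toll_fun_summable.
  rewrite (renewD sf (summableZ (c := - s) st)) (renewZ _ st).
  by field; rewrite gt_eqF.
rewrite normrM (ger0_norm (x := z^-1)) ?invr_ge0 // ler_pdivrMr //.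
have -> : C / (p * (1 - p)) * s ^+ 2 * z = (C * s ^+ 2) / (p * (1 - p)) * z by ring.
apply: renew_lin => //; first by rewrite mulr_ge0 ?sqr_ge0.
move=> x /andP[x0 _]; rewrite /f.
have -> : (expR s)^-1 * (expR s * x * igamma (m - 2) (expR s * x)) + -1 * (x * igamma (m - 2) x) + - s * toll_fun m x
  = x * (igamma (m - 2) (expR s * x) - igamma (m - 2) x) - s * toll_fun m x.
  by field; rewrite gt_eqF.
exact: hC.
Qed.

End RenewalFunction.

(** * The limit of the mean *)

Section Sticky.
Context {R : realType}.
Variable p : R.
Hypotheses (p0 : 0 < p) (p1 : p < 1).
Variable D : R -> R.
Variable B : R.
Hypothesis Dbound : forall z, 1 <= z -> `|D z| <= B.
Hypothesis Drec : forall e : R, 0 < e -> exists X : R, forall z, X <= z ->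
  D z <= e + (p * D (p * z) + (1 - p) * D ((1 - p) * z)).

Let q0 : 0 < 1 - p. Proof. by rewrite subr_gt0. Qed.

Let frequently (c : R) := forall X : R, exists2 z, X <= z & c <= D z.

(** The limit superior of [D] at infinity, as the supremum of the levels reached arbitrarily far
    out. *)
Let M := sup [set c | frequently c].

Let freqNB : frequently (- B).
Proof.
move=> X; exists (Num.max X 1); rewrite ?le_max ?lexx //.
have := Dbound (z := Num.max X 1); rewrite le_max lexx orbT => /(_ isT).
by rewrite ler_norml => /andP[].
Qed.

Let has_supM : has_sup [set c | frequently c].
Proof.
split; first by exists (- B); exact: freqNB.
exists B => c /(_ 1) [z z1 h]; apply: (le_trans h); apply: le_trans (Dbound z1).
exact: ler_norm.
Qed.

Lemma limsup_upper (e : R) : 0 < e -> exists X : R, forall z, X <= z -> D z <= M + e.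
Proof.
move=> e0; apply: contrapT => h.
have : frequently (M + e).
  move=> X; apply: contrapT => h2; apply: h; exists X => z Xz.
  by rewrite leNgt; apply/negP => h3; apply: h2; exists z => //; exact: ltW.
move=> hf; have := sup_upper_bound has_supM hf.
by rewrite -/M gerDl leNgt e0.
Qed.

Lemma limsup_freq (e : R) : 0 < e -> frequently (M - e).
Proof.
move=> e0; have [c hc cM] := sup_adherent e0 has_supM.
by move=> X; have [z Xz h] := hc X; exists z => //; apply: le_trans h; exact: ltW.
Qed.

Let sticky_step (e : R) : 0 < e -> exists2 de : R, 0 < de & exists X : R, forall z, X <= z ->
  M - de <= D z -> M - e <= D (p * z) /\ M - e <= D ((1 - p) * z).
Proof.
move=> e0; pose de := e * (p * (1 - p)) / 3.
have pq0 : 0 < p * (1 - p) by rewrite mulr_gt0.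
have de0 : 0 < de by rewrite divr_gt0 // mulr_gt0.
exists de => //.
have [X1 h1] := limsup_upper de0; have [X2 h2] := Drec de0.
exists (Num.max X2 (Num.max 0 (Num.max (X1 / p) (X1 / (1 - p))))) => z.
rewrite !ge_max => /and4P[z2 z0 z3 z4] hz.
have hp : D (p * z) <= M + de by apply: h1; rewrite mulrC -ler_pdivrMr.
have hq : D ((1 - p) * z) <= M + de by apply: h1; rewrite mulrC -ler_pdivrMr.
have hr := h2 z z2.
have E : 3 * de = e * (p * (1 - p)) by rewrite /de mulrC divfK.
have hp' := ler_wpM2l (ltW p0) hp; have hq' := ler_wpM2l (ltW q0) hq.
have ep : e * (p * (1 - p)) <= e * p.
  by rewrite ler_wpM2l ?ltW // gtr_pMr // gtrBl.
have eq' : e * (p * (1 - p)) <= e * (1 - p).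
  by rewrite ler_wpM2l ?ltW // gtr_pMl.
have qde : (1 - p) * de <= de by rewrite ler_piMl ?ltW // gtrBl.
have pde : p * de <= de by rewrite ler_piMl ?ltW.
split.
  rewrite -(ler_pM2l p0); nra.
rewrite -(ler_pM2l q0); nra.
Qed.

Let sticky_iter i j (e : R) : 0 < e -> exists2 de : R, 0 < de & exists X : R, forall z, X <= z ->
  M - de <= D z -> M - e <= D (p ^+ i * (1 - p) ^+ j * z).
Proof.
elim: i j e => [|i IHi] j e e0.
  elim: j e e0 => [|j IHj] e e0.
    by exists e => //; exists 0 => z _; rewrite !expr0 !mul1r.
  have [e1 e10 [X1 h1]] := IHj e e0; have [e2 e20 [X2 h2]] := sticky_step e10.
  exists e2 => //; exists (Num.max X2 (X1 / (1 - p))) => z; rewrite ge_max => /andP[z2 z1] hz.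
  rewrite exprSr !mulrA -mulrA; apply: h1; first by rewrite mulrC -ler_pdivrMr.
  exact: (h2 z z2 hz).2.
have [e1 e10 [X1 h1]] := IHi j e e0; have [e2 e20 [X2 h2]] := sticky_step e10.
exists e2 => //; exists (Num.max X2 (X1 / p)) => z; rewrite ge_max => /andP[z2 z1] hz.
have -> : p ^+ i.+1 * (1 - p) ^+ j * z = p ^+ i * (1 - p) ^+ j * (p * z) by rewrite exprS; ring.
apply: h1; first by rewrite mulrC -ler_pdivrMr.
exact: (h2 z z2 hz).1.
Qed.

Let sticky_finite (i j : nat -> nat) N (e : R) : 0 < e -> exists2 de : R, 0 < de & exists X : R,
  forall z, X <= z -> M - de <= D z ->
  forall k, (k <= N)%N -> M - e <= D (p ^+ i k * (1 - p) ^+ j k * z).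
Proof.
move=> e0; elim: N => [|N [de de0 [X h]]].
  have [de de0 [X h]] := sticky_iter (i 0%N) (j 0%N) e0.
  by exists de => //; exists X => z Xz hz k; rewrite leqn0 => /eqP ->; exact: h.
have [de' de'0 [X' h']] := sticky_iter (i N.+1) (j N.+1) e0.
exists (Num.min de de'); first by rewrite lt_min de0.
exists (Num.max X X') => z; rewrite ge_max => /andP[zX zX'] hz k.
have hz1 : M - de <= D z by apply: le_trans hz; rewrite lerB // ge_min lexx.
have hz2 : M - de' <= D z by apply: le_trans hz; rewrite lerB // ge_min lexx orbT.
by rewrite leq_eqVlt => /orP[/eqP ->|]; [exact: h'|rewrite ltnS; exact: h].
Qed.

(** Near-maximality propagates only to smaller arguments, through factors p and q. The points p^(k
    u) q^((N - k) v) z0 are all reachable, and they form a progression of ratio p^u / q^v that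
    starts at q^(N v) z0; this ratio may be arbitrarily close to 1. *)
Lemma sticky : exists M : R,
  (forall e : R, 0 < e -> exists X : R, forall z, X <= z -> D z <= M + e) /\
  (forall (u v N : nat) (e X : R), 0 < e -> exists2 z, X <= z &
     forall k, (k <= N)%N -> M - e <= D ((p ^+ u / (1 - p) ^+ v) ^+ k * z)).
Proof.
exists M; split; first exact: limsup_upper.
move=> u v N e X e0.
have [de de0 [X1 h]] := sticky_finite (fun k => (k * u)%N) (fun k => ((N - k) * v)%N) N e0.
have c0 : 0 < (1 - p) ^+ (N * v) by rewrite exprn_gt0.
have [z hz1 hz2] := limsup_freq de0 (Num.max X1 (X / (1 - p) ^+ (N * v))).
rewrite ge_max in hz1; have [z1 zX] := andP hz1.
exists ((1 - p) ^+ (N * v) * z); first by rewrite mulrC -ler_pdivrMr.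
move=> k kN; have := h z z1 hz2 k kN.
have -> // : p ^+ (k * u) * (1 - p) ^+ ((N - k) * v) * z =
   (p ^+ u / (1 - p) ^+ v) ^+ k * ((1 - p) ^+ (N * v) * z).
rewrite expr_div_n -!exprM mulrA; congr (_ * _).
have -> : (N * v = (N - k) * v + v * k)%N by rewrite (mulnC v k) -mulnDl subnK.
rewrite exprD (mulnC k u) mulrA -[RHS]mulrA; field.
by rewrite expf_neq0 // gt_eqF.
Qed.

End Sticky.

(** * Small combinations of incommensurable numbers *)

Section Incommensurable.
Context {R : realType}.
Variables la mu : R.
Hypotheses (la0 : 0 < la) (mu0 : 0 < mu).
Hypothesis incomm : forall k l : int, k%:~R * la = l%:~R * mu -> k = 0.

Let S : set R := [set x | 0 < x /\ exists u v : int, x = u%:~R * la + v%:~R * mu].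

Let S_sub x y : S x -> S y -> y < x -> S (x - y).
Proof.
move=> [x0 [u [v E]]] [y0 [u' [v' E']]] yx; split; first by rewrite subr_gt0.
by exists (u - u'), (v - v'); rewrite E E' !rmorphB /=; ring.
Qed.

Let S_la : S la. Proof. by split => //; exists 1, 0; rewrite mul1r mul0r addr0. Qed.

Let S_mu : S mu. Proof. by split => //; exists 0, 1; rewrite mul1r mul0r add0r. Qed.

Let S_mod x y : S x -> S y -> x - (Num.floor (x / y))%:~R * y = 0 \/ S (x - (Num.floor (x / y))%:~R * y).
Proof.
move=> [x0 [u [v E]]] [y0 [u' [v' E']]].
have : 0 <= x - (Num.floor (x / y))%:~R * y.
  by rewrite subr_ge0 -ler_pdivlMr // ge_floor.
rewrite le_eqVlt => /orP[/eqP <-|h]; [by left|right; split => //].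
exists (u - Num.floor (x / y) * u'), (v - Num.floor (x / y) * v').
by rewrite {1}E {2}E' !rmorphB !rmorphM /=; ring.
Qed.

(** If the positive elements of the group generated by [la] and [mu] stayed away from 0, the least
    of them would divide both [la] and [mu]. *)
Lemma small_comb (de : R) : 0 < de -> exists2 x, S x & x < de.
Proof.
move=> de0; apply: contrapT => h.
have Sde x : S x -> de <= x by move=> Sx; rewrite leNgt; apply/negP => xd; apply: h; exists x.
have hinf : has_inf S by split; [exists la; exact: S_la|exists de => x /Sde].
pose g := inf S.
have gle x : S x -> g <= x by move=> Sx; apply: ge_inf => //; case: hinf.
have g0 : 0 < g.
  apply: (lt_le_trans de0); apply: lb_le_inf; first by exists la; exact: S_la.
  by move=> x /Sde.
have Sg : S g.
  (* [x] lies in [g, 2g). If it is not [g], some [y] in [S] lies below it, and [x - y] would be a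
     smaller element of [S]. *)
  have [x Sx xg] := inf_adherent g0 hinf.
  case: (eqVneq x g) => [<- //|xNg].
  have gx : g < x by rewrite lt_neqAle eq_sym xNg gle.
  have xg0 : 0 < x - g by rewrite subr_gt0.
  have [y Sy yg] := inf_adherent xg0 hinf.
  have yx : y < x by move: yg; rewrite -/g addrC subrK.
  have := gle _ (S_sub Sx Sy yx); have := gle _ Sy; move: xg; rewrite -/g; lra.
have key x : S x -> exists k : int, x = k%:~R * g.
  move=> Sx; exists (Num.floor (x / g)); case: (S_mod Sx Sg) => [/eqP|/gle].
    by rewrite subr_eq0 => /eqP.
  have := floorD1_gt (x / g); rewrite ltr_pdivrMr // intrD mulrDl mul1r; lra.
have [k hk] := key _ S_la; have [l hl] := key _ S_mu.
have E : l%:~R * la = k%:~R * mu by rewrite hk hl; ring.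
move: (incomm E) hl => -> hl; by move: mu0; rewrite hl mul0r ltxx.
Qed.

Lemma small_nat_comb (de : R) : 0 < de -> exists u v : nat, 0 < u%:R * la - v%:R * mu <= de.
Proof.
move=> de0.
(* Staying below [la] and [mu] excludes combinations with two nonnegative coefficients. *)
have dm0 : 0 < Num.min de (Num.min la mu) by rewrite !lt_min de0 la0.
have [x [x0 [u [v E]]] xd] := small_comb dm0.
move: xd; rewrite !lt_min => /and3P[xd xla xmu].
case: u v E => [a|a] [b|b] E.
- exfalso; case: a E => [|a] E.
    case: b E => [|b] E; first by move: x0; rewrite E /= !mul0r addr0 ltxx.
    move: xmu; rewrite ltNge E /= mul0r add0r => /negP; apply.
    by rewrite ler_peMl ?(ltW la0) ?(ltW mu0) // -pmulrn ler1n.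
  move: xla; rewrite ltNge E => /negP; apply.
  have : la <= a.+1%:~R * la by rewrite ler_peMl ?(ltW la0) ?(ltW mu0) // -pmulrn ler1n.
  have : 0 <= b%:~R * mu by rewrite mulr_ge0 ?(ltW mu0) // -pmulrn ler0n.
  lra.
- exists a, b.+1; move: E; rewrite NegzE rmorphN /= mulNr => <-.
  by rewrite x0 ltW.
(* The signs are the wrong way round: the remainder of [la] modulo [x] has the right ones. It is at
   most [x], and nonzero by incommensurability. *)
- pose k := Num.truncn (la / x).
  have hk : k%:R * x <= la < k.+1%:R * x.
    have lx0 : 0 <= la / x by rewrite divr_ge0 ?ltW.
    by have := truncn_itv lx0; rewrite ler_pdivlMr // ltr_pdivrMr.
  exists (1 + k * a.+1)%N, (k * b)%N.
  have -> : (1 + k * a.+1)%:R * la - (k * b)%:R * mu = la - k%:R * x.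
    by rewrite E NegzE rmorphN /= natrD !natrM; ring.
  have [h1 h2] := andP hk; apply/andP; split; last first.
    by move: h2; rewrite -natr1 mulrDl mul1r; lra.
  rewrite lt_neqAle subr_ge0 h1 andbT eq_sym subr_eq0; apply/negP => /eqP E2.
  suff : (1 + k%:Z * a.+1%:Z = 0 :> int) by lia.
  apply: (@incomm _ (k%:Z * b%:Z)); rewrite rmorphD !rmorphM /=.
  move: E2; rewrite E NegzE rmorphN /= => E2; rewrite mulrDl mul1r {1}E2; ring.
- exfalso; move: x0; rewrite E !NegzE !rmorphN /= !mulNr ltNge -opprD oppr_le0 => /negP; apply.
  by rewrite addr_ge0 // mulr_ge0 ?(ltW la0) ?(ltW mu0) // -pmulrn ler0n.
Qed.

End Incommensurable.

Section LogarithmicScale.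
Context {R : realType}.
Variables (p : R) (m : nat).
Hypotheses (p0 : 0 < p) (p1 : p < 1) (m2 : (1 < m)%N).

Let q0 : 0 < 1 - p. Proof. by rewrite subr_gt0. Qed.
Let la := - ln p.
Let mu := - ln (1 - p).
Let la0 : 0 < la. Proof. by rewrite oppr_gt0 ln_lt0 // p0. Qed.
Let mu0 : 0 < mu. Proof. by rewrite oppr_gt0 ln_lt0 // q0 gtrBl. Qed.

Lemma entropyE : entropy p = p * la + (1 - p) * mu.
Proof. by rewrite /entropy /la /mu; ring. Qed.

Lemma entropy_gt0 : 0 < entropy p.
Proof. by rewrite entropyE addr_gt0 // mulr_gt0. Qed.

Lemma aperiodic_small (de : R) : aperiodic p -> 0 < de ->
  exists u v : nat, exists2 s : R, 0 < s <= de & p ^+ u / (1 - p) ^+ v = expR (- s).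
Proof.
move=> ap de0.
have inc (k l : int) : k%:~R * la = l%:~R * mu -> k = 0.
  move=> E; apply/eqP/negPn/negP => k0.
  have l0 : ln (1 - p) != 0 by rewrite -oppr_eq0 gt_eqF.
  have k0' : k%:~R != 0 :> R by rewrite intr_eq0.
  apply: (ap (l%:Q / k%:Q)); rewrite fmorph_div /= !ratr_int /log_ratio.
  have E' : k%:~R * ln p = l%:~R * ln (1 - p) by move: E; rewrite /la /mu !mulrN => /oppr_inj.
  by apply: (mulfI k0'); rewrite mulrA E'; field; rewrite k0' l0.
have [u [v h]] := small_nat_comb la0 mu0 inc de0.
exists u, v, (u%:R * la - v%:R * mu) => //.
have -> : - (u%:R * la - v%:R * mu) = u%:R * ln p + - (v%:R * ln (1 - p)) by rewrite /la /mu; ring.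
by rewrite expRD expRN !expRM_natl !lnK ?posrE.
Qed.

End LogarithmicScale.

Lemma le_small_error (R : realType) (x y K d : R) : 0 < d ->
  (forall e, 0 < e -> e <= d -> x <= y + K * e) -> x <= y.
Proof.
move=> d0 h; rewrite leNgt; apply/negP => yx.
pose e := Num.min d ((x - y) / (2 * (`|K| + 1))).
have K1 : 0 < `|K| + 1 by rewrite ltr_wpDl.
have e0 : 0 < e by rewrite lt_min d0 divr_gt0 ?subr_gt0 // mulr_gt0.
have := h e e0; rewrite ge_min lexx => /(_ isT).
have : K * e <= (`|K| + 1) * e.
  by rewrite ler_wpM2r ?(ltW e0) // (le_trans (ler_norm _)) // lerDl.
have : (`|K| + 1) * e <= (x - y) / 2.
  have : e <= (x - y) / (2 * (`|K| + 1)) by rewrite ge_min lexx orbT.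
  move=> /(ler_wpM2l (ltW K1)) /le_trans; apply.
  by rewrite le_eqVlt; apply/orP; left; apply/eqP; field; rewrite gt_eqF.
move: yx; lra.
Qed.

(** * The limit for an irrational ratio of logarithms *)

Section AperiodicLimit.
Context {R : realType}.
Variables (p : R) (m : nat).
Hypotheses (p0 : 0 < p) (p1 : p < 1) (m2 : (1 < m)%N).

Let q0 : 0 < 1 - p. Proof. by rewrite subr_gt0. Qed.

Lemma ratio_bounded : exists2 B : R, 0 <= B & forall z, 0 < z -> `|ratio p m z| <= B.
Proof.
have [C hC] := ratio_bound p0 p1 m2.
exists `|C| => // z z0; rewrite ger0_norm ?ratio_ge0 //; apply: (le_trans (hC z z0)).
rewrite ler_pdivrMr //; apply: (@le_trans _ _ (`|C| * pot z)).
  by rewrite ler_wpM2r ?pot_ge0 ?(ltW z0) // ler_norm.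
by rewrite ler_wpM2l // pot_le // ltW.
Qed.

Lemma ratio_rec_error (e : R) : 0 < e -> exists X : R, forall z, X <= z ->
  `|ratio p m z - (p * ratio p m (p * z) + (1 - p) * ratio p m ((1 - p) * z))| <= e.
Proof.
move=> e0; have [C C0 hC] := toll_fun_bound (R := R) m2.
exists (Num.max 1 (C / e)) => z; rewrite ge_max => /andP[z1 zC].
have z0 : 0 < z by apply: lt_le_trans z1.
rewrite (ratio_eq p0 p1 m2 z0) addrK normrM (ger0_norm (x := z^-1)) ?invr_ge0 ?(ltW z0) //.
rewrite ler_pdivrMr //; apply: (le_trans (hC z (ltW z0))).
apply: (@le_trans _ _ (C * 1)); last by rewrite mulr1 mulrC -ler_pdivrMr.
rewrite ler_wpM2l // /wt ler_pdivrMr ?exprn_gt0 ?addr_gt0 // mul1r.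
by rewrite lerXn2r ?nnegrE ?addr_ge0 ?(ltW z0) // lerDr.
Qed.

Let Y := cumul p m.
Let rt := ratio p m.

Let cumul_step : exists2 C : R, 0 <= C & forall s z, 0 <= s -> expR s <= 2 -> 0 < z ->
  `|Y z - Y (expR (- s) * z) - s * rt (expR (- s) * z)| <= C * s ^+ 2.
Proof.
have [C C0 hC] := cumul_increment p0 p1 m2; exists C => // s z s0 s2 z0.
have := hC s (expR (- s) * z) s0 s2; rewrite mulrA -expRD subrr expR0 mul1r.
by apply; rewrite mulr_gt0 // expR_gt0.
Qed.

Let window_lower : exists2 C : R, 0 <= C & forall s z c n, 0 <= s -> expR s <= 2 -> 0 < z ->
  (forall k, (k <= n)%N -> c <= rt (expR (- s) ^+ k * z)) ->
  n%:R * (s * c - C * s ^+ 2) <= Y z - Y (expR (- s) ^+ n * z).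
Proof.
have [C C0 hC] := cumul_step; exists C => // s z c n s0 s2 z0.
elim: n => [|n IH] h; first by rewrite mul0r expr0 mul1r subrr.
have {}IH := IH (fun k kn => h k (leqW kn)).
have h1 := h n.+1 (leqnn _).
have z1 : 0 < expR (- s) ^+ n * z by rewrite mulr_gt0 // exprn_gt0 // expR_gt0.
have := hC s _ s0 s2 z1; rewrite mulrA -exprS ler_norml => /andP[h2 _].
have := ler_wpM2l s0 h1; rewrite -natr1; lra.
Qed.

Let window_upper : exists2 C : R, 0 <= C & forall s z c n, 0 <= s -> expR s <= 2 -> 0 < z ->
  (forall k, (k <= n)%N -> rt (expR (- s) ^+ k * z) <= c) ->
  Y z - Y (expR (- s) ^+ n * z) <= n%:R * (s * c + C * s ^+ 2).
Proof.
have [C C0 hC] := cumul_step; exists C => // s z c n s0 s2 z0.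
elim: n => [|n IH] h; first by rewrite mul0r expr0 mul1r subrr.
have {}IH := IH (fun k kn => h k (leqW kn)).
have h1 := h n.+1 (leqnn _).
have z1 : 0 < expR (- s) ^+ n * z by rewrite mulr_gt0 // exprn_gt0 // expR_gt0.
have := hC s _ s0 s2 z1; rewrite mulrA -exprS ler_norml => /andP[_ h2].
have := ler_wpM2l s0 h1; rewrite -natr1; lra.
Qed.

Let cumul_mono x y : 0 < x -> x <= y -> Y x <= Y y.
Proof.
move=> x0 xy; have -> : y = (y / x) * x by rewrite divfK // gt_eqF.
by apply: cumul_homo => //; rewrite ler_pdivlMr // mul1r.
Qed.

Let steps (x s : R) := Num.truncn (- ln x / s).

Let stepsP x s : 0 < x -> x < 1 -> 0 < s ->
  (steps x s)%:R * s <= - ln x < (steps x s).+1%:R * s.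
Proof.
move=> x0 x1 s0; have h : 0 <= - ln x / s by rewrite divr_ge0 ?(ltW s0) // oppr_ge0 ln_le0 // ltW.
by have := truncn_itv h; rewrite ler_pdivlMr // ltr_pdivrMr.
Qed.

(** The logarithmic window of length - ln x is cut into steps of length [s]; the incomplete last
    step costs at most [s * B]. *)
Let drop_lower : exists2 C : R, 0 <= C & forall x s z c B, 0 < x -> x < 1 ->
  0 < s -> expR s <= 2 -> 0 < z -> 0 <= B -> c <= B ->
  (forall k, (k <= steps x s)%N -> c <= rt (expR (- s) ^+ k * z)) ->
  - ln x * (c - C * s) - s * B <= Y z - Y (x * z).
Proof.
have [C C0 hC] := window_lower; exists C => // x s z c B x0 x1 s0 s2 z0 B0 cB h.
have [n1 n2] := andP (stepsP x0 x1 s0).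
have xz0 : 0 < x * z by rewrite mulr_gt0.
have l0 : 0 <= - ln x by rewrite oppr_ge0 ln_le0 // ltW.
(* With a negative bracket the number of steps could not be replaced by its lower bound; then
   monotonicity of [cumul] already suffices. *)
case: (leP 0 (c - C * s)) => hk; last first.
  have hd : 0 <= Y z - Y (x * z) by rewrite subr_ge0 cumul_mono // ler_piMl ?ltW.
  apply: le_trans hd; rewrite subr_le0.
  apply: (@le_trans _ _ 0); last by rewrite mulr_ge0 // ltW.
  by rewrite mulr_ge0_le0 // ltW.
have := hC s z c _ (ltW s0) s2 z0 h.
have : Y (x * z) <= Y (expR (- s) ^+ steps x s * z).
  apply: cumul_mono => //; rewrite ler_pM2r //.
  by rewrite -expRM_natl -{1}(lnK (x := x)) ?posrE // ler_expR mulrN lerNr.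
have E : (steps x s)%:R * (s * c - C * s ^+ 2) = ((steps x s)%:R * s) * (c - C * s) by ring.
rewrite E; have : (- ln x - s) * (c - C * s) <= ((steps x s)%:R * s) * (c - C * s).
  by rewrite ler_wpM2r //; move: n2; rewrite -natr1 mulrDl mul1r; lra.
have : s * (c - C * s) <= s * B.
  by rewrite ler_wpM2l ?(ltW s0) // (le_trans _ cB) // gerBl mulr_ge0 // ltW.
lra.
Qed.

Let drop_upper : exists2 C : R, 0 <= C & forall x s z c, 0 < x -> x < 1 ->
  0 < s -> expR s <= 2 -> 0 < z -> 0 <= c ->
  (forall k, (k <= (steps x s).+1)%N -> rt (expR (- s) ^+ k * z) <= c) ->
  Y z - Y (x * z) <= (- ln x + s) * (c + C * s).
Proof.
have [C C0 hC] := window_upper; exists C => // x s z c x0 x1 s0 s2 z0 c0 h.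
have [n1 n2] := andP (stepsP x0 x1 s0).
have xz0 : 0 < x * z by rewrite mulr_gt0.
have := hC s z c _ (ltW s0) s2 z0 h.
have : Y (expR (- s) ^+ (steps x s).+1 * z) <= Y (x * z).
  apply: cumul_mono; first by rewrite mulr_gt0 // exprn_gt0 // expR_gt0.
  rewrite ler_pM2r // -expRM_natl -[leRHS](lnK (x := x)) ?posrE // ler_expR mulrN lerNl.
  exact: ltW.
have E : (steps x s).+1%:R * (s * c + C * s ^+ 2) = ((steps x s).+1%:R * s) * (c + C * s) by ring.
rewrite E; have : ((steps x s).+1%:R * s) * (c + C * s) <= (- ln x + s) * (c + C * s).
  rewrite ler_wpM2r ?addr_ge0 ?mulr_ge0 ?(ltW s0) //.
  by rewrite -natr1 mulrDl mul1r; lra.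
lra.
Qed.

Let igamma_near (e : R) : 0 < e -> exists X : R, forall z, X <= z ->
  `|igamma (m - 2) z - (m - 2)`!%:R| <= e.
Proof.
move=> e0; have := @igamma_cvg R (m - 2) => /cvgr_distC_le /(_ e e0).
case=> A [_ hA]; exists (A + 1) => z Az; apply: hA.
by apply: lt_le_trans Az; rewrite ltrDl.
Qed.

Hypothesis ap : aperiodic p.

Let la := - ln p.
Let mu := - ln (1 - p).

Let p1' : 1 - p < 1. Proof. by rewrite gtrBl. Qed.

Let aperiodic_step (e : R) : 0 < e -> exists u v : nat, exists s : R,
  [/\ 0 < s, s <= e, expR s <= 2 & p ^+ u / (1 - p) ^+ v = expR (- s)].
Proof.
move=> e0; have l2 : 0 < ln (2 : R) by rewrite ln_gt0 // ltr1n.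
have me : 0 < Num.min e (ln 2) by rewrite lt_min e0.
have [u [v [s /andP[s0 sm] E]]] := aperiodic_small p0 p1 ap me.
exists u, v, s; move: sm; rewrite le_min => /andP[h1 h2]; split => //.
by rewrite -[leRHS](lnK (x := 2)) ?posrE // ler_expR.
Qed.

Let H := entropy p.
Let L : R := (m - 2)`!%:R.
Let HE : H = p * la + (1 - p) * mu. Proof. exact: entropyE. Qed.
Let H0 : 0 < H. Proof. exact: entropy_gt0. Qed.

Lemma ratio_aperiodic (e : R) : 0 < e -> exists X : R, forall z, X <= z ->
  `|rt z - L / H| <= e.
Proof.
move=> e0; have [B B0 hB] := ratio_bounded.
have Hn0 : H != 0 by rewrite gt_eqF.
have upper : exists X : R, forall z, X <= z -> rt z <= L / H + e.
  have hb z : 1 <= z -> `|rt z| <= B by move=> z1; apply: hB; apply: lt_le_trans z1.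
  have hr d : 0 < d -> exists X : R, forall z, X <= z ->
      rt z <= d + (p * rt (p * z) + (1 - p) * rt ((1 - p) * z)).
    move=> /ratio_rec_error [X hX]; exists X => z Xz.
    by have := hX z Xz; rewrite ler_norml => /andP[_]; rewrite lerBlDr.
  have [M [hM hS]] := sticky p0 p1 hb hr.
  have MB : M <= B.
    apply/ler_addgt0Pr => d d0; have [z z1 h] := hS 0%N 0%N 0%N d 1 d0.
    have := h 0%N (leqnn _); rewrite [X in rt (X * _)]expr0 mul1r.
    have := hB z (lt_le_trans ltr01 z1); rewrite ler_norml /rt => /andP[_]; lra.
  (* The points where [ratio] stays above [M - d] form a mesh of step [s] that reaches across both
     windows below z, so [cumul_eq] compares [H * M] with the limit of [igamma]. *)
  suff hML : H * M <= L.
    have [X hX] := hM e e0; exists X => z Xz; apply: (le_trans (hX z Xz)).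
    by rewrite lerD2r ler_pdivlMr // mulrC.
  have [C C0 hC] := drop_lower.
  apply: (@le_small_error _ _ _ (1 + H + H * C + B) 1 ltr01) => d d0 _.
  have [u [v [s [s0 sd s2 Ew]]]] := aperiodic_step d0.
  have [X1 hX1] := igamma_near d0.
  have [z zX h] := hS u v (maxn (steps p s) (steps (1 - p) s)) d (Num.max 1 X1) d0.
  move: zX; rewrite ge_max => /andP[z1 zX1]; have z0 : 0 < z by apply: lt_le_trans z1.
  rewrite Ew in h.
  have cB : M - d <= B by lra.
  have h1 := hC p s z (M - d) B p0 p1 s0 s2 z0 B0 cB (fun k hk => h k (leq_trans hk (leq_maxl _ _))).
  have h2 := hC (1 - p) s z (M - d) B q0 p1' s0 s2 z0 B0 cB (fun k hk => h k (leq_trans hk (leq_maxr _ _))).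
  have hI := hX1 z zX1; rewrite -(cumul_eq m p0 p1 z0) ler_norml in hI; have [_ hI2] := andP hI.
  have g1 := ler_wpM2l (ltW p0) h1; have g2 := ler_wpM2l (ltW q0) h2.
  have E : p * (- ln p * (M - d - C * s) - s * B) + (1 - p) * (- ln (1 - p) * (M - d - C * s) - s * B)
    = H * (M - d - C * s) - s * B by rewrite HE /la /mu; ring.
  have HC : H * (C * s) <= H * (C * d) by rewrite !ler_wpM2l // ltW.
  have sB : s * B <= d * B by rewrite ler_wpM2r.
  rewrite /Y -/L in g1 g2 hI2 *; lra.
(* The same for the negative of [ratio], so that [- M] is the limit inferior of [ratio]. Now the
   mesh must go one step beyond each window. *)
have lower : exists X : R, forall z, X <= z -> - rt z <= - (L / H) + e.
  have hb z : 1 <= z -> `|- rt z| <= B by move=> z1; rewrite normrN; apply: hB; apply: lt_le_trans z1.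
  have hr d : 0 < d -> exists X : R, forall z, X <= z ->
      - rt z <= d + (p * - rt (p * z) + (1 - p) * - rt ((1 - p) * z)).
    move=> /ratio_rec_error [X hX]; exists X => z Xz.
    by have := hX z Xz; rewrite ler_norml => /andP[+ _]; rewrite /rt; lra.
  have [M [hM hS]] := sticky p0 p1 hb hr.
  have MB : - M <= B.
    have [X hX] := hM 1 ltr01.
    apply/ler_addgt0Pr => d d0; have [z z1 h] := hS 0%N 0%N 0%N d 1 d0.
    have [Y0 hY0] := hM d d0.
    have m0 : 0 < Num.max Y0 1 by rewrite lt_max ltr01 orbT.
    have := hY0 (Num.max Y0 1); rewrite le_max lexx => /(_ isT).
    have := hB _ m0; rewrite ler_norml /rt => /andP[_]; lra.
  suff hML : L <= H * (- M).
    have [X hX] := hM e e0; exists X => z Xz; apply: (le_trans (hX z Xz)).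
    by rewrite lerD2r lerNr ler_pdivrMr // mulrC.
  have [C C0 hC] := drop_upper.
  apply: (@le_small_error _ _ _ (1 + H + H * C + (1 + C + B)) 1 ltr01) => d d0 d1.
  have [u [v [s [s0 sd s2 Ew]]]] := aperiodic_step d0.
  have [X1 hX1] := igamma_near d0.
  have [z zX h] := hS u v (maxn (steps p s).+1 (steps (1 - p) s).+1) d (Num.max 1 X1) d0.
  move: zX; rewrite ge_max => /andP[z1 zX1]; have z0 : 0 < z by apply: lt_le_trans z1.
  rewrite Ew in h.
  have h' k : (k <= maxn (steps p s).+1 (steps (1 - p) s).+1)%N -> rt (expR (- s) ^+ k * z) <= d - M.
    by move=> /h; lra.
  have c0 : 0 <= d - M.
    apply: le_trans (h' 0%N (leq0n _)); rewrite expr0 mul1r.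
    by apply: ratio_ge0.
  have h1 := hC p s z (d - M) p0 p1 s0 s2 z0 c0 (fun k hk => h' k (leq_trans hk (leq_maxl _ _))).
  have h2 := hC (1 - p) s z (d - M) q0 p1' s0 s2 z0 c0 (fun k hk => h' k (leq_trans hk (leq_maxr _ _))).
  have hI := hX1 z zX1; rewrite -(cumul_eq m p0 p1 z0) ler_norml in hI; have [hI2 _] := andP hI.
  have g1 := ler_wpM2l (ltW p0) h1; have g2 := ler_wpM2l (ltW q0) h2.
  have E : p * ((- ln p + s) * (d - M + C * s)) + (1 - p) * ((- ln (1 - p) + s) * (d - M + C * s))
    = H * (d - M + C * s) + s * (d - M + C * s) by rewrite HE /la /mu; ring.
  have HC : H * (C * s) <= H * (C * d) by rewrite !ler_wpM2l // ltW.
  have CC : C * s <= C by rewrite ler_piMr // (le_trans sd).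
  have sB : s * (d - M + C * s) <= d * (1 + C + B).
    apply: ler_pM => //; first exact: ltW.
      by rewrite addr_ge0 // mulr_ge0 // ltW.
    lra.
  rewrite /Y -/L in g1 g2 hI2 *; lra.
have [X hX] := upper; have [X' hX'] := lower.
exists (Num.max X X') => z; rewrite ge_max => /andP[/hX h1 /hX' h2].
rewrite ler_norml; apply/andP; split; lra.
Qed.

End AperiodicLimit.

(** * The periodic limit for a rational ratio of logarithms *)

Section PeriodicLimit.
Context {R : realType}.
Variables (p rho : R) (m a b : nat).
Hypotheses (p0 : 0 < p) (p1 : p < 1) (m2 : (1 < m)%N).
Hypotheses (rho0 : 0 < rho) (rho1 : rho < 1) (a0 : (0 < a)%N) (ab : coprime a b).
Hypotheses (pE : p = rho ^+ a) (qE : 1 - p = rho ^+ b).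

Let q0 : 0 < 1 - p. Proof. by rewrite subr_gt0. Qed.
Let rt := ratio p m.

Definition hump (z : R) : R := toll_fun m z / z.

Lemma hump_ge0 z : 0 < z -> 0 <= hump z.
Proof. by move=> z0; rewrite divr_ge0 ?toll_fun_ge0 // ltW. Qed.

Lemma hump_le : exists2 C : R, 0 <= C & forall z, 0 < z -> hump z <= C / z.
Proof.
have [C C0 hC] := toll_fun_bound (R := R) m2; exists C => // z z0.
rewrite ler_wpM2r ?invr_ge0 ?(ltW z0) //; apply: (le_trans (ler_norm _)).
apply: (le_trans (hC z (ltW z0))); rewrite -[leRHS]mulr1 ler_wpM2l // /wt.
rewrite ler_pdivrMr ?exprn_gt0 ?addr_gt0 // mul1r.
by rewrite lerXn2r ?nnegrE ?addr_ge0 ?(ltW z0) // lerDr.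
Qed.

(** The discrete counterpart of the weighted drop of [cumul]: the equation of [ratio], with its
    arguments at rho^a z and rho^b z, becomes a first-order recursion for these window sums. *)
Let S z := \sum_(i < a) p * rt (rho ^+ i * z) + \sum_(i < b) (1 - p) * rt (rho ^+ i * z).

Let shift (c : R) n z :
  \sum_(i < n) c * rt (rho ^+ i * z) + c * rt (rho ^+ n * z) =
  c * rt z + \sum_(i < n) c * rt (rho ^+ i * (rho * z)).
Proof.
rewrite -(big_ord_recr n (fun i => c * rt (rho ^+ i * z))) big_ord_recl /= expr0 mul1r.
by congr (_ + _); apply: eq_bigr => i _; rewrite exprSr mulrA.
Qed.

Let S_step z : 0 < z -> S z = hump z + S (rho * z).
Proof.
move=> z0; have := shift p a z; have := shift (1 - p) b z; rewrite -pE -qE.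
have := ratio_eq p0 p1 m2 z0; rewrite -/(hump z) -/rt /S; lra.
Qed.

Let S_series n z : 0 < z -> S z = \sum_(i < n) hump (rho ^+ i * z) + S (rho ^+ n * z).
Proof.
move=> z0; elim: n => [|n IH]; first by rewrite big_ord0 add0r expr0 mul1r.
rewrite IH big_ord_recr /= -addrA; congr (_ + _).
rewrite S_step ?mulr_gt0 ?exprn_gt0 //; congr (_ + S _).
by rewrite exprS mulrA.
Qed.

(** The entropy of [p] divided by [- ln rho]. *)
Let kappa := p * a%:R + (1 - p) * b%:R.

Lemma kappa_gt0 : 0 < kappa.
Proof. by rewrite ltr_pwDl ?mulr_gt0 ?ltr0n // mulr_ge0 // ltW. Qed.

Let S_bound (c z : R) : 0 < z -> (forall i, rt (rho ^+ i * z) <= c) -> S z <= kappa * c.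
Proof.
move=> z0 h; rewrite /S /kappa mulrDl; apply: lerD.
  apply: (@le_trans _ _ (\sum_(i < a) p * c)).
    by apply: ler_sum => i _; rewrite ler_wpM2l // ltW.
  by rewrite sumr_const card_ord -[X in X <= _]mulr_natr mulrAC.
apply: (@le_trans _ _ (\sum_(i < b) (1 - p) * c)).
  by apply: ler_sum => i _; rewrite ler_wpM2l // ltW.
by rewrite sumr_const card_ord -[X in X <= _]mulr_natr mulrAC.
Qed.

Let S_ge0 z : 0 < z -> 0 <= S z.
Proof.
move=> z0; have h i : 0 <= rt (rho ^+ i * z).
  exact: (ratio_ge0 p0 p1 m2 (mulr_gt0 (exprn_gt0 i rho0) z0)).
by apply: addr_ge0; apply: sumr_ge0 => i _; apply: mulr_ge0 => //; exact: ltW.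
Qed.

Lemma hump_series_down z : 0 < z -> series (fun i => hump (rho ^+ i * z)) n @[n --> \oo] --> S z.
Proof.
move=> z0; have [C hC] := ratio_bound p0 p1 m2.
(* The bound by [pot] makes [ratio] O(w) near 0, so the remainder of the series decays
   geometrically. *)
have rtle w : 0 < w -> rt w <= `|C| * w.
  move=> w0; apply: (le_trans (hC w w0)); rewrite ler_pdivrMr // -mulrA.
  apply: (@le_trans _ _ (`|C| * pot w)).
    by rewrite ler_wpM2r ?pot_ge0 ?(ltW w0) // ler_norm.
  rewrite ler_wpM2l // /pot ler_pdivrMr ?addr_gt0 //.
  by rewrite -expr2 mulrDr mulr1 lerDl mulr_ge0 ?sqr_ge0 // ltW.
have rn i : 0 < rho ^+ i by rewrite exprn_gt0.
have r1 i : rho ^+ i <= 1 by rewrite exprn_ile1 // ltW.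
have hS n : S (rho ^+ n * z) <= kappa * (`|C| * z) * rho ^+ n.
  have -> : kappa * (`|C| * z) * rho ^+ n = kappa * (`|C| * (rho ^+ n * z)) by ring.
  apply: S_bound; first by rewrite mulr_gt0.
  move=> i; apply: (le_trans (rtle _ _)); first by rewrite !mulr_gt0.
  by rewrite ler_wpM2l // ler_piMl // mulr_ge0 ?(ltW z0) // ltW.
have hg : kappa * (`|C| * z) * rho ^+ n @[n --> \oo] --> (0 : R).
  rewrite -(mulr0 (kappa * (`|C| * z))); apply: cvgM; first exact: cvg_cst.
  by apply: cvg_expr; rewrite ger0_norm // ltW.
have h0 : S (rho ^+ n * z) @[n --> \oo] --> (0 : R).
  apply: (@squeeze_cvgr _ _ _ _ (fun=> 0) (fun n => kappa * (`|C| * z) * rho ^+ n)) => //; last exact: cvg_cst.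
  by near=> n; rewrite hS andbT S_ge0 // mulr_gt0.
rewrite (_ : series _ = (fun n => S z - S (rho ^+ n * z))).
  by rewrite -[X in _ --> X]subr0; apply: cvgB => //; exact: cvg_cst.
by apply/funext => n; rewrite (S_series n z0) addrK /series /= big_mkord.
Unshelve. all: by end_near. Qed.

Let T z := limn (series (fun i => hump (z / rho ^+ i.+1))).

Let T_cvg_le : exists2 C : R, 0 <= C & forall z, 0 < z ->
  series (fun i => hump (z / rho ^+ i.+1)) n @[n --> \oo] --> T z /\ 0 <= T z <= C / z.
Proof.
have [C C0 hC] := hump_le.
exists (C / (1 - rho)) => [|z z0]; first by rewrite divr_ge0 // subr_ge0 ltW.
have rn i : 0 < rho ^+ i by rewrite exprn_gt0.
have zi i : 0 < z / rho ^+ i.+1 by rewrite divr_gt0.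
have nd : nondecreasing_seq (series (fun i => hump (z / rho ^+ i.+1))).
  by apply: nondecreasing_series => n _ _; rewrite hump_ge0.
have bd n : series (fun i => hump (z / rho ^+ i.+1)) n <= C / (1 - rho) / z.
  rewrite /series /= big_mkord.
  apply: (@le_trans _ _ (\sum_(i < n) C / z * rho ^+ i)).
    apply: ler_sum => i _; apply: (le_trans (hC _ (zi i))).
    rewrite invfM invrK mulrA ler_wpM2l ?divr_ge0 ?(ltW z0) //.
    by rewrite exprSr ler_piMr ?(ltW (rn _)) // ltW.
  rewrite -mulr_sumr mulrAC ler_wpM2r ?invr_ge0 ?(ltW z0) // ler_wpM2l //.
  have r1 : 0 < 1 - rho by rewrite subr_gt0.
  rewrite -[leRHS]mul1r ler_pdivlMr // mulrC -opprB mulNr -subrX1 opprB.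
  by rewrite gerBl ltW.
have cv : cvgn (series (fun i => hump (z / rho ^+ i.+1))).
  by apply: nondecreasing_is_cvgn => //; exists (C / (1 - rho) / z) => _ [n _ <-].
split => //; apply/andP; split.
  apply: limr_ge => //; near=> n; rewrite /series /= sumr_ge0 // => i _.
  by rewrite hump_ge0.
by apply: limr_le => //; near=> n.
Unshelve. all: by end_near. Qed.

Lemma hump_series_up z : 0 < z -> series (fun i => hump (z / rho ^+ i.+1)) n @[n --> \oo] --> T z.
Proof. by have [C _ h] := T_cvg_le; move=> /h []. Qed.

Definition profile z : R := S z + T z.

Lemma profile_rho z : 0 < z -> profile (rho * z) = profile z.
Proof.
move=> z0; rewrite /profile (S_step z0); suff -> : T (rho * z) = hump z + T z by ring.
apply: cvg_lim => //.
apply/(cvg_succP (series (fun i => hump (rho * z / rho ^+ i.+1)))).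
rewrite (_ : (fun L => _) = (fun n => hump z + series (fun i => hump (z / rho ^+ i.+1)) n)).
  by apply: cvgD; [exact: cvg_cst|exact: hump_series_up].
apply/funext => n; rewrite /series /= big_nat_recl //=; congr (_ + _).
  by rewrite expr1 mulrAC divff ?mul1r // gt_eqF.
apply: eq_bigr => i _; congr hump; rewrite [rho ^+ i.+2]exprS.
by field; rewrite !gt_eqF // exprn_gt0.
Qed.

Lemma profile_rhoX n z : 0 < z -> profile (rho ^+ n * z) = profile z.
Proof.
move=> z0; elim: n => [|n IH]; first by rewrite expr0 mul1r.
by rewrite exprS -mulrA profile_rho // mulr_gt0 // exprn_gt0.
Qed.

Let D z := rt z - profile z / kappa.

Let D_bounded : exists B : R, forall z, 1 <= z -> `|D z| <= B.
Proof.
have [B B0 hB] := ratio_bounded p0 p1 m2; have [C C0 hC] := T_cvg_le.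
exists (B + (kappa * B + C) / kappa) => z z1; have z0 : 0 < z by apply: lt_le_trans z1.
apply: (le_trans (ler_normB _ _)); apply: lerD; first exact: hB.
have [_ /andP[T0 TC]] := hC z z0.
rewrite ger0_norm; last by apply: divr_ge0; [apply: addr_ge0 => //; exact: S_ge0|exact: (ltW kappa_gt0)].
rewrite ler_pM2r ?invr_gt0 ?kappa_gt0 //; apply: lerD.
  apply: S_bound => // i; apply: (le_trans (ler_norm _)); apply: hB.
  by rewrite mulr_gt0 // exprn_gt0.
by apply: (le_trans TC); rewrite ler_pdivrMr // ler_peMr.
Qed.

(** By invariance of [profile] the window sum of [D] is [S z - profile z]. It tends to 0, so [D]
    cannot be near a positive limit superior, or a negative limit inferior, on a whole window far
    out. *)
Let D_sum z : 0 < z ->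
  \sum_(i < a) p * D (rho ^+ i * z) + \sum_(i < b) (1 - p) * D (rho ^+ i * z) = - T z.
Proof.
move=> z0; have E (c : R) n : \sum_(i < n) c * D (rho ^+ i * z) =
    \sum_(i < n) c * rt (rho ^+ i * z) - c * n%:R * (profile z / kappa).
  rewrite /D (eq_bigr (fun i : 'I_n => c * rt (rho ^+ i * z) - c * (profile z / kappa))).
    by rewrite sumrB sumr_const card_ord -mulr_natr; ring.
  by move=> i _; rewrite profile_rhoX // mulrBr.
rewrite !E; have k0 : kappa != 0 by rewrite gt_eqF ?kappa_gt0.
have -> : \sum_(i < a) p * rt (rho ^+ i * z) - p * a%:R * (profile z / kappa) +
  (\sum_(i < b) (1 - p) * rt (rho ^+ i * z) - (1 - p) * b%:R * (profile z / kappa)) =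
  S z - kappa * (profile z / kappa) by rewrite /S /kappa; ring.
by rewrite (mulrC kappa) divfK // /profile; ring.
Qed.

Let rho_comb : exists u v : nat, p ^+ u / (1 - p) ^+ v = rho.
Proof.
have [u v E _] := egcdnP b a0; exists u, v.
rewrite qE pE -!exprM (mulnC a) (mulnC b) E (eqP ab) addn1 exprS mulfK //.
by rewrite expf_neq0 // gt_eqF.
Qed.

Let weighted_ge (c : R) (f : nat -> R) : (forall k, (k <= maxn a b)%N -> c <= f k) ->
  kappa * c <= \sum_(i < a) p * f i + \sum_(i < b) (1 - p) * f i.
Proof.
move=> h; rewrite /kappa mulrDl; apply: lerD.
  apply: (@le_trans _ _ (\sum_(i < a) p * c)).
    by rewrite sumr_const card_ord -[X in _ <= X]mulr_natr mulrAC.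
  apply: ler_sum => i _; rewrite ler_wpM2l ?(ltW p0) // h //.
  by rewrite (leq_trans (ltnW (ltn_ord i))) // leq_maxl.
apply: (@le_trans _ _ (\sum_(i < b) (1 - p) * c)).
  by rewrite sumr_const card_ord -[X in _ <= X]mulr_natr mulrAC.
apply: ler_sum => i _; rewrite ler_wpM2l ?(ltW q0) // h //.
by rewrite (leq_trans (ltnW (ltn_ord i))) // leq_maxr.
Qed.

Let D_rec (e : R) : 0 < e -> exists X : R, forall z, X <= z ->
  `|D z - (p * D (p * z) + (1 - p) * D ((1 - p) * z))| <= e.
Proof.
move=> e0; have [X hX] := ratio_rec_error p0 p1 m2 e0; exists (Num.max X 1) => z.
rewrite ge_max => /andP[zX z1]; have z0 : 0 < z by apply: lt_le_trans z1.
have := hX z zX; rewrite /D.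
have -> : profile (p * z) = profile z by rewrite {1}pE profile_rhoX.
have -> : profile ((1 - p) * z) = profile z by rewrite {1}qE profile_rhoX.
congr (`|_| <= _); rewrite /rt; ring.
Qed.

Lemma ratio_periodic (e : R) : 0 < e -> exists X : R, forall z, X <= z ->
  `|ratio p m z - profile z / kappa| <= e.
Proof.
move=> e0; have [B hB] := D_bounded; have [C C0 hC] := T_cvg_le.
have [u [v Ew]] := rho_comb; have k0 := kappa_gt0.
have upper : exists X : R, forall z, X <= z -> D z <= e.
  have hr d : 0 < d -> exists X : R, forall z, X <= z ->
      D z <= d + (p * D (p * z) + (1 - p) * D ((1 - p) * z)).
    move=> /D_rec [X hX]; exists X => z Xz.
    by have := hX z Xz; rewrite ler_norml => /andP[_]; rewrite lerBlDr.
  have [M [hM hS]] := sticky p0 p1 hB hr.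
  suff M0 : M <= 0 by have [X hX] := hM e e0; exists X => z Xz; have := hX z Xz; lra.
  apply/ler_addgt0Pr => d d0; rewrite add0r.
  have [z z1 h] := hS u v (maxn a b) d 1 d0; rewrite Ew in h.
  have z0 : 0 < z by apply: lt_le_trans z1.
  have := weighted_ge (f := fun k => D (rho ^+ k * z)) h; rewrite D_sum //.
  have [_ /andP[T0 _]] := hC z z0 => hk.
  have : kappa * (M - d) <= 0 by apply: (le_trans hk); rewrite oppr_le0.
  by rewrite pmulr_rle0 // subr_le0.
have lower : exists X : R, forall z, X <= z -> - D z <= e.
  have hb z : 1 <= z -> `|- D z| <= B by rewrite normrN; exact: hB.
  have hr d : 0 < d -> exists X : R, forall z, X <= z ->
      - D z <= d + (p * - D (p * z) + (1 - p) * - D ((1 - p) * z)).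
    move=> /D_rec [X hX]; exists X => z Xz.
    by have := hX z Xz; rewrite ler_norml => /andP[+ _]; lra.
  have [M [hM hS]] := sticky p0 p1 hb hr.
  suff M0 : M <= 0 by have [X hX] := hM e e0; exists X => z Xz; have := hX z Xz; lra.
  apply/ler_addgt0Pr => d d0; rewrite add0r.
  have d20 : 0 < d / 2 by rewrite divr_gt0.
  (* The window sum is now [T z], which is positive but at most C / z; the window is taken far
     enough out for this to be below kappa d / 2. *)
  have [z] := hS u v (maxn a b) (d / 2) (Num.max 1 (C / (kappa * (d / 2)))) d20.
  rewrite Ew ge_max => /andP[z1 z2] h.
  have z0 : 0 < z by apply: lt_le_trans z1.
  have := weighted_ge (f := fun k => - D (rho ^+ k * z)) h.
  have -> : \sum_(i < a) p * - D (rho ^+ i * z) + \sum_(i < b) (1 - p) * - D (rho ^+ i * z) = T z.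
    rewrite -[RHS]opprK -D_sum // opprD -!sumrN; congr (_ + _); apply: eq_bigr => i _; exact: mulrN.
  have [_ /andP[_ T1]] := hC z z0 => hk.
  have : kappa * (M - d / 2) <= kappa * (d / 2).
    apply: (le_trans hk); apply: (le_trans T1).
    by rewrite ler_pdivrMr // mulrC -ler_pdivrMr // mulr_gt0.
  by rewrite ler_pM2l //; lra.
have [X hX] := upper; have [X' hX'] := lower.
exists (Num.max X X') => z; rewrite ge_max => /andP[/hX h1 /hX' h2].
by rewrite ler_norml -/(D z); apply/andP; split; lra.
Qed.

(** Invariance under [rho] moves [z] arbitrarily far out, where [profile] is close to [kappa] times
    [ratio], whose Lipschitz bound survives the limit. *)
Lemma profile_lip : exists2 C : R, 0 <= C & forall r z : R, 1 <= r <= 2 -> 0 < z ->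
  `|profile (r * z) - profile z| <= C * (r - 1).
Proof.
have [C C0 hC] := ratio_lip p0 p1 m2; have k0 := kappa_gt0.
exists (kappa * C) => [|r z hr z0]; first by rewrite mulr_ge0 // ltW.
have r0 : 0 < r by case/andP: hr => r1 _; apply: lt_le_trans r1.
apply/ler_addgt0Pr => e e0.
have e1 : 0 < e / (2 * kappa) by rewrite divr_gt0 // mulr_gt0.
have [X hX] := ratio_periodic e1.
pose Z := Num.max X 1.
have Z0 : 0 < Z by rewrite lt_max ltr01 orbT.
have [n hn] : exists n, Z <= z / rho ^+ n.
  have cg : rho ^+ n @[n --> \oo] --> (0 : R) by apply: cvg_expr; rewrite ger0_norm // ltW.
  have zZ : 0 < z / Z by rewrite divr_gt0.
  have /cvgr0_norm_le /(_ _ zZ) [n _ /(_ n (leqnn n))] := cg.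
  rewrite /= ger0_norm ?exprn_ge0 ?(ltW rho0) // => h; exists n.
  by rewrite ler_pdivlMr ?exprn_gt0 // mulrC -ler_pdivlMr.
have rn : 0 < rho ^+ n by rewrite exprn_gt0.
pose w := z / rho ^+ n; have w0 : 0 < w by rewrite divr_gt0.
have zw : z = rho ^+ n * w by rewrite /w mulrC divfK // gt_eqF.
have wX : X <= w by apply: le_trans hn; rewrite le_max lexx.
have rwX : X <= r * w.
  by case/andP: hr => r1 _; apply: (le_trans wX); rewrite ler_peMl // ltW.
have -> : profile z = profile w by rewrite zw profile_rhoX.
have -> : profile (r * z) = profile (r * w) by rewrite zw mulrCA profile_rhoX // mulr_gt0.
have h1 := hX _ wX; have h2 := hX _ rwX; have h3 := hC r w hr w0.
have -> : profile (r * w) - profile w = kappa * ((ratio p m (r * w) - ratio p m w) -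
   (ratio p m (r * w) - profile (r * w) / kappa) + (ratio p m w - profile w / kappa)).
  by field; rewrite gt_eqF.
rewrite normrM (ger0_norm (ltW k0)).
have -> : kappa * C * (r - 1) + e = kappa * (C * (r - 1) + e / (2 * kappa) + e / (2 * kappa)).
  by field; rewrite gt_eqF.
rewrite ler_wpM2l ?(ltW k0) // (le_trans (ler_normD _ _)) //; apply: lerD => //.
by rewrite (le_trans (ler_normB _ _)) //; apply: lerD.
Qed.

End PeriodicLimit.

(** * Fourier series *)

Section Fourier.
Context {R : realType}.
Implicit Types f g : R -> R.

Local Notation mu := (@lebesgue_measure R).
Let I : set R := `[- pi, pi]%classic.

Let mI : measurable I. Proof. exact: measurable_itv. Qed.

Let muI : (lebesgue_measure I = (2 * pi)%:E)%E.
Proof.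
rewrite /I lebesgue_measure_itv /= lte_fin gtrN ?pi_gt0 //.
by rewrite -EFinB opprK mulr_natl mulr2n.
Qed.

Definition bounded_meas f : Prop :=
  measurable_fun I f /\ exists C, forall x, - pi <= x <= pi -> `|f x| <= C.

Definition circle_int f : R := (\int[mu]_(x in I) f x)%R.

Lemma bounded_meas_integrable f : bounded_meas f -> mu.-integrable I (EFin \o f).
Proof.
move=> [mf [C hC]]; apply: measurable_bounded_integrable => //.
  by apply: (le_lt_trans (y := (2 * pi)%:E)); [rewrite le_eqVlt; apply/orP; left; apply/eqP; exact: muI|exact: ltry].
exists C; split; first exact: num_real.
by move=> M CM x xI; apply: (le_trans (hC x _)); [move: xI; rewrite /I /= in_itv|exact: ltW].
Qed.

Lemma bounded_measD f g : bounded_meas f -> bounded_meas g -> bounded_meas (fun x => f x + g x).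
Proof.
move=> [mf [C hC]] [mg [C' hC']]; split; first exact: measurable_funD.
exists (C + C') => x hx; apply: (le_trans (ler_normD _ _)); apply: lerD; [exact: hC|exact: hC'].
Qed.

Lemma bounded_measM f g : bounded_meas f -> bounded_meas g -> bounded_meas (fun x => f x * g x).
Proof.
move=> [mf [C hC]] [mg [C' hC']]; split; first exact: measurable_funM.
by exists (C * C') => x hx; rewrite normrM; apply: ler_pM => //; [exact: hC|exact: hC'].
Qed.

Lemma bounded_meas_cst c : bounded_meas (fun=> c).
Proof. by split => //; exists `|c|. Qed.

Lemma bounded_measZ c f : bounded_meas f -> bounded_meas (fun x => c * f x).
Proof. by apply: bounded_measM; exact: bounded_meas_cst. Qed.

Lemma bounded_measB f g : bounded_meas f -> bounded_meas g -> bounded_meas (fun x => f x - g x).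
Proof.
move=> hf hg; have := bounded_measD hf (bounded_measZ (-1) hg).
by have -> : (fun x => f x + -1 * g x) = (fun x => f x - g x) by apply/funext => x; rewrite mulN1r.
Qed.

Lemma bounded_meas_cont f C : continuous f -> (forall x, - pi <= x <= pi -> `|f x| <= C) -> bounded_meas f.
Proof.
by move=> cf h; split; [apply: measurable_funTS; exact: continuous_measurable_fun|exists C].
Qed.

Lemma bounded_meas_sum (J : Type) (s : seq J) (F : J -> R -> R) :
  (forall j, bounded_meas (F j)) -> bounded_meas (fun x => \sum_(j <- s) F j x).
Proof.
move=> h; elim: s => [|j s IH].
  rewrite (_ : (fun x => _) = (fun=> 0)); first exact: bounded_meas_cst.
  by apply/funext => x; rewrite big_nil.
rewrite (_ : (fun x => _) = (fun x => F j x + \sum_(j <- s) F j x)); first exact: bounded_measD.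
by apply/funext => x; rewrite big_cons.
Qed.

Lemma circle_intD f g : bounded_meas f -> bounded_meas g ->
  circle_int (fun x => f x + g x) = circle_int f + circle_int g.
Proof. by move=> hf hg; rewrite /circle_int RintegralD //; exact: bounded_meas_integrable. Qed.

Lemma circle_intZ c f : bounded_meas f -> circle_int (fun x => c * f x) = c * circle_int f.
Proof. by move=> hf; rewrite /circle_int RintegralZl //; exact: bounded_meas_integrable. Qed.

Lemma circle_intB f g : bounded_meas f -> bounded_meas g ->
  circle_int (fun x => f x - g x) = circle_int f - circle_int g.
Proof. by move=> hf hg; rewrite /circle_int RintegralB //; exact: bounded_meas_integrable. Qed.

Lemma eq_circle_int f g : (forall x, - pi <= x <= pi -> f x = g x) -> circle_int f = circle_int g.
Proof.
move=> h; apply: eq_Rintegral => x; rewrite inE /I /= in_itv /=; exact: h.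
Qed.

Lemma circle_int_cst c : circle_int (fun=> c) = c * (2 * pi).
Proof.
rewrite /circle_int Rintegral_cst //; congr (_ * _).
by apply: (etrans (congr1 fine muI)).
Qed.

Lemma circle_int_sum (J : Type) (s : seq J) (F : J -> R -> R) :
  (forall j, bounded_meas (F j)) ->
  circle_int (fun x => \sum_(j <- s) F j x) = \sum_(j <- s) circle_int (F j).
Proof.
move=> h; elim: s => [|j s IH].
  rewrite big_nil (@eq_circle_int _ (fun=> 0)); first by rewrite circle_int_cst mul0r.
  by move=> x _; rewrite big_nil.
rewrite big_cons -IH -circle_intD //; last exact: bounded_meas_sum.
by apply: eq_circle_int => x _; rewrite big_cons.
Qed.

Section Bessel.
Variables (f : R -> R) (e : nat -> R -> R) (c : R).
Hypotheses (bf : bounded_meas f) (be : forall n, bounded_meas (e n)) (c0 : 0 < c).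
Hypothesis (en : forall n, circle_int (fun x => e n x * e n x) = c).
Hypothesis (eo : forall n k, (n < k)%N -> circle_int (fun x => e n x * e k x) = 0).

Let a n := circle_int (fun x => f x * e n x).
Let r N x := f x - \sum_(n <- iota 0 N) (a n / c) * e n x.

Let br N : bounded_meas (r N).
Proof. by apply: bounded_measB => //; apply: bounded_meas_sum => n; exact: bounded_measZ. Qed.

Let re N : circle_int (fun x => r N x * e N x) = a N.
Proof.
have -> : (fun x => r N x * e N x) = (fun x => f x * e N x - \sum_(n <- iota 0 N) (a n / c) * (e n x * e N x)).
  apply/funext => x; rewrite /r mulrBl mulr_suml; congr (_ - _).
  by apply: eq_bigr => n _; rewrite mulrA.
rewrite circle_intB; [|exact: bounded_measM|by apply: bounded_meas_sum => n; apply: bounded_measZ; exact: bounded_measM].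
rewrite circle_int_sum => [|n]; last by apply: bounded_measZ; exact: bounded_measM.
rewrite big_seq big1 ?subr0 // => n; rewrite mem_iota add0n => /andP[_ nN].
by rewrite circle_intZ ?eo ?mulr0 //; exact: bounded_measM.
Qed.

Let bessel N : circle_int (fun x => r N x ^+ 2) = circle_int (fun x => f x ^+ 2) - \sum_(n < N) a n ^+ 2 / c.
Proof.
elim: N => [|N IH].
  rewrite big_ord0 subr0; apply: eq_circle_int => x _.
  by rewrite /r big_nil subr0.
have -> : (fun x => r N.+1 x ^+ 2) = (fun x => (r N x * r N x - (2 * (a N / c)) * (r N x * e N x)) +
    (a N / c) ^+ 2 * (e N x * e N x)).
  apply/funext => x; rewrite {1}/r -addn1 iotaD big_cat big_seq1 add0n opprD addrA -/(r N x); ring.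
have b1 : bounded_meas (fun x => r N x * r N x) by exact: bounded_measM.
have b2 : bounded_meas (fun x => r N x * e N x) by exact: bounded_measM.
have b3 : bounded_meas (fun x => e N x * e N x) by exact: bounded_measM.
rewrite circle_intD; [|by apply: bounded_measB => //; exact: bounded_measZ|exact: bounded_measZ].
rewrite circle_intB //; last exact: bounded_measZ.
rewrite !circle_intZ // re en -/(circle_int (fun x => r N x ^+ 2)) IH big_ord_recr /=.
by field; rewrite gt_eqF.
Qed.

(** By Bessel's inequality the squared coefficients are summable, which gives the Riemann-Lebesgue
    lemma for bounded functions without smooth approximation. *)
Lemma bessel_cvg0 : circle_int (fun x => f x * e n x) @[n --> \oo] --> (0 : R).
Proof.
have hs : cvgn (series (fun n => a n ^+ 2)).
  apply: nondecreasing_is_cvgn.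
    by apply: nondecreasing_series => n _ _; exact: sqr_ge0.
  exists (circle_int (fun x => f x ^+ 2) * c) => _ [N _ <-].
  rewrite /series /= big_mkord -ler_pdivrMr //.
  have h0 : 0 <= circle_int (fun x => r N x ^+ 2).
    by apply: Rintegral_ge0 => x _; exact: sqr_ge0.
  by move: h0; rewrite bessel subr_ge0 mulr_suml.
have h2 := cvg_series_cvg_0 hs.
apply/cvgr0Pnorm_lt => d d0.
have d20 : 0 < d ^+ 2 by rewrite exprn_gt0.
have /cvgr0_norm_lt /(_ _ d20) [N _ hN] := h2.
exists N => // n /hN /=; rewrite ger0_norm ?sqr_ge0 // -[a n ^+ 2]real_normK ?num_real //.
by rewrite ltr_pXn2r // nnegrE ltW.
Qed.

End Bessel.

End Fourier.

(** * Dirichlet's theorem at a point of Lipschitz continuity *)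

Section Dirichlet.
Context {R : realType}.
Implicit Types (f : R -> R) (n k N : nat).

Lemma circle_int_FTC f F : continuous f -> (forall x : R, is_derive x 1 F (f x)) ->
  circle_int f = F pi - F (- pi).
Proof.
move=> cf hF.
have cF : continuous F by move=> x; apply/differentiable_continuous/derivable1_diffP; have [] := hF x.
have pp : - pi < pi :> R by rewrite gtrN // pi_gt0.
rewrite /circle_int /Rintegral (@continuous_FTC2 R f F (- pi) pi pp) //.
- exact: continuous_subspaceT.
- split; first by move=> x _; have [] := hF x.
    by apply: cvg_at_right_filter; exact: cF.
  by apply: cvg_at_left_filter; exact: cF.
- by move=> x _; rewrite derive1E; have [_ ->] := hF x.
Qed.

Lemma continuous_cosM (c : R) : continuous (fun x => cos (c * x)).
Proof.
move=> x; apply: (@continuous_comp _ _ _ (fun y => c * y) cos); last exact: continuous_cos.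
exact: mulrl_continuous.
Qed.

Lemma continuous_sinM (c : R) : continuous (fun x => sin (c * x)).
Proof.
move=> x; apply: (@continuous_comp _ _ _ (fun y => c * y) sin); last exact: continuous_sin.
exact: mulrl_continuous.
Qed.

Lemma bounded_meas_cos (c : R) : bounded_meas (fun x => cos (c * x)).
Proof.
by apply: (bounded_meas_cont (C := 1)) => [|x _]; [exact: continuous_cosM|exact: cos_max].
Qed.

Lemma bounded_meas_sin (c : R) : bounded_meas (fun x => sin (c * x)).
Proof.
by apply: (bounded_meas_cont (C := 1)) => [|x _]; [exact: continuous_sinM|exact: sin_max].
Qed.

Lemma sin_npi n : sin (n%:R * pi) = 0 :> R.
Proof.
elim: n => [|n IH]; first by rewrite mul0r sin0.
by rewrite -natr1 mulrDl mul1r sinD IH sinpi mul0r mulr0 addr0.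
Qed.

Let dM (c x : R) : is_derive x 1 (fun y : R => c * y) c.
Proof.
apply: is_derive_conv (is_deriveZ c (is_derive_id x 1)) _ _ => //.
by rewrite /GRing.scale /= mulr1.
Qed.

Lemma circle_int_cos n : (0 < n)%N -> circle_int (fun x => cos (n%:R * x)) = 0 :> R.
Proof.
move=> n0; have nR : (n%:R : R) != 0 by rewrite pnatr_eq0 -lt0n.
have hF (x : R) : is_derive x 1 (fun y : R => n%:R^-1 * sin (n%:R * y)) (cos (n%:R * x)).
  have h := @is_derive1_comp R sin (fun y => n%:R * y) x _ _ (is_derive_sin _) (dM n%:R x).
  apply: is_derive_conv (is_deriveZ n%:R^-1 h) _ _ => //.
  by rewrite /GRing.scale /= mulrC mulfK.
rewrite (circle_int_FTC (@continuous_cosM n%:R) hF).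
by rewrite mulrN sinN sin_npi oppr0 mulr0 subrr.
Qed.

Lemma circle_int_sin n : circle_int (fun x => sin (n%:R * x)) = 0 :> R.
Proof.
case: n => [|n].
  by rewrite (@eq_circle_int _ _ (fun=> 0)) ?circle_int_cst ?mul0r // => x _; rewrite mul0r sin0.
have nR : (n.+1%:R : R) != 0 by rewrite pnatr_eq0.
have hF (x : R) : is_derive x 1 (fun y : R => (- n.+1%:R^-1) * cos (n.+1%:R * y)) (sin (n.+1%:R * x)).
  have h := @is_derive1_comp R cos (fun y => n.+1%:R * y) x _ _ (is_derive_cos _) (dM n.+1%:R x).
  apply: is_derive_conv (is_deriveZ (- n.+1%:R^-1) h) _ _ => //.
  by rewrite /GRing.scale /=; field.
rewrite (circle_int_FTC (@continuous_sinM n.+1%:R) hF).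
by rewrite mulrN cosN subrr.
Qed.

Lemma mul_cos_cos (u v : R) : cos u * cos v = 2^-1 * (cos (u - v) + cos (u + v)).
Proof. by rewrite cosB cosD; field. Qed.

Lemma mul_sin_sin (u v : R) : sin u * sin v = 2^-1 * (cos (u - v) - cos (u + v)).
Proof. by rewrite cosB cosD; field. Qed.

(** The sign [s] treats cosines (1) and sines (-1) together; orthogonality is asked for n < k, and
    the case n > k is left as it stands. *)
Let int_prod n k (s : R) : circle_int (fun x => 2^-1 * (cos (k.+1%:R * x - n.+1%:R * x) + s * cos (k.+1%:R * x + n.+1%:R * x)))
  = if n == k then pi else if (n < k)%N then 0 else circle_int (fun x => 2^-1 * (cos (k.+1%:R * x - n.+1%:R * x) + s * cos (k.+1%:R * x + n.+1%:R * x))).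
Proof.
have b c := bounded_meas_cos c.
have E x : cos (k.+1%:R * x + n.+1%:R * x) = cos ((k.+1 + n.+1)%:R * x) by rewrite natrD mulrDl.
case: eqP => [->|nk].
  rewrite (@eq_circle_int _ _ (fun x => 2^-1 * (1 + s * cos ((k.+1 + k.+1)%:R * x)))).
    rewrite circle_intZ ?circle_intD ?circle_intZ ?circle_int_cos ?circle_int_cst ?mulr0 ?addr0 ?mul1r //.
    - by rewrite mulrA mulVf ?mul1r // pnatr_eq0.
    - exact: bounded_meas_cst.
    - exact: bounded_measZ.
    - by apply: bounded_measD; [exact: bounded_meas_cst|exact: bounded_measZ].
  by move=> x _; rewrite subrr cos0 natrD mulrDl.
case: ifP => // h.
rewrite (@eq_circle_int _ _ (fun x => 2^-1 * (cos ((k - n)%:R * x) + s * cos ((k.+1 + n.+1)%:R * x)))).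
  rewrite circle_intZ ?circle_intD ?circle_intZ ?circle_int_cos ?mulr0 ?addr0 ?mulr0 ?subn_gt0 //.
  - exact: bounded_measZ.
  - by apply: bounded_measD => //; exact: bounded_measZ.
by move=> x _; rewrite E -mulrBl -natrB ?subSS // ltnW.
Qed.

Lemma riemann_lebesgue_cos f : bounded_meas f ->
  circle_int (fun x => f x * cos (n%:R * x)) @[n --> \oo] --> (0 : R).
Proof.
move=> bf; apply/(cvg_succP (fun n => circle_int (fun x => f x * cos (n%:R * x)))).
apply: (bessel_cvg0 (e := fun n x => cos (n.+1%:R * x)) (c := pi)) => //.
- by move=> n; exact: bounded_meas_cos.
- exact: pi_gt0.
- move=> n; have := int_prod n n 1; rewrite eqxx => <-.
  by apply: eq_circle_int => x _; rewrite mul_cos_cos mul1r.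
- move=> n k nk; have := int_prod n k 1; rewrite nk (ltn_eqF nk) => <-.
  by apply: eq_circle_int => x _; rewrite mulrC mul_cos_cos mul1r.
Qed.

Lemma riemann_lebesgue_sin f : bounded_meas f ->
  circle_int (fun x => f x * sin (n%:R * x)) @[n --> \oo] --> (0 : R).
Proof.
move=> bf; apply/(cvg_succP (fun n => circle_int (fun x => f x * sin (n%:R * x)))).
apply: (bessel_cvg0 (e := fun n x => sin (n.+1%:R * x)) (c := pi)) => //.
- by move=> n; exact: bounded_meas_sin.
- exact: pi_gt0.
- move=> n; have := int_prod n n (-1); rewrite eqxx => <-.
  by apply: eq_circle_int => x _; rewrite mul_sin_sin mulN1r.
- move=> n k nk; have := int_prod n k (-1); rewrite nk (ltn_eqF nk) => <-.
  by apply: eq_circle_int => x _; rewrite mulrC mul_sin_sin mulN1r.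
Qed.

Lemma sin_lower (y : R) : 0 <= y -> y <= pi / 2 -> y / 4 <= sin y.
Proof.
move=> y0 yp; pose z := y / 2.
have z0 : 0 <= z by rewrite divr_ge0.
(* cos (2 w) >= 0 gives 1/2 <= cos^2 w <= cos w. *)
have cz w : 0 <= w <= z -> 2^-1 <= cos w.
  move=> /andP[w0 wz].
  have c2 : 0 <= cos (w *+ 2).
    have -> : w *+ 2 = w * 2 by rewrite mulr_natr.
    apply: cos_ge0_pihalf; apply/andP; split.
      by apply: (@le_trans _ _ 0); [rewrite oppr_le0 divr_ge0 // pi_ge0|rewrite mulr_ge0].
    by apply: le_trans yp; move: wz; rewrite /z ler_pdivlMr.
  have c0 : 0 <= cos w.
    apply: cos_ge0_pihalf; apply/andP; split.
      by apply: (@le_trans _ _ 0); [rewrite oppr_le0 divr_ge0 // pi_ge0|].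
    by apply: (le_trans wz); rewrite (le_trans _ yp) // /z ler_pdivrMr // ler_peMr // ler1n.
  have : cos w ^+ 2 <= cos w by rewrite expr2 ler_piMr // cos_le1.
  by move: c2; rewrite cos_mulr2n -mulr_natr; lra.
have [c hc] := mvt_everywhere z0 (fun x : R => is_derive_sin x).
rewrite sin0 !subr0 => Es.
have sz : z / 2 <= sin z by rewrite Es [leRHS]mulrC ler_wpM2l // cz.
have -> : y = z *+ 2 by rewrite /z -mulr_natr divfK.
rewrite sin_mulr2n.
have czz : 2^-1 <= cos z by apply: cz; rewrite z0 lexx.
have : 2^-1 * (z / 2) <= cos z * sin z by apply: ler_pM => //; rewrite divr_ge0.
rewrite -(mulr_natr z) -(mulr_natr (cos z * sin z)); lra.
Qed.

Variables (ga : R -> R) (C : R).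
Hypotheses (cga : continuous ga) (C0 : 0 <= C).
Hypothesis lip0 : forall x, - pi <= x <= pi -> `|ga x - ga 0| <= C * `|x|.

Let bga : bounded_meas ga.
Proof.
apply: (bounded_meas_cont (C := `|ga 0| + C * pi)) => // x hx.
rewrite -[ga x](subrK (ga 0)) (le_trans (ler_normD _ _)) // addrC lerD2l.
by apply: (le_trans (lip0 hx)); rewrite ler_wpM2l // ler_norml.
Qed.

(* The removable singularity at 0 is given the value 0 by division by zero. *)
Let K x := (ga x - ga 0) / (2 * sin (2^-1 * x)).

Let sin_half (x : R) : - pi <= x <= pi -> `|x| / 8 <= `|sin (2^-1 * x)|.
Proof.
move=> hx; have -> : `|sin (2^-1 * x)| = `|sin (2^-1 * `|x|)|.
  case: (leP 0 x) => x0; first by rewrite (ger0_norm x0).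
  by rewrite (ltr0_norm x0) mulrN sinN normrN.
apply: le_trans (ler_norm _).
have : 2^-1 * `|x| / 4 <= sin (2^-1 * `|x|).
  apply: sin_lower; first by rewrite mulr_ge0 ?invr_ge0.
  by rewrite mulrC ler_wpM2r ?invr_ge0 // ler_norml.
by apply: le_trans; lra.
Qed.

Let sin_half0 (x : R) : - pi <= x <= pi -> x != 0 -> sin (2^-1 * x) != 0.
Proof.
move=> hx x0; rewrite -normr_gt0; apply: lt_le_trans (sin_half hx).
by rewrite divr_gt0 // normr_gt0.
Qed.

Let cK (x : R) : sin (2^-1 * x) != 0 -> {for x, continuous K}.
Proof.
move=> h; apply: cvgM; first by apply: cvgB; [exact: cga|exact: cvg_cst].
apply: cvgV; first by rewrite mulf_neq0 // pnatr_eq0.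
by apply: cvgM; [exact: cvg_cst|exact: continuous_sinM].
Qed.

Let bK : bounded_meas K.
Proof.
split.
  (* [K] is continuous on either side of 0, and the point 0 is treated as a separate measurable
     piece. *)
  apply: (@measurable_funS _ _ _ _ (`]0, 2 * pi[ `|` ([set 0] `|` `](- (2 * pi)), 0[))).
  - by apply: measurableU => //; apply: measurableU.
  - have p0 : 0 < (pi : R) := pi_gt0 R.
    move=> x; rewrite /= !in_itv /= => /andP[x1 x2].
    case: (ltgtP x 0) => hx; [right; right|left|right; left] => //; apply/andP; split => //.
      by apply: lt_le_trans x1; rewrite ltrN2; lra.
    by apply: (le_lt_trans x2); lra.
  apply/measurable_funU => //; first by apply: measurableU.
  split.
    apply: open_continuous_measurable_fun; first exact: interval_open.
    move=> x; rewrite inE /= in_itv /= => /andP[x0 x2]; apply: cK.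
    by rewrite gt_eqF // sin_gt0_pi //; apply/andP; split; lra.
  apply/measurable_funU => //; split; first exact: measurable_fun_set1.
  apply: open_continuous_measurable_fun; first exact: interval_open.
  move=> x; rewrite inE /= in_itv /= => /andP[x0 x2]; apply: cK.
  by rewrite -oppr_eq0 -sinN -mulrN gt_eqF // sin_gt0_pi //; apply/andP; split; lra.
exists (4 * C) => x hx; rewrite /K normrM normfV.
case: (eqVneq x 0) => [->|x0]; first by rewrite subrr normr0 mul0r mulr_ge0.
have s0 := sin_half0 hx x0.
rewrite ler_pdivrMr ?normr_gt0 ?mulf_neq0 ?pnatr_eq0 //; apply: (le_trans (lip0 hx)).
rewrite normrM ger0_norm //; have := ler_wpM2l C0 (sin_half hx); lra.
Qed.

Let KE (x : R) : - pi <= x <= pi -> ga x - ga 0 = K x * (2 * sin (2^-1 * x)).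
Proof.
move=> hx; case: (eqVneq x 0) => [->|x0]; first by rewrite subrr mulr0 sin0 !mulr0.
by rewrite /K divfK // mulf_neq0 ?pnatr_eq0 ?sin_half0.
Qed.

(** The Dirichlet kernel sums to sin ((N + 1/2) x). It is left expanded, so that only integer
    frequencies meet the Riemann-Lebesgue lemma. *)
Let dirichlet_cos N (x : R) :
  2 * sin (2^-1 * x) * (2^-1 + \sum_(k < N) cos (k.+1%:R * x)) =
  sin (2^-1 * x) * cos (N%:R * x) + cos (2^-1 * x) * sin (N%:R * x).
Proof.
rewrite -sinD; elim: N => [|N IH].
  by rewrite big_ord0 addr0 mul0r addr0 mulrAC mulfV ?mul1r // pnatr_eq0.
rewrite big_ord_recr /= addrA mulrDr IH.
have -> : 2^-1 * x + N%:R * x = N.+1%:R * x - 2^-1 * x by rewrite -natr1; field.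
by rewrite (addrC (2^-1 * x)) sinB sinD; ring.
Qed.

Let dirichlet_sin N (x : R) :
  2 * sin (2^-1 * x) * \sum_(k < N) sin (k.+1%:R * x) =
  cos (2^-1 * x) - (cos (2^-1 * x) * cos (N%:R * x) - sin (2^-1 * x) * sin (N%:R * x)).
Proof.
rewrite -cosD; elim: N => [|N IH].
  by rewrite big_ord0 mulr0 mul0r addr0 subrr.
rewrite big_ord_recr /= mulrDr IH.
have -> : 2^-1 * x + N%:R * x = N.+1%:R * x - 2^-1 * x by rewrite -natr1; field.
by rewrite (addrC (2^-1 * x)) cosB cosD; ring.
Qed.

Let half_cos := bounded_meas_cos (2^-1).
Let half_sin := bounded_meas_sin (2^-1).

Lemma dirichlet_cvg_cos :
  2^-1 * circle_int ga + \sum_(k < N) circle_int (fun x => ga x * cos (k.+1%:R * x))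
  @[N --> \oo] --> pi * ga 0.
Proof.
have bs N : bounded_meas (fun x : R => 2^-1 + \sum_(k <- iota 0 N) cos (k.+1%:R * x)).
  apply: bounded_measD; first exact: bounded_meas_cst.
  by apply: bounded_meas_sum => k; exact: bounded_meas_cos.
have b1 : bounded_meas (fun x => K x * sin (2^-1 * x)) by exact: bounded_measM.
have b2 : bounded_meas (fun x => K x * cos (2^-1 * x)) by exact: bounded_measM.
have sumE (F : nat -> R) N : \sum_(k < N) F k = \sum_(k <- iota 0 N) F k.
  by rewrite -(big_mkord xpredT F) /index_iota subn0.
have E N : 2^-1 * circle_int ga + \sum_(k < N) circle_int (fun x => ga x * cos (k.+1%:R * x)) =
    circle_int (fun x => (K x * sin (2^-1 * x)) * cos (N%:R * x)) +
    circle_int (fun x => (K x * cos (2^-1 * x)) * sin (N%:R * x)) + pi * ga 0.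
  transitivity (circle_int (fun x => ga x * (2^-1 + \sum_(k <- iota 0 N) cos (k.+1%:R * x)))).
    rewrite (sumE (fun k => circle_int (fun x => ga x * cos (k.+1%:R * x)))) -circle_int_sum => [|k]; last by apply: bounded_measM => //; exact: bounded_meas_cos.
    rewrite -circle_intZ // -circle_intD; [|exact: bounded_measZ|].
      by apply: eq_circle_int => x _; rewrite mulrDr mulr_sumr mulrC.
    by apply: bounded_meas_sum => k; apply: bounded_measM => //; exact: bounded_meas_cos.
  rewrite -circle_intD; [|by apply: bounded_measM => //; exact: bounded_meas_cos|by apply: bounded_measM => //; exact: bounded_meas_sin].
  (* The constant [ga 0] is integrated against the kernel exactly, since the cosines have mean zero;
     only the difference [ga x - ga 0] needs a limit. *)
  have <- : circle_int (fun x => ga 0 * (2^-1 + \sum_(k <- iota 0 N) cos (k.+1%:R * x))) = pi * ga 0.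
    rewrite circle_intZ // circle_intD; [|exact: bounded_meas_cst|by apply: bounded_meas_sum => k; exact: bounded_meas_cos].
    rewrite circle_int_sum => [|k]; last exact: bounded_meas_cos.
    rewrite big1 => [|k _]; last exact: circle_int_cos.
    by rewrite circle_int_cst addr0; field.
  rewrite -circle_intD; last 2 first.
  - by apply: bounded_measD; apply: bounded_measM => //; [exact: bounded_meas_cos|exact: bounded_meas_sin].
  - exact: bounded_measZ.
  apply: eq_circle_int => x hx; rewrite -{1}[ga x](subrK (ga 0)) (mulrDl (ga x - ga 0)); congr (_ + _).
  rewrite KE // -mulrA -(sumE (fun k => cos (k.+1%:R * x))) dirichlet_cos; ring.
rewrite (_ : (fun N => _) = (fun N => circle_int (fun x => (K x * sin (2^-1 * x)) * cos (N%:R * x)) +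
    circle_int (fun x => (K x * cos (2^-1 * x)) * sin (N%:R * x)) + pi * ga 0)); last by apply/funext.
rewrite -[X in _ --> X]add0r; apply: cvgD; last exact: cvg_cst.
rewrite -[X in _ --> X]add0r; apply: cvgD; first exact: riemann_lebesgue_cos.
exact: riemann_lebesgue_sin.
Qed.

Lemma dirichlet_cvg_sin : cvgn (fun N => \sum_(k < N) circle_int (fun x => ga x * sin (k.+1%:R * x))).
Proof.
have b1 : bounded_meas (fun x => K x * sin (2^-1 * x)) by exact: bounded_measM.
have b2 : bounded_meas (fun x => K x * cos (2^-1 * x)) by exact: bounded_measM.
have sumE (F : nat -> R) N : \sum_(k < N) F k = \sum_(k <- iota 0 N) F k.
  by rewrite -(big_mkord xpredT F) /index_iota subn0.
have bg : bounded_meas (fun x => ga x - ga 0) by apply: bounded_measB => //; exact: bounded_meas_cst.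
have E N : \sum_(k < N) circle_int (fun x => ga x * sin (k.+1%:R * x)) =
    circle_int (fun x => K x * cos (2^-1 * x)) -
    (circle_int (fun x => (K x * cos (2^-1 * x)) * cos (N%:R * x)) -
    circle_int (fun x => (K x * sin (2^-1 * x)) * sin (N%:R * x))).
  have c1 := bounded_measM b2 (bounded_meas_cos N%:R).
  have c2 := bounded_measM b1 (bounded_meas_sin N%:R).
  rewrite -circle_intB // -circle_intB //; last exact: bounded_measB.
  transitivity (\sum_(k < N) circle_int (fun x => (ga x - ga 0) * sin (k.+1%:R * x))).
    apply: eq_bigr => k _.
    rewrite [RHS](@eq_circle_int _ _ (fun x => ga x * sin (k.+1%:R * x) - ga 0 * sin (k.+1%:R * x))); last first.
      by move=> x _; rewrite mulrBl.
    have bsk := bounded_meas_sin (k.+1%:R : R).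
    rewrite circle_intB; [|exact: bounded_measM|exact: bounded_measZ].
    by rewrite circle_intZ // circle_int_sin mulr0 subr0.
  rewrite (sumE (fun k => circle_int (fun x => (ga x - ga 0) * sin (k.+1%:R * x)))) -circle_int_sum => [|k]; last by apply: bounded_measM => //; exact: bounded_meas_sin.
  apply: eq_circle_int => x hx; rewrite -mulr_sumr KE // -mulrA -(sumE (fun k => sin (k.+1%:R * x))) dirichlet_sin; ring.
rewrite (_ : (fun N => _) = (fun N => circle_int (fun x => K x * cos (2^-1 * x)) -
    (circle_int (fun x => (K x * cos (2^-1 * x)) * cos (N%:R * x)) -
    circle_int (fun x => (K x * sin (2^-1 * x)) * sin (N%:R * x))))); last by apply/funext.
apply/cvg_ex; eexists; apply: cvgB; first exact: cvg_cst.
by apply: cvgB; [exact: riemann_lebesgue_cos|exact: riemann_lebesgue_sin].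
Qed.

End Dirichlet.

(** * Unfolding the Gamma integral *)

Section Unfolding.
Context {R : realType}.
Local Notation mu := (@lebesgue_measure R).
Variables (h S T Th : R -> R) (d x : R).
Hypotheses (d0 : 0 < d) (ch : forall u : R, 0 < u -> {for u, continuous h}).
Hypotheses (h0 : forall u, 0 < u -> 0 <= h u) (cTh : continuous Th) (Th0 : forall y, 0 <= Th y).
Hypothesis Thd : forall y, Th (y + d) = Th y.
Hypothesis hS : forall z, 0 < z -> series (fun i => h (expR (- (i%:R * d)) * z)) n @[n --> \oo] --> S z.
Hypothesis hT : forall z, 0 < z -> series (fun i => h (expR (i.+1%:R * d) * z)) n @[n --> \oo] --> T z.

Let kap : R := d / (2 * pi).
Let kap0 : 0 < kap. Proof. by rewrite divr_gt0 // mulr_gt0 // pi_gt0. Qed.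
Let F (u : R) : R := h u / u * Th (ln u).
(** Coordinates on the n-th fundamental domain of multiplication by exp d on the positive half-line;
    the intervals [J n] are half-open so that they tile it. *)
Let E (n : int) (phi : R) : R := expR (x + kap * phi + n%:~R * d).

Let Th_shift (n : int) y : Th (y + n%:~R * d) = Th y.
Proof.
have nat_shift (k : nat) z : Th (z + k%:R * d) = Th z.
  elim: k => [|k IH]; first by rewrite mul0r addr0.
  by rewrite -natr1 mulrDl mul1r addrA Thd.
case: n => k; first exact: nat_shift.
by rewrite NegzE rmorphN /= mulNr -[LHS](nat_shift k.+1) subrK.
Qed.

Let F_ge0 u : 0 < u -> 0 <= F u.
Proof. by move=> u0; rewrite /F !mulr_ge0 ?h0 ?invr_ge0 ?(ltW u0). Qed.

Let cF (u : R) : 0 < u -> {for u, continuous F}.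
Proof.
move=> u0; apply: cvgM.
  by apply: cvgM; [exact: ch|apply: cvgV; [rewrite gt_eqF|exact: cvg_id]].
by apply: (continuous_comp (continuous_ln u0)); exact: cTh.
Qed.

Let mF : measurable_fun (`]0, +oo[%classic : set R) F.
Proof.
apply: open_continuous_measurable_fun; first exact: interval_open.
by move=> u; rewrite inE /= in_itv /= andbT => u0; exact: cF.
Qed.

Let dE n (phi : R) : is_derive phi 1 (E n) (kap * E n phi).
Proof.
have hg : is_derive phi 1 (fun y : R => x + kap * y + n%:~R * d) kap.
  apply: is_derive_conv (is_deriveD (is_deriveD (is_derive_cst x phi 1)
    (is_deriveZ kap (is_derive_id phi 1))) (is_derive_cst (n%:~R * d) phi 1)) _ _ => //.
  by rewrite add0r addr0 /GRing.scale /= mulr1.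
have hh := @is_derive1_comp R expR _ phi _ _ (is_derive_expR _) hg.
by apply: is_derive_conv hh _ _ => //; rewrite mulrC.
Qed.

Let cE n : continuous (E n).
Proof. by move=> phi; apply/differentiable_continuous/derivable1_diffP; have [] := dE n phi. Qed.

Let E_gt0 n phi : 0 < E n phi. Proof. exact: expR_gt0. Qed.

Let J (n : int) : set R := `[E n (- pi), E n pi[%classic.

Let J_ln n u : J n u <-> 0 < u /\ x - d / 2 + n%:~R * d <= ln u < x + d / 2 + n%:~R * d.
Proof.
have pin : pi != 0 :> R by rewrite gt_eqF // pi_gt0.
have e1 : x + kap * (- pi) + n%:~R * d = x - d / 2 + n%:~R * d.
  by rewrite /kap; move: (pi) pin => q qn; field.
have e2 : x + kap * pi + n%:~R * d = x + d / 2 + n%:~R * d.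
  by rewrite /kap; move: (pi) pin => q qn; field.
rewrite /J /= in_itv /= /E e1 e2; split.
  move=> /andP[h1 h2]; have u0 : 0 < u by apply: lt_le_trans h1; exact: expR_gt0.
  by rewrite -ler_expR -ltr_expR lnK ?posrE // h1 h2.
by move=> [u0]; rewrite -ler_expR -ltr_expR lnK ?posrE.
Qed.

Let J_inj n k u : J n u -> J k u -> n = k.
Proof.
move=> /J_ln [_ /andP[n1 n2]] /J_ln [_ /andP[k1 k2]].
have E1 (i : int) : (i + 1)%:~R * d = i%:~R * d + d by rewrite rmorphD rmorph1 mulrDl mul1r.
have : n%:~R * d < (k + 1)%:~R * d by rewrite E1; lra.
have : k%:~R * d < (n + 1)%:~R * d by rewrite E1; lra.
by rewrite !ltr_pM2r // !ltr_int; lia.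
Qed.

Let J_cover u : 0 < u -> exists n, J n u.
Proof.
move=> u0; exists (Num.floor ((ln u - x + d / 2) / d)); apply/J_ln; split => //.
have h1 := floor_le ((ln u - x + d / 2) / d); have h2 := floorD1_gt ((ln u - x + d / 2) / d).
move: (Num.floor _) h1 h2 => k; rewrite ler_pdivlMr // ltr_pdivrMr // rmorphD rmorph1 mulrDl mul1r => h1 h2.
by apply/andP; split; lra.
Qed.

Let piece n : (\int[mu]_(u in J n) (F u)%:E =
  \int[mu]_(phi in `[(- pi)%R, pi%R]) (kap * (h (E n phi) * Th (x + kap * phi)))%:E)%E.
Proof.
have pp : - pi < pi :> R by rewrite gtrN // pi_gt0.
have dEE : derive1 (E n) = (fun phi => kap * E n phi).
  by apply/funext => phi; rewrite derive1E; have [_ ->] := dE n phi.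
have cdE : continuous (fun phi => kap * E n phi).
  by move=> phi; apply: cvgM; [exact: cvg_cst|exact: cE].
rewrite /J integral_itv_bndo_bndc; last first.
  apply/measurable_EFinP; apply: measurable_funS mF => //.
  move=> u /=; rewrite !in_itv /= andbT => /andP[u1 _].
  by apply: lt_le_trans u1; exact: E_gt0.
rewrite (@integration_by_substitution_increasing R (E n) F) ?(ltW pp) //.
- apply: eq_integral => phi _; congr (_%:E); rewrite dEE.
  rewrite -[LHS]/(F (E n phi) * (kap * E n phi)) /F {3}/E expRK -(Th_shift n (x + kap * phi)).
  by field; rewrite gt_eqF.
- move=> a b _ _ ab; rewrite ltr_expR ltrD2r ltrD2l ltr_pM2l //.
- by rewrite dEE => phi _; exact: cdE.
- by rewrite dEE; apply/cvg_ex; eexists; apply: cvg_at_right_filter; exact: cdE.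
- by rewrite dEE; apply/cvg_ex; eexists; apply: cvg_at_left_filter; exact: cdE.
- split; first by move=> phi _; have [] := dE n phi.
    by apply: cvg_at_right_filter; exact: cE.
  by apply: cvg_at_left_filter; exact: cE.
- apply: continuous_in_subspaceT => u; rewrite inE /= in_itv /= => /andP[u1 _].
  by apply: cF; apply: lt_le_trans u1; exact: E_gt0.
Qed.

Let E_nat (phi : R) (n : int) : E n phi = expR (n%:~R * d) * E 0 phi.
Proof. by rewrite /E mul0r addr0 -expRD addrC. Qed.

Let mpiece n : measurable_fun (`[- pi, pi]%classic : set R)
  (fun phi => (kap * (h (E n phi) * Th (x + kap * phi)))%:E).
Proof.
apply/measurable_EFinP; apply: measurable_funTS; apply: continuous_measurable_fun => phi.
apply: cvgM; first exact: cvg_cst.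
apply: cvgM; first by apply: (continuous_comp (@cE n phi)); exact: ch.
apply: (@continuous_comp _ _ _ (fun y => x + kap * y) Th); last exact: cTh.
by apply: cvgD; [exact: cvg_cst|apply: cvgM; [exact: cvg_cst|exact: cvg_id]].
Qed.

Let family (s : nat -> int) (G : R -> R) : injective s ->
  (forall phi, series (fun i => h (E (s i) phi)) n @[n --> \oo] --> G phi) ->
  (\int[mu]_(u in \bigcup_i J (s i)) (F u)%:E =
   \int[mu]_(phi in `[(- pi)%R, pi%R]) (kap * (G phi * Th (x + kap * phi)))%:E)%E.
Proof.
move=> sinj hG.
have JS : \bigcup_i J (s i) `<=` `]0, +oo[.
  by move=> u [i _ /J_ln [u0 _]]; rewrite /= in_itv /= u0.
rewrite ge0_integral_bigcup; last 4 first.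
- by move=> i; exact: measurable_itv.
- by apply/measurable_EFinP; apply: measurable_funS mF.
- by move=> u /JS; rewrite /= in_itv /= andbT => u0; rewrite lee_fin F_ge0.
- apply/trivIsetP => i j _ _ ij; rewrite -subset0 => u [/J_inj hi /hi] /sinj ji.
  by rewrite ji eqxx in ij.
rewrite (eq_eseriesr (fun i _ => piece (s i))) -integral_nneseries //; last 2 first.
- by move=> i; exact: mpiece.
- move=> i phi _; rewrite lee_fin; apply: mulr_ge0; first exact: ltW.
  by apply: mulr_ge0 => //; apply: h0; exact: E_gt0.
apply: eq_integral => phi _.
have hc : series (fun i => kap * (h (E (s i) phi) * Th (x + kap * phi))) n @[n --> \oo] -->
    kap * (G phi * Th (x + kap * phi)).
  rewrite (_ : series _ = (fun n => kap * (series (fun i => h (E (s i) phi)) n * Th (x + kap * phi)))).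
    by apply: cvgM; [exact: cvg_cst|apply: cvgM; [exact: hG|exact: cvg_cst]].
  by apply/funext => n; rewrite /series /= mulr_suml mulr_sumr.
rewrite -(cvg_lim (@Rhausdorff R) hc) -EFin_lim; last by apply/cvg_ex; eexists; exact: hc.
by congr (limn _); apply/funext => n; rewrite /= sumEFin.
Qed.

(** On each tile du / u becomes kap dphi, and the periodic factor does not see n, so the sum over
    the tiles acts on [h] alone. Nonnegativity justifies the exchange of sum and integral without
    integrability. *)
Lemma unfold_integral :
  (\int[mu]_(u in `]0%R, +oo[%classic) (h u / u * Th (ln u))%:E =
   \int[mu]_(phi in `[(- pi)%R, pi%R]) (kap * ((S (expR (x + kap * phi)) + T (expR (x + kap * phi))) * Th (x + kap * phi)))%:E)%E.
Proof.
(* The tiles with n <= 0 produce the series of [hS], those with n > 0 the series of [hT]. *)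
pose s1 (i : nat) : int := - i%:Z; pose s2 (i : nat) : int := i.+1%:Z.
have cover : `]0, +oo[%classic = (\bigcup_i J (s1 i)) `|` (\bigcup_i J (s2 i)).
  apply/seteqP; split => u /=; last first.
    by case => [[i _ /J_ln [u0 _]]|[i _ /J_ln [u0 _]]]; rewrite in_itv /= u0.
  rewrite in_itv /= andbT => /J_cover [[[|n]|n] hn].
  - by left; exists 0%N.
  - by right; exists n.
  - by left; exists n.+1 => //; rewrite /s1 -NegzE.
have E0 phi : E 0 phi = expR (x + kap * phi) by rewrite /E mul0r addr0.
have H1 phi : series (fun i => h (E (s1 i) phi)) n @[n --> \oo] --> S (expR (x + kap * phi)).
  have := hS (expR_gt0 (x + kap * phi)).
  rewrite (_ : series (fun i => h (E (s1 i) phi)) = series (fun i => h (expR (- (i%:R * d)) * expR (x + kap * phi)))) //.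
  by congr series; apply/funext => i; rewrite E_nat E0 /s1 rmorphN /= mulNr.
have H2 phi : series (fun i => h (E (s2 i) phi)) n @[n --> \oo] --> T (expR (x + kap * phi)).
  have := hT (expR_gt0 (x + kap * phi)).
  rewrite (_ : series (fun i => h (E (s2 i) phi)) = series (fun i => h (expR (i.+1%:R * d) * expR (x + kap * phi)))) //.
  by congr series; apply/funext => i; rewrite E_nat E0.
have ms (s : nat -> int) : measurable (\bigcup_i J (s i)) by apply: bigcupT_measurable => i; exact: measurable_itv.
rewrite cover ge0_integral_setU //; last 5 first.
- exact: ms.
- exact: ms.
- by apply/measurable_EFinP; rewrite -cover.
- by move=> u; rewrite -cover /= in_itv /= andbT => u0; rewrite lee_fin; exact: F_ge0.
- apply/disj_setPS => u [[i _ hi] [j _ hj]]; have := J_inj hi hj; rewrite /s1 /s2; lia.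
rewrite (family _ H1); last by move=> i j; rewrite /s1; lia.
rewrite (family _ H2); last by move=> i j; rewrite /s2; lia.
have pos (s : nat -> int) G phi : series (fun i => h (E (s i) phi)) n @[n --> \oo] --> G phi -> 0 <= G phi.
  move=> hG; rewrite -(cvg_lim (@Rhausdorff R) hG); apply: limr_ge; first by apply/cvg_ex; eexists; exact: hG.
  by exists 0%N => // n _; apply: sumr_ge0 => i _; apply: h0; exact: E_gt0.
have meas (s : nat -> int) (G : R -> R) : (forall phi, series (fun i => h (E (s i) phi)) n @[n --> \oo] --> G phi) ->
    measurable_fun (`[- pi, pi]%classic : set R) (fun phi => (kap * (G phi * Th (x + kap * phi)))%:E).
  move=> hG; apply/measurable_EFinP.
  apply: (measurable_fun_cvg (h := fun n phi => kap * (series (fun i => h (E (s i) phi)) n * Th (x + kap * phi)))).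
    move=> n; rewrite (_ : (fun phi => _) = (fun phi => \sum_(0 <= i < n) kap * (h (E (s i) phi) * Th (x + kap * phi)))).
      by apply: measurable_sum => i; apply/measurable_EFinP; exact: mpiece.
    by apply/funext => phi; rewrite /series /= mulr_suml mulr_sumr.
  by move=> phi _; apply: cvgM; [exact: cvg_cst|apply: cvgM; [exact: hG|exact: cvg_cst]].
have nn (s : nat -> int) (G : R -> R) phi : series (fun i => h (E (s i) phi)) n @[n --> \oo] --> G phi ->
    (0 <= (kap * (G phi * Th (x + kap * phi)))%:E)%E.
  by move=> hG; rewrite lee_fin; apply: mulr_ge0; [exact: ltW|apply: mulr_ge0 => //; apply: (pos s)].
rewrite -ge0_integralD //.
- by apply: eq_integral => phi _; rewrite -EFinD; congr (_%:E); rewrite mulrDl mulrDr.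
- by move=> phi _; exact: (nn s1 (fun phi => S (expR (x + kap * phi)))).
- exact: (meas s1 (fun phi => S (expR (x + kap * phi)))).
- by move=> phi _; exact: (nn s2 (fun phi => T (expR (x + kap * phi)))).
- exact: (meas s2 (fun phi => T (expR (x + kap * phi)))).
Qed.

End Unfolding.

(** * Fourier coefficients of the orbit sum *)

Section ProfileFourier.
Context {R : realType}.
Local Notation mu := (@lebesgue_measure R).
Variables (p d x : R) (m a b : nat).
Hypotheses (p0 : 0 < p) (p1 : p < 1) (m2 : (1 < m)%N) (d0 : 0 < d) (a0 : (0 < a)%N).
Hypotheses (ab : coprime a b) (pE : p = expR (- d) ^+ a) (qE : 1 - p = expR (- d) ^+ b).

Let rho0 : 0 < expR (- d) :> R. Proof. exact: expR_gt0. Qed.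
Let rho1 : expR (- d) < 1 :> R. Proof. by rewrite expR_lt1 oppr_lt0. Qed.
Let kap : R := d / (2 * pi).
Let kap0 : 0 < kap. Proof. by rewrite divr_gt0 // mulr_gt0 // pi_gt0. Qed.
Let G y := profile p (expR (- d)) m a b (expR y).

Let G_lip : exists2 C : R, 0 <= C & forall y z : R, `|G y - G z| <= C * `|y - z|.
Proof.
have [C C0 hC] := profile_lip p0 p1 m2 rho0 rho1 a0 ab pE qE.
exists (2 * C); first by rewrite mulr_ge0.
have small (y s : R) : 0 <= s -> s <= ln 2 -> `|G (y + s) - G y| <= 2 * C * s.
  move=> s0 s2; have e2 : expR s <= 2 by rewrite -[leRHS]lnK ?posrE // ler_expR.
  have e1 : 1 <= expR s by rewrite -expR0 ler_expR.
  have e3 : expR s - 1 <= s * expR s.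
    have := expR_ge1Dx (- s); rewrite -(ler_pM2r (expR_gt0 s)) -expRD addNr expR0; lra.
  rewrite /G expRD mulrC; apply: (le_trans (hC _ _ _ (expR_gt0 y))); first by rewrite e1 e2.
  rewrite [2 * C]mulrC -mulrA ler_wpM2l //; apply: (le_trans e3).
  by rewrite mulrC ler_wpM2r.
have l2 : 0 < ln 2 :> R by rewrite ln_gt0 // ltr1n.
(* The Lipschitz bound of [profile] covers ratios up to 2; larger shifts are chained in steps of ln
   2. *)
have large n : forall y s : R, 0 <= s -> s <= n%:R * ln 2 -> `|G (y + s) - G y| <= 2 * C * s.
  elim: n => [|n IH] y s s0 sn.
    by apply: small => //; apply: (le_trans sn); rewrite mul0r ltW.
  have [s2|s2] := leP s (ln 2); first exact: small.
  have h1 : `|G (y + ln 2 + (s - ln 2)) - G (y + ln 2)| <= 2 * C * (s - ln 2).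
    apply: IH; first by lra.
    by move: sn; rewrite -[n.+1%:R]natr1 mulrDl mul1r; lra.
  have h2 := small y (ln 2) (ltW l2) (lexx _).
  have -> : y + s = y + ln 2 + (s - ln 2) by ring.
  have -> : 2 * C * s = 2 * C * (s - ln 2) + 2 * C * ln 2 by ring.
  by apply: (le_trans (ler_distD (G (y + ln 2)) _ _)); rewrite lerD.
have all_s (y s : R) : 0 <= s -> `|G (y + s) - G y| <= 2 * C * s.
  move=> s0; apply: (large (Num.truncn (s / ln 2)).+1) => //.
  by rewrite -ler_pdivrMr // ltW // truncnS_gt.
move=> y z; have [yz|zy] := leP z y.
  by have := all_s z (y - z); rewrite [z + _]addrC subrK subr_ge0 => /(_ yz); rewrite [`|y - z|]ger0_norm ?subr_ge0.
have := all_s y (z - y); rewrite [y + _]addrC subrK subr_ge0 distrC => /(_ (ltW zy)).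
by rewrite [`|y - z|]distrC [`|z - y|]ger0_norm // subr_ge0 ltW.
Qed.

Definition profile_circle (phi : R) : R := G (x + kap * phi).
Local Notation ga := profile_circle.

Lemma profile_circle_lip : exists2 C : R, 0 <= C & forall u v : R, `|ga u - ga v| <= C * `|u - v|.
Proof.
have [C C0 hC] := G_lip; exists (C * kap); first by rewrite mulr_ge0 // ltW.
move=> u v; apply: (le_trans (hC _ _)).
have -> : x + kap * u - (x + kap * v) = kap * (u - v) by ring.
by rewrite normrM (gtr0_norm kap0) mulrA.
Qed.

Lemma profile_circle_continuous : continuous ga.
Proof.
have [C C0 hC] := profile_circle_lip; move=> u; apply/cvgrPdist_lt => e e0.
near=> v; apply: (le_lt_trans (hC u v)).
apply: (@le_lt_trans _ _ ((C + 1) * `|u - v|)); first by rewrite ler_wpM2r // lerDl.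
rewrite mulrC -ltr_pdivlMr ?ltr_wpDl //; near: v.
by apply: cvgr_dist_lt; [exact: cvg_id|rewrite divr_gt0 // ltr_wpDl].
Unshelve. all: by end_near. Qed.

Lemma bounded_meas_profile : bounded_meas ga.
Proof.
have [C C0 hC] := profile_circle_lip.
apply: (bounded_meas_cont (C := C * pi + `|ga 0|) profile_circle_continuous) => u /andP[u1 u2].
rewrite -[ga u](subrK (ga 0)); apply: (le_trans (ler_normD _ _)); rewrite lerD2r.
apply: (le_trans (hC _ _)); rewrite ler_wpM2l // subr0 ler_norml; apply/andP; split; lra.
Qed.

Let c_hump (u : R) : 0 < u -> {for u, continuous (hump m : R -> R)}.
Proof.
move=> u0; apply: cvgM; last by apply: cvgV; [rewrite gt_eqF|exact: cvg_id].
apply: cvgM; first exact: exprn_continuous.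
by apply: (@continuous_comp _ _ _ (fun y => - y) expR); [exact: opp_continuous|exact: continuous_expR].
Qed.

Let weight (u : R) := u ^+ (m - 2) * expR (- u).

Let humpE (u : R) : 0 < u -> hump m u / u = weight u.
Proof.
move=> u0; rewrite /hump /toll_fun /weight.
have {1}-> : m = (m - 2).+2 by move: m2; lia.
by rewrite 2!exprS; field; rewrite gt_eqF.
Qed.

Section TestFunction.
Variables (f : R -> R).
Hypotheses (cf : continuous f) (fd : forall y, f (y + d) = f y).

Lemma unfold_nonneg (B : R) : (forall y, 0 <= f y <= B) ->
  (\int[mu]_(u in `]0%R, +oo[%classic) (weight u * f (ln u))%:E =
   (kap * circle_int (fun phi => ga phi * f (x + kap * phi)))%:E)%E.
Proof.
move=> fB.
have f0 y : 0 <= f y by have /andP[] := fB y.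
have bf : bounded_meas (fun phi => f (x + kap * phi)).
  apply: (bounded_meas_cont (C := B)) => [phi|phi _].
    apply: (@continuous_comp _ _ _ (fun y => x + kap * y) f); last exact: cf.
    by apply: cvgD; [exact: cvg_cst|apply: cvgM; [exact: cvg_cst|exact: cvg_id]].
  by rewrite ger0_norm //; have /andP[] := fB (x + kap * phi).
have bgf := bounded_measM bounded_meas_profile bf.
pose S (z : R) := \sum_(i < a) p * ratio p m (expR (- d) ^+ i * z) +
  \sum_(i < b) (1 - p) * ratio p m (expR (- d) ^+ i * z).
pose T (z : R) := limn (series (fun i => hump m (z / expR (- d) ^+ i.+1))).
have hS z : 0 < z -> series (fun i => hump m (expR (- (i%:R * d)) * z)) n @[n --> \oo] --> S z.
  move=> z0; have := hump_series_down p0 p1 m2 rho0 rho1 pE qE z0.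
  rewrite (_ : (fun i => hump m (expR (- d) ^+ i * z)) = (fun i => hump m (expR (- (i%:R * d)) * z))).
    exact.
  by apply/funext => i; rewrite -expRM_natl mulrN.
have hT z : 0 < z -> series (fun i => hump m (expR (i.+1%:R * d) * z)) n @[n --> \oo] --> T z.
  move=> z0.
  rewrite (_ : (fun i => hump m (expR (i.+1%:R * d) * z)) = (fun i => hump m (z / expR (- d) ^+ i.+1))).
    exact: (hump_series_up m2 rho0 rho1 z0).
  by apply/funext => i; rewrite -expRM_natl mulrN expRN invrK mulrC.
transitivity (\int[mu]_(u in `]0%R, +oo[%classic) (hump m u / u * f (ln u))%:E)%E.
  by apply: eq_integral => u; rewrite inE /= in_itv /= andbT => u0; rewrite humpE.
rewrite (unfold_integral x d0 c_hump (@hump_ge0 _ m) cf f0 fd hS hT).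
rewrite -(circle_intZ _ bgf) /circle_int /Rintegral fineK; last first.
  by apply: integrable_fin_num => //; apply: bounded_meas_integrable; apply: bounded_measZ.
by [].
Qed.

Let cweight : {in `]0, +oo[, continuous weight}.
Proof.
move=> u _; apply: cvgM; first exact: exprn_continuous.
by apply: (@continuous_comp _ _ _ (fun y => - y) expR); [exact: opp_continuous|exact: continuous_expR].
Qed.

(** Integrability is read off the unfolding, whose right side is a real number. *)
Lemma weight_integrable (B : R) : (forall y, 0 <= f y <= B) ->
  mu.-integrable `]0, +oo[ (EFin \o (fun u => weight u * f (ln u))).
Proof.
move=> fB; apply/integrableP; split.
  apply/measurable_EFinP; apply: open_continuous_measurable_fun; first exact: interval_open.
  move=> u; rewrite inE /= => u1; have u0 : 0 < u by move: u1; rewrite in_itv /= andbT.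
  apply: cvgM; first exact: cweight.
  by apply: (continuous_comp (continuous_ln u0)); exact: cf.
have -> : (\int[mu]_(u in `]0%R, +oo[%classic) `|(EFin \o (fun u => weight u * f (ln u))%R) u| =
    \int[mu]_(u in `]0%R, +oo[%classic) (weight u * f (ln u))%:E)%E.
  apply: eq_integral => u; rewrite inE /= in_itv /= andbT => u0; rewrite /= ger0_norm //.
  have /andP[f0 _] := fB (ln u).
  by rewrite !mulr_ge0 ?exprn_ge0 ?expR_ge0 // ltW.
by rewrite (unfold_nonneg fB) ltry.
Qed.

End TestFunction.

Lemma unfold_bounded (f : R -> R) (cf : continuous f) : (forall y, f (y + d) = f y) ->
  (forall y, `|f y| <= 1) ->
  Rintegral mu `]0, +oo[ (fun u => weight u * f (ln u)) =
  kap * circle_int (fun phi => ga phi * f (x + kap * phi)).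
Proof.
move=> fd f1.
(* A function of varying sign is written as [1 + f] minus 1, two nonnegative periodic functions to
   which the unfolding applies. *)
have c1 : continuous (fun y => 1 + f y) by move=> y; apply: cvgD; [exact: cvg_cst|exact: cf].
have d1 y : 1 + f (y + d) = 1 + f y by rewrite fd.
have b1 y : 0 <= 1 + f y <= 2 by have := f1 y; rewrite ler_norml => /andP[? ?]; lra.
have c2 : continuous (fun _ : R => 1 : R) by exact: cst_continuous.
have d2 (y : R) : 1 = 1 :> R by [].
have b2 (y : R) : (0 : R) <= (1 : R) <= 1 by rewrite ler01 lexx.
have i1 := weight_integrable c1 d1 b1; have i2 := weight_integrable c2 d2 b2.
transitivity (Rintegral mu `]0, +oo[ (fun u => weight u * (1 + f (ln u)) - weight u * 1)).
  by apply: eq_Rintegral => u _; ring.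
rewrite RintegralB // /Rintegral (unfold_nonneg c1 d1 b1) (unfold_nonneg c2 d2 b2) /= -mulrBr -circle_intB.
- by congr (_ * _); apply: eq_circle_int => phi _; ring.
- apply: bounded_measM; first exact: bounded_meas_profile.
  apply: (bounded_meas_cont (C := 2)) => [phi|phi _].
    apply: (@continuous_comp _ _ _ (fun y => x + kap * y) (fun y => 1 + f y)); last exact: c1.
    by apply: cvgD; [exact: cvg_cst|apply: cvgM; [exact: cvg_cst|exact: cvg_id]].
  by have /andP[h1 h2] := b1 (x + kap * phi); rewrite ger0_norm.
- by apply: bounded_measM; [exact: bounded_meas_profile|exact: bounded_meas_cst].
Qed.

Local Open Scope complex_scope.

Let tau (k : int) : R := 2 * pi * k%:~R / d.

Let tau_d (g : R -> R) (k : int) y : periodic g (pi *+ 2) -> g (tau k * (y + d)) = g (tau k * y).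
Proof.
move=> gp.
have -> : tau k * (y + d) = tau k * y + k%:~R * (pi *+ 2) by rewrite /tau -mulr_natr; field; rewrite gt_eqF.
case: k => k; first by rewrite mulr_natl periodicn.
by rewrite NegzE rmorphN /= mulNr mulr_natl -[LHS](periodicn gp k.+1) subrK.
Qed.

(** Gamma at m - 1 - i tau integrates u^(m - 2) exp (- u) against exp (- i tau ln u), which is
    d-periodic in ln u. Unfolding yields the k-th Fourier coefficient, and the exponential factor
    undoes the translation by [x]. *)
Lemma fourier_cGamma (k : int) :
  cGamma (m%:R + (- 1 - (tau k)%:C * 'i)) * cexp ((2 * pi * k%:~R * x / d)%:C * 'i) =
  (kap * circle_int (fun phi => ga phi * cos (k%:~R * phi))) +i*
  (- (kap * circle_int (fun phi => ga phi * sin (k%:~R * phi)))).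
Proof.
have zE : m%:R + (- 1 - (tau k)%:C * 'i) - 1 = (m - 2)%:R +i* (- tau k).
  rewrite -(rmorph_nat (real_complex R)).
  (* Complex arithmetic is unfolded by conversion, which leaves identities between real
     coordinates. *)
  rewrite -[LHS]/(Complex (m%:R + (- 1 - (tau k * 0 - 0 * 1)) - 1) (0 + (- 0 - (tau k * 1 + 0 * 0)) - 0)).
  by congr (_ +i* _); [rewrite natrB //|]; ring.
have wE (u : R) : 0 < u -> expR ((m - 2)%:R * ln u) = u ^+ (m - 2) by move=> u0; rewrite expRM_natl lnK ?posrE.
set A := circle_int (fun phi => ga phi * cos (tau k * (x + kap * phi))).
set B := circle_int (fun phi => ga phi * sin (tau k * (x + kap * phi))).
have abs_cos (y : R) : `|cos y| <= 1 by rewrite ler_norml cos_geN1 cos_le1.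
have abs_sin (y : R) : `|sin y| <= 1 by rewrite ler_norml sin_geN1 sin_le1.
have cang (g : R -> R) : continuous g -> (forall y, `|g y| <= 1) ->
    bounded_meas (fun phi => ga phi * g (tau k * (x + kap * phi))).
  move=> cg g1; apply: bounded_measM; first exact: bounded_meas_profile.
  apply: (bounded_meas_cont (C := 1)) => // phi.
  apply: (@continuous_comp _ _ _ (fun y => tau k * (x + kap * y)) g); last exact: cg.
  apply: cvgM; first exact: cvg_cst.
  by apply: cvgD; [exact: cvg_cst|apply: cvgM; [exact: cvg_cst|exact: cvg_id]].
have bA := cang _ (@continuous_cos R) abs_cos.
have bB := cang _ (@continuous_sin R) abs_sin.
have cgE : cGamma (m%:R + (- 1 - (tau k)%:C * 'i)) = (kap * A) +i* (- (kap * B)).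
  rewrite /cGamma; congr (_ +i* _).
    rewrite -(@unfold_bounded (fun y => cos (tau k * y))).
    - apply: eq_Rintegral => u; rewrite inE /= in_itv /= andbT => u0.
      rewrite /cpow zE /weight -(wE _ u0).
      rewrite -[LHS]/((expR ((m - 2)%:R * ln u - (- tau k) * 0) * cos ((m - 2)%:R * 0 + (- tau k) * ln u)) * expR (- u)
        - (expR ((m - 2)%:R * ln u - (- tau k) * 0) * sin ((m - 2)%:R * 0 + (- tau k) * ln u)) * 0).
      by rewrite !mulr0 !subr0 add0r mulNr cosN; ring.
    - exact: continuous_cosM.
    - by move=> y; rewrite tau_d //; exact: cosD2pi.
    - by move=> y; exact: abs_cos.
  have -> : - (kap * B) = kap * circle_int (fun phi => ga phi * - sin (tau k * (x + kap * phi))).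
    rewrite -mulrN -mulN1r -(circle_intZ _ bB); congr (_ * _).
    by apply: eq_circle_int => phi _; ring.
  rewrite -(@unfold_bounded (fun y => - sin (tau k * y))).
  - apply: eq_Rintegral => u; rewrite inE /= in_itv /= andbT => u0.
    rewrite /cpow zE /weight -(wE _ u0).
    rewrite -[LHS]/((expR ((m - 2)%:R * ln u - (- tau k) * 0) * cos ((m - 2)%:R * 0 + (- tau k) * ln u)) * 0
      + (expR ((m - 2)%:R * ln u - (- tau k) * 0) * sin ((m - 2)%:R * 0 + (- tau k) * ln u)) * expR (- u)).
    by rewrite !mulr0 !subr0 !add0r mulNr sinN; ring.
  - by move=> y; apply: cvgN; exact: continuous_sinM.
  - by move=> y; rewrite tau_d //; exact: sinD2pi.
  - by move=> y; rewrite normrN; exact: abs_sin.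
have pin : pi != 0 :> R by rewrite gt_eqF // pi_gt0.
have dn : d != 0 by rewrite gt_eqF.
have tE : 2 * pi * k%:~R * x / d = tau k * x by rewrite /tau; field.
have angle phi : tau k * (x + kap * phi) = tau k * x + k%:~R * phi.
  by rewrite /tau /kap; move: (pi) pin => q qn; field; rewrite ?qn ?dn.
rewrite cgE tE; set c := tau k * x.
rewrite -[LHS]/(Complex (kap * A * (expR (c * 0 - 0 * 1) * cos (c * 1 + 0 * 0)) - - (kap * B) * (expR (c * 0 - 0 * 1) * sin (c * 1 + 0 * 0)))
  (kap * A * (expR (c * 0 - 0 * 1) * sin (c * 1 + 0 * 0)) + - (kap * B) * (expR (c * 0 - 0 * 1) * cos (c * 1 + 0 * 0)))).
rewrite !mulr0 mul0r subr0 mulr1 addr0 expR0 !mul1r.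
have -> : circle_int (fun phi => ga phi * cos (k%:~R * phi)) = cos c * A + sin c * B.
  rewrite -!circle_intZ // -circle_intD; [|exact: bounded_measZ..].
  apply: eq_circle_int => phi _; rewrite angle cosD sinD -/c.
  transitivity ((cos c ^+ 2 + sin c ^+ 2) * (ga phi * cos (k%:~R * phi))); last by ring.
  by rewrite cos2Dsin2 mul1r.
have -> : circle_int (fun phi => ga phi * sin (k%:~R * phi)) = cos c * B - sin c * A.
  rewrite -!circle_intZ // -circle_intB; [|exact: bounded_measZ..].
  apply: eq_circle_int => phi _; rewrite angle cosD sinD -/c.
  transitivity ((cos c ^+ 2 + sin c ^+ 2) * (ga phi * sin (k%:~R * phi))); last by ring.
  by rewrite cos2Dsin2 mul1r.
by congr (_ +i* _); ring.
Qed.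

End ProfileFourier.

Local Open Scope complex_scope.

(** * Coordinatewise limits and Gamma at integers *)

Section ComplexLimits.
Context {R : realType}.

Lemma cvg_complex (u v : nat -> R) (a b : R) :
  u n @[n --> \oo] --> a -> v n @[n --> \oo] --> b ->
  (u n +i* v n : R[i]^o) @[n --> \oo] --> (a +i* b : R[i]^o).
Proof.
move=> ua vb; apply/cvgrPdist_lt => eps; rewrite ltcE => /andP[/eqP e1 e0].
have e2 : 0 < complex.Re eps / 2 by rewrite divr_gt0.
near=> n.
have h1 : `|a - u n| < complex.Re eps / 2 by near: n; exact: cvgr_dist_lt.
have h2 : `|b - v n| < complex.Re eps / 2 by near: n; exact: cvgr_dist_lt.
rewrite normc_def ltcE /= e1 eqxx /=.
apply: (@le_lt_trans _ _ (`|a - u n| + `|b - v n|)); last by lra.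
rewrite -[leRHS]ger0_norm ?addr_ge0 // -sqrtr_sqr ler_wsqrtr //.
rewrite -(real_normK (num_real (a - u n))) -(real_normK (num_real (b - v n))).
by have := mulr_ge0 (normr_ge0 (a - u n)) (normr_ge0 (b - v n)); nra.
Unshelve. all: by end_near. Qed.

Lemma series_complex (u v : nat -> R) :
  series (fun n => u n +i* v n : R[i]^o) = (fun n => series u n +i* series v n : R[i]^o).
Proof.
apply/funext => n; rewrite /series /=; elim: n => [|n IH]; first by rewrite !big_nil.
by rewrite !big_nat_recr //= IH.
Qed.

Lemma lim_complex (u v : nat -> R) (a b : R) :
  u n @[n --> \oo] --> a -> v n @[n --> \oo] --> b ->
  limn (fun n => u n +i* v n : R[i]^o) = a +i* b.
Proof. by move=> ua vb; apply/cvg_lim; [exact: norm_hausdorff|exact: cvg_complex]. Qed.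

Lemma cGamma_nat n : cGamma (n.+2%:R - 1 : R[i]) = n`!%:R.
Proof.
have zE : n.+2%:R - 1 - 1 = n%:R +i* 0 :> R[i].
  rewrite -(rmorph_nat (real_complex R)) -[LHS]/(Complex (n.+2%:R - 1 - 1) (0 - 0 - 0)).
  by congr (_ +i* _); rewrite -?[n.+2]addn2 ?natrD; ring.
rewrite -(rmorph_nat (real_complex R) n`!) -[RHS]/(n`!%:R +i* 0) /cGamma; congr (_ +i* _).
  transitivity (Rintegral lebesgue_measure `]0, +oo[ (fun u : R => u ^+ n * expR (- u))).
    apply: eq_Rintegral => u; rewrite inE /= in_itv /= andbT => u0; rewrite /cpow zE.
    rewrite -[LHS]/((expR (n%:R * ln u - 0 * 0) * cos (n%:R * 0 + 0 * ln u)) * expR (- u)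
      - (expR (n%:R * ln u - 0 * 0) * sin (n%:R * 0 + 0 * ln u)) * 0).
    by rewrite !mulr0 mul0r addr0 !subr0 cos0 mulr1 expRM_natl lnK.
  have c0 (u : R) : {for u, continuous (fun u : R => u ^+ n * expR (- u))}.
    apply: cvgM; first exact: exprn_continuous.
    by apply: (@continuous_comp _ _ _ (fun y => - y) expR); [exact: opp_continuous|exact: continuous_expR].
  have F0 : igamma n (0 : R) = 0.
    elim: (n) => [|k IH] /=; first by rewrite oppr0 expR0 subrr.
    by rewrite IH mulr0 expr0n /= mul0r subrr.
  rewrite /Rintegral integral_itv_obnd_cbnd.
    rewrite (@ge0_continuous_FTC2y _ _ (igamma n) 0 n`!%:R) ?F0 ?sube0 //.
    - by move=> u u0; rewrite mulr_ge0 ?exprn_ge0 ?expR_ge0.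
    - by apply: continuous_subspaceT.
    - exact: igamma_cvg.
    - by move=> u _; have [] := is_derive_igamma n u.
    - apply: cvg_at_right_filter; rewrite -[X in _ --> X]F0.
      by apply/differentiable_continuous/derivable1_diffP; have [] := is_derive_igamma n (0 : R).
    - by move=> u _; rewrite derive1E; have [_ ->] := is_derive_igamma n u.
  by apply/measurable_EFinP; apply: measurable_funTS; apply: continuous_measurable_fun.
rewrite (eq_Rintegral _ (g := fun=> 0)); first by rewrite /Rintegral integral0.
move=> u; rewrite inE /= in_itv /= andbT => u0; rewrite /cpow zE.
rewrite -[LHS]/((expR (n%:R * ln u - 0 * 0) * cos (n%:R * 0 + 0 * ln u)) * 0
      + (expR (n%:R * ln u - 0 * 0) * sin (n%:R * 0 + 0 * ln u)) * expR (- u)).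
by rewrite !mulr0 mul0r addr0 sin0 mulr0 mul0r addr0.
Qed.

End ComplexLimits.

(** * Closed forms of [psiE] *)

Section FluctuationFunction.
Context {R : realType}.

Lemma periodic_span (p : R) : 0 < p -> p < 1 -> ~ aperiodic p ->
  exists a b : nat, [/\ 0 < log_span p, (0 < a)%N, coprime a b,
    p = expR (- log_span p) ^+ a & 1 - p = expR (- log_span p) ^+ b].
Proof.
move=> p0 p1 np; have q0 : 0 < 1 - p by rewrite subr_gt0.
have lp : ln p < 0 by rewrite ln_lt0 // p0 p1.
have lq : ln (1 - p) < 0 by rewrite ln_lt0 // q0 gtrBl.
have exr : exists r : rat, log_ratio p = ratr r.
  by apply: contrapT => h; apply: np => r rE; apply: h; exists r.
rewrite /log_span; set r := xget 0 _.
have rE : log_ratio p = ratr r by exact: (@xgetPex _ 0 [set r : rat | log_ratio p = ratr r]).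
have r0 : 0 < r by rewrite -(ltr0q R) -rE /log_ratio nmulr_lgt0 // invr_lt0.
have n0 : 0 < numq r by rewrite numq_gt0.
have nE : (numq r)%:~R = `|numq r|%N%:R :> R by rewrite -[in LHS](gtz0_abs n0).
have dE : (denq r)%:~R = `|denq r|%N%:R :> R by rewrite -[in LHS](gtz0_abs (denq_gt0 r)).
have n1 : 0 < `|numq r|%N%:R :> R by rewrite -nE ltr0z.
have d1 : 0 < `|denq r|%N%:R :> R by rewrite -dE ltr0z denq_gt0.
exists `|numq r|%N, `|denq r|%N; split.
- by rewrite divr_gt0 ?oppr_gt0 // nE.
- by rewrite absz_gt0 gt_eqF.
- exact: coprime_num_den.
- rewrite -expRM_natl nE -[LHS]lnK ?posrE //; congr expR.
  by field; rewrite gt_eqF.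
- rewrite -expRM_natl -[LHS]lnK ?posrE //; congr expR.
  move: rE; rewrite /log_ratio /ratr nE dE => rE.
  have -> : ln p = `|numq r|%N%:R / `|denq r|%N%:R * ln (1 - p).
    by rewrite -rE divfK // lt_eqF.
  by field; rewrite !gt_eqF.
Qed.

Context {d : measure_display} {Omega : measurableType d} {P : probability Omega R}.
Variables (X : nat -> nat -> {RV P >-> bool}) (p : R) (t : bintree).
Hypotheses (p0 : 0 < p) (p1 : p < 1) (m2 : (1 < nleaves t)%N).
Let m := nleaves t.

Lemma psiE_aperiodic x : aperiodic p -> psiE X p t x = (pi_tree X t / m`!%:R * (m - 2)`!%:R)%:C.
Proof.
move=> ap; rewrite /psiE asboolT // /fE -/m.
have -> : m%:R = (m - 2).+2%:R :> R[i] by congr (_%:R); rewrite /m; move: m2; lia.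
by rewrite cGamma_nat -!(rmorph_nat (real_complex R)) -mulrA [_ * _^-1]mulrC mulrA -fmorphV -!rmorphM.
Qed.

Lemma psiE_periodic x (a b : nat) : ~ aperiodic p -> 0 < log_span p -> (0 < a)%N -> coprime a b ->
  p = expR (- log_span p) ^+ a -> 1 - p = expR (- log_span p) ^+ b ->
  psiE X p t x =
  (pi_tree X t / m`!%:R * (log_span p * profile p (expR (- log_span p)) m a b (expR x)))%:C.
Proof.
move=> np; set dd := log_span p => d0 a0 ab pE qE.
rewrite /psiE asboolF // -/dd.
set c := pi_tree X t / m`!%:R; pose kap := dd / (2 * pi).
pose ga := profile_circle p dd x m a b.
pose A (k : int) := circle_int (fun phi => ga phi * cos (k%:~R * phi)).
pose B (k : int) := circle_int (fun phi => ga phi * sin (k%:~R * phi)).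
pose u k := c * kap * A k; pose v k := - (c * kap * B k).
have termE : (fun k : int => fE X t (-1 - (2 * pi * k%:~R / dd)%:C * 'i) *
    cexp ((2 * pi * k%:~R * x / dd)%:C * 'i) : R[i]^o) = (fun k => u k +i* v k : R[i]^o).
  apply/funext => k; rewrite /fE -/m mulrAC -[X in X / _]mulrA.
  rewrite (fourier_cGamma x p0 p1 m2 d0 a0 ab pE qE) -/kap -/ga -/(A k) -/(B k).
  rewrite -(rmorph_nat (real_complex R)) -fmorphV mulrAC -rmorphM -/c.
  rewrite -[LHS]/(Complex (c * (kap * A k) - 0 * - (kap * B k)) (c * - (kap * B k) + 0 * (kap * A k))).
  by congr (_ +i* _); rewrite /u /v; ring.
have [C C0 lipC] := profile_circle_lip x p0 p1 m2 d0 a0 ab pE qE.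
have cga := @profile_circle_continuous _ p dd x _ a b p0 p1 m2 d0 a0 ab pE qE.
have lip0 (phi : R) : - pi <= phi <= pi -> `|ga phi - ga 0| <= C * `|phi|.
  by move=> _; apply: (le_trans (lipC _ _)); rewrite subr0.
have hC := dirichlet_cvg_cos cga C0 lip0; have hS := dirichlet_cvg_sin cga C0 lip0.
have A_even k : A (- k) = A k.
  by apply: eq_circle_int => phi _; rewrite rmorphN /= mulNr cosN.
have B_odd k : B (- k) = - B k.
  rewrite -[RHS]mulN1r /B -circle_intZ; last first.
    apply: bounded_measM; last exact: bounded_meas_sin.
    exact: (bounded_meas_profile x p0 p1 m2 d0 a0 ab pE qE).
  by apply: eq_circle_int => phi _; rewrite rmorphN /= mulNr sinN; ring.
have A0 : A 0 = circle_int ga by apply: eq_circle_int => phi _; rewrite mul0r cos0 mulr1.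
have B0 : B 0 = 0.
  rewrite /B (_ : (fun phi => _) = (fun=> 0)); first by rewrite circle_int_cst mul0r.
  by apply/funext => phi; rewrite mul0r sin0 mulr0.
(* Dirichlet's theorem counts the constant term with weight one half. *)
pose L := pi * ga 0 - 2^-1 * A 0.
have sA : \sum_(k < N) A k.+1%:Z @[N --> \oo] --> L.
  rewrite /L A0 (_ : (fun N => _) = (fun N => (2^-1 * circle_int ga +
    \sum_(k < N) circle_int (fun y => ga y * cos (k.+1%:R * y))) - 2^-1 * circle_int ga)).
    by apply: cvgB; [exact: hC|exact: cvg_cst].
  by apply/funext => N; rewrite addrC addKr.
pose M := limn (fun N => \sum_(k < N) circle_int (fun y => ga y * sin (k.+1%:R * y))).
have sB : \sum_(k < N) B k.+1%:Z @[N --> \oo] --> M by exact: hS.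
have shift (F : int -> R) l : \sum_(k < N) F k.+1%:Z @[N --> \oo] --> l ->
    series (fun k : nat => F k) N @[N --> \oo] --> F 0 + l.
  move=> hF; apply/(cvg_succP (series (fun k : nat => F k))).
  rewrite (_ : (fun N => _) = (fun N => F 0 + \sum_(k < N) F k.+1%:Z)).
    by apply: cvgD; [exact: cvg_cst|exact: hF].
  by apply/funext => N; rewrite /series /= big_mkord big_ord_recl.
have hu1 : series (fun k : nat => u k) N @[N --> \oo] --> c * kap * (A 0 + L).
  rewrite (_ : series _ = (fun N => c * kap * series (fun k : nat => A k) N)).
    by apply: cvgM; [exact: cvg_cst|exact: shift].
  by apply/funext => N; rewrite /series /= mulr_sumr.
have hv1 : series (fun k : nat => v k) N @[N --> \oo] --> - (c * kap * M).
  rewrite (_ : series _ = (fun N => - (c * kap * series (fun k : nat => B k) N))).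
    apply: cvgN; apply: cvgM; first exact: cvg_cst.
    by have := shift B M sB; rewrite B0 add0r.
  by apply/funext => N; rewrite /series /= mulr_sumr sumrN.
have hu2 : series (fun k : nat => u (Negz k)) N @[N --> \oo] --> c * kap * L.
  rewrite (_ : series _ = (fun N => c * kap * \sum_(k < N) A k.+1%:Z)).
    by apply: cvgM; [exact: cvg_cst|exact: sA].
  apply/funext => N; rewrite /series /= big_mkord mulr_sumr.
  by apply: eq_bigr => k _; rewrite /u NegzE A_even.
have hv2 : series (fun k : nat => v (Negz k)) N @[N --> \oo] --> c * kap * M.
  rewrite (_ : series _ = (fun N => c * kap * \sum_(k < N) B k.+1%:Z)).
    by apply: cvgM; [exact: cvg_cst|exact: sB].
  apply/funext => N; rewrite /series /= big_mkord mulr_sumr.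
  by apply: eq_bigr => k _; rewrite /v NegzE B_odd mulrN opprK.
rewrite termE /bi_series !series_complex (lim_complex hu1 hv1) (lim_complex hu2 hv2).
rewrite -[LHS]/(Complex (c * kap * (A 0 + L) + c * kap * L) (- (c * kap * M) + c * kap * M)).
congr (_ +i* _); last by rewrite addNr.
(* Both halves together give A 0 + 2 L = 2 pi ga 0, and the factor [kap] = dd / (2 pi) reduces this
   to dd times [ga 0]. *)
have -> : profile p (expR (- dd)) m a b (expR x) = ga 0 by rewrite /ga /profile_circle mulr0 addr0.
have pin : pi != 0 :> R by rewrite gt_eqF // pi_gt0.
by rewrite /L /kap; move: (pi) pin => q qn; field.
Qed.

End FluctuationFunction.

(** * Convergence *)

Section MeanFluctuation.
Context {R : realType} {d : measure_display} {Omega : measurableType d}.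
Variable P : probability Omega R.
Variable X : nat -> nat -> {RV P >-> bool}.
Variables (p : R) (t : bintree).
Hypotheses (p0 : 0 < p) (p1 : p < 1) (hX : iid_Be_bits X p) (ft : full_tree t).
Hypothesis m2 : (1 < nleaves t)%N.
Local Notation m := (nleaves t).

Let inv0 : n%:R^-1 @[n --> \oo] --> (0 : R).
Proof. by apply/gtr0_cvgV0; [exists 1%N => // n /= n0; rewrite ltr0n|exact: cvgr_idn]. Qed.

Let mean_quotient (g : R -> R) :
  (forall e : R, 0 < e -> exists Z : R, forall z, Z <= z -> `|ratio p m z - g z| <= e) ->
  (m%:R * mean_copies p t n / n%:R - m%:R * (pi_tree X t / m`!%:R * g n%:R)) @[n --> \oo] --> (0 : R).
Proof.
move=> hg; have [C hC] := mean_copies_approx p0 p1 m2 ft erefl.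
have mE := pi_tree_mean_toll p0 p1 hX m2.
set K := pi_tree X t / m`!%:R.
have h1 : (mean_copies p t n - K * renew p (toll_fun m) n%:R) / n%:R @[n --> \oo] --> (0 : R).
  apply/norm_cvg0P; apply: (squeeze_cvgr (f := fun _ : nat => 0 : R) (h := fun n => C * n%:R^-1)).
  - exists 1%N => // n /= n0; rewrite normr_ge0 normrM normfV (ger0_norm (ler0n _ _)).
    by rewrite ler_wpM2r ?invr_ge0 ?ler0n // /K mE; exact: hC.
  - exact: cvg_cst.
  - by rewrite -[X in _ --> X](mulr0 C); exact: (cvgM (cvg_cst C) inv0).
have h2 : ratio p m n%:R - g n%:R @[n --> \oo] --> (0 : R).
  apply/cvgr0Pnorm_le => e e0; have [Z hZ] := hg e e0.
  near=> n; apply: hZ; near: n.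
  exact: nbhs_infty_ger.
rewrite (_ : (fun n : nat => _) = (fun n => m%:R * ((mean_copies p t n - K * renew p (toll_fun m) n%:R) / n%:R) +
    m%:R * K * (ratio p m n%:R - g n%:R))).
  rewrite -[X in _ --> X](_ : m%:R * 0 + m%:R * K * 0 = 0); last by rewrite !mulr0 addr0.
  exact: (cvgD (cvgM (cvg_cst _) h1) (cvgM (cvg_cst _) h2)).
by apply/funext => n; rewrite /ratio; ring.
Unshelve. all: by end_near. Qed.

(** A real function [psi] represents [psiE] in both the aperiodic and the periodic case, so the
    final argument needs neither the case distinction nor complex limits. *)
Lemma mean_fluctuation : exists2 psi : R -> R, (forall x, psiE X p t x = (psi x)%:C%C) &
  (m%:R * mean_copies p t n / n%:R - m%:R / entropy p * psi (ln n%:R)) @[n --> \oo] --> (0 : R).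
Proof.
have H0 := entropy_gt0 p0 p1.
suff [g hg hr] : exists2 g : R -> R,
    forall x, psiE X p t x = (pi_tree X t / m`!%:R * g x)%:C%C &
    forall e : R, 0 < e -> exists Z : R, forall z, Z <= z -> `|ratio p m z - g (ln z) / entropy p| <= e.
  exists (fun x => pi_tree X t / m`!%:R * g x) => //.
  rewrite (_ : (fun n : nat => _) = (fun n => m%:R * mean_copies p t n / n%:R -
    m%:R * (pi_tree X t / m`!%:R * (g (ln n%:R) / entropy p)))); first exact: (mean_quotient hr).
  by apply/funext => n; ring.
have [ap|np] := pselect (aperiodic p).
  exists (fun=> (m - 2)`!%:R) => [x|e e0]; first exact: psiE_aperiodic.
  exact: ratio_aperiodic.
have [a [b [d0 a0 ab pE qE]]] := periodic_span p0 p1 np.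
have rho1 : expR (- log_span p) < 1 by rewrite expR_lt1 oppr_lt0.
exists (fun x => log_span p * profile p (expR (- log_span p)) m a b (expR x)) => [x|e e0].
  exact: psiE_periodic.
have [Z hZ] := ratio_periodic p0 p1 m2 (expR_gt0 _) rho1 a0 ab pE qE e0.
exists (Num.max Z 1) => z; rewrite ge_max => /andP[Zz z1]; have z0 : 0 < z by lra.
rewrite lnK ?posrE //; have := hZ z Zz.
(* The factor d in [psiE] cancels against the entropy, which is d times the normalization of the
   periodic limit. *)
have -> : entropy p = log_span p * (p * a%:R + (1 - p) * b%:R).
  have lE (r : R) k : r = expR (- log_span p) ^+ k -> ln r = - (k%:R * log_span p).
    by move=> ->; rewrite -expRM_natl expRK mulrN.
  by rewrite /entropy (lE _ _ pE) (lE _ _ qE); ring.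
by rewrite -mulf_div divff ?gt_eqF // mul1r.
Qed.

Lemma cond_concentration (eps : R) : 0 < eps ->
  fine (P [set w | eps < `|q_cond R (patricia X n w) t - m%:R * mean_copies p t n / n%:R|])
    @[n --> \oo] --> (0 : R).
Proof.
move=> e0; have [C hC] := var_copies_le p0 p1 ft m2.
have lnn : ln n%:R / n%:R @[n --> \oo] --> (0 : R).
  (* [ln (dl * n) <= dl * n] bounds ln n by dl n - ln dl; the other half of [e] is left for the
     constant. *)
  apply/cvgr0Pnorm_le => e e1; pose dl := e / 2; have dl0 : 0 < dl by rewrite divr_gt0.
  near=> n; have n1 : (0 < n)%N by near: n; exists 1%N.
  have n0 : 0 < n%:R :> R by rewrite ltr0n.
  have l0 : 0 <= ln n%:R :> R by rewrite ln_ge0 // ler1n.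
  rewrite ger0_norm ?divr_ge0 ?ler0n // ler_pdivrMr //.
  have h1 : ln (dl * n%:R) <= dl * n%:R by rewrite ltW // ln_sublinear // mulr_gt0.
  have h2 : - ln dl / dl <= n%:R by near: n; exact: nbhs_infty_ger.
  move: h1 h2; rewrite lnM ?posrE // ler_pdivrMr // /dl; lra.
pose K := m%:R ^+ 2 / eps ^+ 2.
apply: (squeeze_cvgr (f := fun _ : nat => 0 : R) (h := fun n => K * (C * (ln n%:R / n%:R) + m%:R * n%:R^-1))).
- exists 1%N => // n /= n1; have n0 : 0 < n%:R :> R by rewrite ltr0n.
  rewrite fine_ge0 //=; apply: (le_trans (q_cond_chebyshev p0 p1 hX ft m2 n1 e0)).
  rewrite (_ : K * _ = m%:R ^+ 2 * (C * (n%:R * ln n%:R) + m%:R * n%:R) / (n%:R ^+ 2 * eps ^+ 2)).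
    apply: ler_wpM2r; first by rewrite invr_ge0 mulr_ge0 ?sqr_ge0.
    by apply: ler_wpM2l; [exact: sqr_ge0|exact: hC].
  by rewrite /K; field; rewrite !gt_eqF.
- exact: cvg_cst.
- rewrite -[X in _ --> X](_ : K * (C * 0 + m%:R * 0) = 0); last by rewrite !mulr0 addr0 mulr0.
  exact: (cvgM (cvg_cst _) (cvgD (cvgM (cvg_cst _) lnn) (cvgM (cvg_cst _) inv0))).
Unshelve. all: by end_near. Qed.

Lemma cond_op1 (l : nat -> R) :
  m%:R * mean_copies p t n / n%:R - l n @[n --> \oo] --> (0 : R) ->
  is_op1 P (fun n w => q_cond R (patricia X n w) t - l n).
Proof.
move=> hl eps e0; have e2 : 0 < eps / 2 by rewrite divr_gt0.
have mP n (a c : R) : measurable [set w | a < `|q_cond R (patricia X n w) t - c|].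
  exact: (measurable_random_trie X n (fun T => a < `|q_cond R (compression T) t - c|)).
have fP n (a c : R) : P [set w | a < `|q_cond R (patricia X n w) t - c|] \is a fin_num.
  by apply: fin_num_measure; exact: mP.
apply/fine_cvgP; split; first by exists 0%N => // n _; exact: fP.
apply: (squeeze_cvgr (f := fun _ : nat => 0 : R) (h := fun n =>
  fine (P [set w | eps / 2 < `|q_cond R (patricia X n w) t - m%:R * mean_copies p t n / n%:R|]))).
- move/cvgr0Pnorm_lt: hl => /(_ _ e2) hl; near=> n.
  have hn : `|m%:R * mean_copies p t n / n%:R - l n| < eps / 2 by near: n.
  rewrite /= fine_ge0 //= fine_le ?fP // le_measure ?inE //.
  move=> w /= h1; have := ler_distD (m%:R * mean_copies p t n / n%:R) (q_cond R (patricia X n w) t) (l n).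
  by lra.
- exact: cvg_cst.
- exact: cond_concentration.
Unshelve. all: by end_near. Qed.

End MeanFluctuation.

Theorem corollary3p7 (R : realType) (d : measure_display)
    (Omega : measurableType d) (P : probability Omega R)
    (X : nat -> nat -> {RV P >-> bool}) (p : R) (t : bintree) :
  0 < p -> p < 1 -> iid_Be_bits X p -> full_tree t ->
  ((1 < nleaves t)%N ->
    is_op1 P (fun n w =>
      (q_cond R (patricia X n w) t)%:C -
      ((nleaves t)%:R / entropy p)%:C * psiE X p t (ln n%:R)) /\
    ((q_mean P (patricia X n) t)%:C -
      ((nleaves t)%:R / entropy p)%:C * psiE X p t (ln n%:R) : R[i]^o)
      @[n --> \oo] --> (0 : R[i]^o) /\
    (aperiodic p ->
      is_op1 P (fun n w =>
        q_cond R (patricia X n w) t -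
        pi_tree X t / (((nleaves t)%:R - 1) * entropy p)) /\
      q_mean P (patricia X n) t @[n --> \oo] -->
        pi_tree X t / (((nleaves t)%:R - 1) * entropy p))) /\
  (nleaves t = 1%N ->
    forall n, (0 < n)%N -> q_mean P (patricia X n) t = 1).
Proof.
move=> p0 p1 hX ft; split=> [m2|m1 n n0]; last exact: (q_mean_leaf p0 p1 hX ft m1 n0).
have [psi psiR hpsi] := mean_fluctuation p0 p1 hX ft m2.
have qE := q_mean_copies p0 p1 hX ft m2.
have qlim (l : nat -> R) : (nleaves t)%:R * mean_copies p t n / n%:R - l n @[n --> \oo] --> (0 : R) ->
    q_mean P (patricia X n) t - l n @[n --> \oo] --> (0 : R).
  by rewrite (_ : (fun n => q_mean P (patricia X n) t - l n) = (fun n => (nleaves t)%:R * mean_copies p t n / n%:R - l n)) //;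
    apply/funext => n; rewrite qE.
split.
  (* A positive [eps] of [R[i]] is real, and [psiR] makes the difference real as well, so its
     modulus is an absolute value. *)
  move=> eps; rewrite ltcE => /andP[/eqP i0 e0].
  have := cond_op1 p0 p1 hX ft m2 hpsi e0.
  rewrite (_ : (fun n => P _) = (fun n => P [set w | eps < `|(q_cond R (patricia X n w) t)%:C -
      ((nleaves t)%:R / entropy p)%:C * psiE X p t (ln n%:R)|])) //.
  apply/funext => n; congr (P _); apply/seteqP.
  suff E w : (complex.Re eps < `|q_cond R (patricia X n w) t - (nleaves t)%:R / entropy p * psi (ln n%:R)|) =
      (eps < `|(q_cond R (patricia X n w) t)%:C - ((nleaves t)%:R / entropy p)%:C * psiE X p t (ln n%:R)|).
    by split => w /=; rewrite E.
  by rewrite psiR -rmorphM -rmorphB normc_def ltcE /= i0 eqxx /= expr0n addr0 sqrtr_sqr.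
split.
  have E : (fun n => (q_mean P (patricia X n) t)%:C -
      ((nleaves t)%:R / entropy p)%:C * psiE X p t (ln n%:R) : R[i]^o) =
      (fun n => (q_mean P (patricia X n) t - (nleaves t)%:R / entropy p * psi (ln n%:R)) +i* 0 : R[i]^o).
    by apply/funext => n; rewrite psiR -rmorphM -rmorphB.
  by rewrite E; exact: (cvg_complex (qlim _ hpsi) (cvg_cst (0 : R))).
move=> ap.
have cE n : (nleaves t)%:R / entropy p * psi (ln n%:R) = pi_tree X t / (((nleaves t)%:R - 1) * entropy p).
  have /(congr1 (@complex.Re R)) /= -> : (psi (ln n%:R))%:C = (pi_tree X t / (nleaves t)`!%:R * (nleaves t - 2)`!%:R)%:C.
    by rewrite -psiR; exact: psiE_aperiodic.
  have [k mE] : exists k, nleaves t = k.+2 by exists (nleaves t - 2)%N; move: m2; lia.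
  rewrite mE subSS subSS subn0 !factS !natrM -natr1 addrK.
  have k0 : k`!%:R != 0 :> R by rewrite pnatr_eq0 -lt0n fact_gt0.
  have k1 : k.+1%:R != 0 :> R by rewrite pnatr_eq0.
  have k2 : k.+1%:R + 1 != 0 :> R by rewrite natr1 pnatr_eq0.
  have H0 : entropy p != 0 by rewrite gt_eqF // entropy_gt0.
  by move: (k.+1%:R) (k`!%:R) k0 k1 k2 => y z z0 y0 y1; field; rewrite ?z0 ?y0 ?y1 ?H0.
have hc : (nleaves t)%:R * mean_copies p t n / n%:R -
    pi_tree X t / (((nleaves t)%:R - 1) * entropy p) @[n --> \oo] --> (0 : R).
  by move: hpsi; under eq_fun do rewrite cE.
split; first exact: (cond_op1 p0 p1 hX ft m2 hc).
exact/subr_cvg0/(qlim (fun=> _) hc).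
Qed.
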